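(* Let $S$ be a multiplicative set of positive integers satisfying Condition B with constants $\delta>0,\rho>0$. Then $$\sum_{n\le x}\frac{\Lambda_S(n)}{n}=\delta\log x-\gamma_S+O\Big(\frac{1}{\log^{\rho}x}\Big).$$ Moreover, $$\gamma_S=-\delta\gamma+\sum_{n=1}^{\infty}\frac{\delta-\Lambda_S(n)}{n},$$ where $\gamma$ is Euler's constant. If furthermore $S$ is the multiplicative semigroup generated by $q_1,q_2,\ldots$, then $$\gamma_S=\lim_{x\to\infty}\Big(\delta\log x-\sum_{q_i\le x}\frac{\log q_i}{q_i-1}\Big).$$
   Context: A set $S$ of positive integers is multiplicative if for all coprime $m,n$ one has $mn\in S$ iff $m\in S$ and $n\in S$ (and $1\in S$). $\pi_S(x)$ denotes the number of primes $p\le x$ in $S$, and $\mathrm{Li}(x)=\int_2^x dt/\log t$. $S$ satisfies Condition B if there are fixed $\delta>0,\rho>0$ with $\pi_S(x)=\delta\,\mathrm{Li}(x)+O(x/\log^{2+\rho}x)$. Let $L_S(s)=\sum_{n\in S}n^{-s}$ for $\mathrm{Re}(s)>1$, and define $\Lambda_S(n)$ by $-L_S'(s)/L_S(s)=\sum_{n\ge1}\Lambda_S(n)n^{-s}$. The Euler–Kronecker constant is $\gamma_S=\lim_{s\to1^+}\big(L_S'(s)/L_S(s)+\delta/(s-1)\big)$. In the semigroup case the generators $q_i$ are understood to be powers of pairwise distinct primes, so that $L_S(s)=\prod_i(1-q_i^{-s})^{-1}$. *)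

(* Defs.v *)
(* Number theory on nat (prime, coprime, big products) is from MathComp; sets of
   naturals are MathComp's classical [set nat], whose membership test [n \in S]
   is a boolean; the analysis is over Stdlib's R, with Coquelicot. *)
From Stdlib Require Import Reals ClassicalEpsilon.
From Coquelicot Require Import Coquelicot.
From mathcomp Require Import all_boot.
From mathcomp Require Import boolp classical_sets.

Local Open Scope R_scope.

Definition multiplicative_set (S : set nat) : Prop :=
  ~ S 0%N /\ S 1%N /\
  forall m n : nat, coprime m n -> (S (m * n)%N <-> S m /\ S n).

(* Equals floor x for x >= 0, and 0 for x < 0. *)
Definition nat_floor (x : R) : nat := Z.to_nat (Int_part x).

Definition prime_count (S : set nat) (x : R) : nat :=
  count (fun p => prime p && (p \in S)) (iota 1 (nat_floor x)).

Definition Li (x : R) : R := RInt (fun t => / ln t) 2 x.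

(* f x = O(g x) as x -> +oo. *)
Definition bigO_pinfty (f g : R -> R) : Prop :=
  exists K : R, Rbar_locally p_infty (fun x => Rabs (f x) <= K * Rabs (g x)).

Definition condition_B (S : set nat) (delta rho : R) : Prop :=
  0 < delta /\ 0 < rho /\
  bigO_pinfty (fun x => INR (prime_count S x) - delta * Li x)
              (fun x => x / Rpower (ln x) (2 + rho)).

(* n^{-s} = exp(-s log n) for n >= 1, split into modulus and argument. *)
Definition npow_opp (n : nat) (s : C) : C :=
  (exp (- Re s * ln (INR n)) *
   (cos (Im s * ln (INR n)) - Ci * sin (Im s * ln (INR n))))%C.

Definition L_term (S : set nat) (s : C) (n : nat) : C :=
  if n \in S then npow_opp n s else 0%C.

(* L_S(s), the sum being taken componentwise; meaningful for Re s > 1. *)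
Definition L_fun (S : set nat) (s : C) : C :=
  (Series (fun k => Re (L_term S s k.+1)), Series (fun k => Im (L_term S s k.+1))).

Definition is_Lambda (S : set nat) (Lam : nat -> R) : Prop :=
  forall s : C, 1 < Re s ->
    is_series (fun k => (RtoC (Lam k.+1) * npow_opp k.+1 s)%C)
              (- (C_derive (L_fun S) s / L_fun S s))%C.

(* The coefficients Lambda_S(n), n >= 1, which the expansion of -L_S'/L_S into a
   Dirichlet series determines uniquely; the value at 0 is unconstrained and is
   never used. *)
Definition Lambda (S : set nat) : nat -> R :=
  epsilon (inhabits (fun _ => 0)) (is_Lambda S).

Definition is_Euler_Kronecker (S : set nat) (delta g : R) : Prop :=
  filterlim (fun s : R => (C_derive (L_fun S) (RtoC s) / L_fun S (RtoC s)
                           + RtoC (delta / (s - 1)))%C)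
            (at_right 1) (locally (RtoC g)).

Definition euler_gamma : R :=
  real (Lim_seq (fun n => sum_n_m (fun k => / INR k) 1 n - ln (INR n))).

Definition distinct_prime_powers (q : nat -> nat) : Prop :=
  exists p e : nat -> nat,
    injective p /\
    forall i, prime (p i) /\ (0 < e i)%N /\ q i = (p i ^ e i)%N.

(* The empty product is allowed, so 1 belongs to the semigroup. *)
Definition semigroup_generated (q : nat -> nat) : set nat :=
  fun n => exists l : seq nat, n = (\prod_(i <- l) q i)%N.

(* Sum over the indices i with q i <= x: a finite sum if q is injective. *)
Definition sum_generators_le (q : nat -> nat) (f : nat -> R) (x : R) : R :=
  Series (fun i => if Rle_dec (INR (q i)) x then f (q i) else 0).

(* Main.v *)
Require Import Defs.
From Stdlib Require Import Znat Reals Lra Lia ClassicalEpsilon.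
From Coquelicot Require Import Coquelicot.
From HB Require Import structures.
From mathcomp Require Import all_boot.
From mathcomp Require Import boolp classical_sets.

Local Open Scope R_scope.

(* For a prime p put f_p(z) = sum_k 1_S(p^k) z^k.  Then Lambda_S(p^k) = a_k log p, where
   the a_k are the coefficients of z f_p'/f_p, and 1_S * Lambda_S = 1_S log.  For Re s > 1
   this gives -L_S' = L_S D with D = sum Lambda_S(n) n^-s absolutely convergent; as a linear
   differential equation on horizontal half-lines it also shows that L_S has no zero there.
   Since |a_k| << (7/4)^k, the proper prime powers contribute an absolutely convergent sum
   with tail O(x^(-1/8)), while the primes are handled by partial summation from Condition B:
   with R(n) the error term, R(n) log n / n is O(log^(-1-rho) n) and
   R(n) (g(n+1) - g(n)), g(n) = log n / n, is O(1 / (n log^(1+rho) n)).  Hence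
   sum_{n <= x} Lambda_S(n)/n - delta log x tends to a limit l at the rate log^(-rho) x, and
   Abel's theorem at s = 1 identifies -l with the Euler-Kronecker constant.  For a semigroup,
   sum_{q_i <= x} log q_i / (q_i - 1) differs from sum_{n <= x} Lambda_S(n)/n only by the
   geometric tails q_i^k > x, which are O(x^(-1/4)) in total. *)

(** * Finite sums and power estimates *)

(** The obstacle is the prime 2 at s = 1. Taken at face value the recurrence for a_k yields only
    |a_k| <= 2^k - 1, and 2^k is just what division by n = 2^k fails to beat. With 7/4 in place of 2
    the ratio 7/4 * 2^(-7/8) is below 1, and the exponent 1/8 left over turns mere convergence over
    proper prime powers into a rate. Since [Lambda] is chosen by [epsilon], nothing is known of it
    until some expansion of -L_S'/L_S has been exhibited at every complex s with Re s > 1 and its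
    coefficients have been shown to be determined. This is why L_S must be nonzero off the real axis
    as well. No Euler product is formed: f_p occurs only through its coefficients, and the
    convolution identity is the one link between local and global data. Integral tests are replaced
    by mean value estimates whose right-hand sides telescope, so that every tail comes with an
    explicit bound. *)

Fact RplusA : associative Rplus.
Proof. by move=> x y z; rewrite Rplus_assoc. Qed.

HB.instance Definition _ := Monoid.isComLaw.Build R 0 Rplus RplusA Rplus_comm Rplus_0_l.
HB.instance Definition _ := Monoid.isMulLaw.Build R 0 Rmult Rmult_0_l Rmult_0_r.
HB.instance Definition _ :=
  Monoid.isAddLaw.Build R Rmult Rplus Rmult_plus_distr_r Rmult_plus_distr_l.

Notation "\sum_ ( i <- r | P ) F" := (\big[Rplus/0]_(i <- r | P%B) F) : R_scope.
Notation "\sum_ ( m <= i < n | P ) F" := (\big[Rplus/0]_(m <= i < n | P%B) F) : R_scope.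
Notation "\sum_ ( m <= i < n ) F" := (\big[Rplus/0]_(m <= i < n) F) : R_scope.

Lemma rsum_le (I : eqType) (r : seq I) (P : pred I) (f g : I -> R) :
  (forall i, i \in r -> P i -> f i <= g i) ->
  \sum_(i <- r | P i) f i <= \sum_(i <- r | P i) g i.
Proof.
move=> h; rewrite big_seq_cond [X in _ <= X]big_seq_cond.
apply: (big_ind2 (fun x y => x <= y)); first lra.
- by move=> x1 x2 y1 y2 *; lra.
- by move=> i /andP[? ?]; apply: h.
Qed.

Lemma rsum_ge0 (I : eqType) (r : seq I) (P : pred I) (f : I -> R) :
  (forall i, i \in r -> P i -> 0 <= f i) -> 0 <= \sum_(i <- r | P i) f i.
Proof.
move=> h; rewrite big_seq_cond; apply: (big_ind (fun x => 0 <= x)); first lra.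
- by move=> x y *; lra.
- by move=> i /andP[? ?]; apply: h.
Qed.

Lemma rsum_abs (I : eqType) (r : seq I) (P : pred I) (f : I -> R) :
  Rabs (\sum_(i <- r | P i) f i) <= \sum_(i <- r | P i) Rabs (f i).
Proof.
apply: (big_ind2 (fun x y => Rabs x <= y)).
- rewrite Rabs_R0; lra.
- by move=> x1 x2 y1 y2 h1 h2; apply: Rle_trans (Rabs_triang _ _) _; lra.
- by move=> i _; lra.
Qed.

Lemma rsum_subpred (I : eqType) (r : seq I) (P Q : pred I) (f : I -> R) :
  (forall i, i \in r -> P i -> Q i) -> (forall i, i \in r -> Q i -> 0 <= f i) ->
  \sum_(i <- r | P i) f i <= \sum_(i <- r | Q i) f i.
Proof.
move=> hPQ hf; rewrite big_mkcond [X in _ <= X]big_mkcond.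
apply: rsum_le => i ir _; case: ifP => hP.
  by rewrite (hPQ i ir hP); lra.
case: ifP => hQ; last lra.
exact: hf.
Qed.

Lemma rsum_recr m n (f : nat -> R) : (m <= n)%N ->
  \sum_(m <= i < n.+1) f i = \sum_(m <= i < n) f i + f n.
Proof. exact: big_nat_recr. Qed.

Lemma rsum_cat n m p (f : nat -> R) : (m <= n)%N -> (n <= p)%N ->
  \sum_(m <= i < p) f i = \sum_(m <= i < n) f i + \sum_(n <= i < p) f i.
Proof. exact: big_cat_nat. Qed.

Lemma rsumD (I : Type) (r : seq I) (P : pred I) (f g : I -> R) :
  \sum_(i <- r | P i) (f i + g i) = \sum_(i <- r | P i) f i + \sum_(i <- r | P i) g i.
Proof. exact: big_split. Qed.

Lemma rsum_distrr (I : Type) (r : seq I) (P : pred I) (f : I -> R) a :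
  \sum_(i <- r | P i) a * f i = a * \sum_(i <- r | P i) f i.
Proof. exact/esym/big_distrr. Qed.

Lemma rsumB (I : Type) (r : seq I) (P : pred I) (f g : I -> R) :
  \sum_(i <- r | P i) (f i - g i) = \sum_(i <- r | P i) f i - \sum_(i <- r | P i) g i.
Proof.
rewrite rsumD; congr (_ + _); apply: (big_ind2 (fun x y => x = - y)) => //; first lra.
by move=> x1 x2 y1 y2 -> ->; lra.
Qed.

Lemma rsum_single (I : eqType) (r : seq I) (P : pred I) (f : I -> R) j :
  uniq r -> j \in r -> P j -> (forall i, i \in r -> P i -> i != j -> f i = 0) ->
  \sum_(i <- r | P i) f i = f j.
Proof.
move=> ur jr Pj hf; rewrite big_mkcond (bigD1_seq j) //= Pj big1_seq ?Rplus_0_r //.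
by move=> i /andP[ij ir]; case: ifP => // Pi; apply: hf.
Qed.

Lemma rsum_range_le m n N (f : nat -> R) : (n <= N)%N ->
  (forall i, (m <= i)%N -> 0 <= f i) ->
  \sum_(m <= i < n) f i <= \sum_(m <= i < N) f i.
Proof.
move=> hnN hf; have [hmn|hnm] := leqP m n.
  rewrite [X in _ <= X](@big_cat_nat _ _ _ n) //=.
  have : 0 <= \sum_(n <= i < N) f i.
    by apply: rsum_ge0 => i; rewrite mem_index_iota => /andP[hi _] _; apply: hf; apply: leq_trans hi.
  lra.
rewrite big_geq; last exact: ltnW.
by apply: rsum_ge0 => i; rewrite mem_index_iota => /andP[hi _] _; apply: hf.
Qed.

Lemma sum_n_m_big (f : nat -> R) m n : sum_n_m f m n = \sum_(m <= i < n.+1) f i.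
Proof.
have [hmn|hnm] := leqP m n.
  elim: n hmn => [|n IH] hmn.
    by move: hmn; rewrite leqn0 => /eqP ->; rewrite sum_n_n big_nat1.
  move: hmn; rewrite leq_eqVlt => /orP[/eqP->|hmn].
    by rewrite sum_n_n big_nat1.
  rewrite sum_n_Sm; last by apply/leP; apply: ltnW.
  by rewrite IH // [RHS]big_nat_recr //=; apply: ltnW.
rewrite sum_n_m_zero; last by apply/ltP.
by rewrite big_geq.
Qed.

Lemma sum_n_shift_big (f : nat -> R) n :
  sum_n (fun k => f k.+1) n = \sum_(1 <= i < n.+2) f i.
Proof. by rewrite /sum_n sum_n_m_big [RHS]big_add1. Qed.

(** Series over n >= 1 have the summand [f k.+1], so their partial sum of index N runs up to n = N +
    1; the limit absorbs this shift. *)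
Lemma is_series_bigP (f : nat -> R) l :
  is_series (fun k => f k.+1) l <->
  is_lim_seq (fun N => \sum_(1 <= i < N.+1) f i) l.
Proof.
have e n : sum_n (fun k => f k.+1) n = \sum_(1 <= i < n.+2) f i := sum_n_shift_big f n.
split => [h|/is_lim_seq_incr_1 h].
  apply/is_lim_seq_incr_1.
  have h' : is_lim_seq (sum_n (fun k => f k.+1)) l by exact: h.
  by apply: is_lim_seq_ext h' => n; rewrite e.
have : is_lim_seq (sum_n (fun k => f k.+1)) l.
  by apply: is_lim_seq_ext h => n; rewrite e.
by [].
Qed.

Lemma sum_le_Series (f : nat -> R) N :
  (forall n, (0 < n)%N -> 0 <= f n) -> ex_series (fun k => f k.+1) ->
  \sum_(1 <= i < N) f i <= Series (fun k => f k.+1).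
Proof.
move=> f0 /Series_correct /is_series_bigP h.
suff : Rbar_le (\sum_(1 <= i < N) f i) (Series (fun k => f k.+1)) by [].
apply: (is_lim_seq_le_loc (fun=> _) _ _ _ _ (is_lim_seq_const _) h).
exists N => n /leP hn; apply: rsum_range_le => //.
exact: leq_trans hn _.
Qed.

Lemma Series_ge0 (f : nat -> R) :
  (forall n, (0 < n)%N -> 0 <= f n) -> ex_series (fun k => f k.+1) ->
  0 <= Series (fun k => f k.+1).
Proof.
by move=> f0 hf; apply: Rle_trans (sum_le_Series f 1 f0 hf); rewrite big_geq //; lra.
Qed.

Lemma nonneg_series_bounded (f : nat -> R) B :
  (forall n, (0 < n)%N -> 0 <= f n) -> (forall N, \sum_(1 <= i < N.+1) f i <= B) ->
  ex_series (fun k => f k.+1).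
Proof.
move=> f0 hB.
have [l hl] : ex_finite_lim_seq (fun N => \sum_(1 <= i < N.+1) f i).
  apply: (ex_finite_lim_seq_incr _ B) => // n.
  rewrite [X in _ <= X]big_nat_recr //=; have := f0 n.+1 isT; lra.
by exists l; apply/is_series_bigP.
Qed.

Lemma rsum_telescope (f : nat -> R) m n : (m <= n)%N ->
  \sum_(m <= i < n) (f i - f i.+1) = f m - f n.
Proof.
move=> hmn; rewrite -(subnKC hmn); elim: (n - m)%N => [|k IH].
  rewrite addn0 big_geq //; lra.
rewrite addnS big_nat_recr ?leq_addr //= IH; lra.
Qed.

Lemma INR_gt0 n : (0 < n)%N -> 0 < INR n.
Proof. by move=> hn; apply: lt_0_INR; apply/ltP. Qed.

Lemma INR_ge1 n : (0 < n)%N -> 1 <= INR n.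
Proof. by move=> hn; apply: (le_INR 1); apply/leP. Qed.

Lemma leq_INR m n : (m <= n)%N -> INR m <= INR n.
Proof. by move=> hn; apply: le_INR; apply/leP. Qed.

Lemma INR_ge2 n : (1 < n)%N -> 2 <= INR n.
Proof. by move=> /leq_INR; rewrite [INR 2]/=; lra. Qed.

Lemma ltn_INR m n : (m < n)%N -> INR m < INR n.
Proof. by move=> hn; apply: lt_INR; apply/ltP. Qed.

Lemma Rpower_pos x y : 0 < Rpower x y. Proof. exact: exp_pos. Qed.

Lemma ln_le_minus1 x : 0 < x -> ln x <= x - 1.
Proof. move=> hx; have := exp_ineq1_le (ln x); rewrite exp_ln //; lra. Qed.

Lemma ln_ge0 x : 1 <= x -> 0 <= ln x.
Proof. by move=> hx; rewrite -ln_1; apply: ln_le; lra. Qed.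

Lemma ln_gt0 x : 1 < x -> 0 < ln x.
Proof. by move=> hx; rewrite -ln_1; apply: ln_increasing; lra. Qed.

Lemma ln_INR_ge0 n : (0 < n)%N -> 0 <= ln (INR n).
Proof. by move=> hn; apply: ln_ge0; apply: INR_ge1. Qed.

Lemma ln_le_Rpower x b : 0 < x -> 0 < b -> ln x <= / b * Rpower x b.
Proof.
move=> hx hb; have e : ln x = / b * ln (Rpower x b) by rewrite ln_exp; field; lra.
rewrite {1}e; apply: Rmult_le_compat_l.
  by left; apply: Rinv_0_lt_compat.
have := ln_le_minus1 _ (Rpower_pos x b); lra.
Qed.

(** The bound ln x <= x^c / c with c = b/a, raised to the power a. The explicit constant is what
    later converts power savings into logarithmic ones. *)
Lemma Rpower_ln_le x a b : 1 < x -> 0 < a -> 0 < b ->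
  Rpower (ln x) a <= Rpower (a / b) a * Rpower x b.
Proof.
move=> hx ha hb.
have hab : 0 < b / a by apply: Rdiv_lt_0_compat.
have e : Rpower x b = Rpower (Rpower x (b / a)) a.
  by rewrite Rpower_mult; congr Rpower; field; lra.
rewrite e Rpower_mult_distr; [|exact: Rdiv_lt_0_compat|exact: Rpower_pos].
apply: Rle_Rpower_l; first lra.
split; first exact: ln_gt0.
have -> : a / b = / (b / a) by field; lra.
apply: ln_le_Rpower => //; lra.
Qed.

Lemma Rpower_decreasing x y a : 0 < x <= y -> 0 <= a -> Rpower y (- a) <= Rpower x (- a).
Proof.
move=> [hx hxy] ha; rewrite !Rpower_Ropp; apply: Rinv_le_contravar.
  exact: Rpower_pos.
exact: Rle_Rpower_l.
Qed.

(** By the mean value theorem the difference equals a c^(-1-a) for some c < x + 1. Summed over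
    integers x the right-hand side telescopes, which replaces the integral test for the zeta
    series. *)
Lemma Rpower_neg_diff x a : 0 < x -> 0 < a ->
  Rpower (x + 1) (- (1 + a)) <= / a * (Rpower x (- a) - Rpower (x + 1) (- a)).
Proof.
move=> hx ha.
have hd c : x <= c <= x + 1 ->
    derivable_pt_lim (fun t => Rpower t (- a)) c (- a * Rpower c (- a - 1)).
  by move=> hc; apply: derivable_pt_lim_power; lra.
have hx1 : x < x + 1 by lra.
have [c [hc1 hc2]] := MVT_cor2 _ _ _ _ hx1 hd.
have -> : Rpower x (- a) - Rpower (x + 1) (- a) = a * Rpower c (- (1 + a)).
  have -> : - (1 + a) = - a - 1 by lra.
  move: hc1 => /=; lra.
rewrite -Rmult_assoc Rinv_l ?Rmult_1_l; last lra.
apply: Rpower_decreasing; lra.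
Qed.

Lemma Rpower_INR1 a : Rpower (INR 1) a = 1.
Proof. by rewrite /Rpower ln_1 Rmult_0_r exp_0. Qed.

Lemma zeta_partial_le a N : 0 < a ->
  \sum_(1 <= n < N) Rpower (INR n) (- (1 + a)) <= 1 + / a.
Proof.
move=> ha; have ia := Rinv_0_lt_compat _ ha.
case: N => [|[|N]].
- rewrite big_geq //; lra.
- rewrite big_geq //; lra.
rewrite big_nat_recl // Rpower_INR1.
suff : \sum_(1 <= i < N.+1) Rpower (INR i.+1) (- (1 + a)) <= / a by lra.
apply: Rle_trans (_ : \sum_(1 <= i < N.+1)
   (/ a * Rpower (INR i) (- a) - / a * Rpower (INR i.+1) (- a)) <= _).
  apply: rsum_le => i; rewrite mem_index_iota => /andP[hi _] _.
  have := Rpower_neg_diff _ _ (INR_gt0 _ hi) ha.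
  rewrite S_INR; lra.
rewrite (rsum_telescope (fun i => / a * Rpower (INR i) (- a))) //.
rewrite Rpower_INR1.
have := Rpower_pos (INR N.+1) (- a); nra.
Qed.

Lemma ex_series_zeta a : 0 < a -> ex_series (fun k => Rpower (INR k.+1) (- (1 + a))).
Proof.
move=> ha; apply: (nonneg_series_bounded (fun n => Rpower (INR n) (- (1 + a))) (1 + / a)).
  by move=> n _; left; apply: Rpower_pos.
by move=> N; apply: zeta_partial_le.
Qed.

(** * Logarithmic derivatives of local factors *)

(** Course-of-values recursion made structural by carrying the list of all earlier coefficients. The
    recurrence compares coefficients in f * (z f'/f) = z f', whose constant term is 0. *)
Fixpoint logder_seq (b : nat -> R) (n : nat) : seq R :=
  if n is m.+1 then
    let s := logder_seq b m in
    rcons s (INR n * b n - \sum_(1 <= j < n) nth 0 s j * b (n - j)%N)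
  else [:: 0].

(* The coefficients of z f'(z) / f(z) for f(z) = sum_k b_k z^k with b_0 = 1. *)
Definition logder (b : nat -> R) (k : nat) : R := nth 0 (logder_seq b k) k.

Lemma size_logder_seq b n : size (logder_seq b n) = n.+1.
Proof. by elim: n => //= n IH; rewrite size_rcons IH. Qed.

Lemma nth_logder_seq b n k : (k <= n)%N -> nth 0 (logder_seq b n) k = logder b k.
Proof.
elim: n => [|n IH]; first by rewrite leqn0 => /eqP ->.
rewrite leq_eqVlt => /orP[/eqP -> //|kn].
by rewrite [logder_seq _ _]/= nth_rcons size_logder_seq kn IH.
Qed.

Lemma logderS b n :
  logder b n.+1 = INR n.+1 * b n.+1 - \sum_(1 <= j < n.+1) logder b j * b (n.+1 - j)%N.
Proof.
rewrite {1}/logder [logder_seq _ _]/= nth_rcons size_logder_seq ltnn eqxx.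
congr (_ - _); apply: eq_big_nat => j /andP[_ hj].
by rewrite nth_logder_seq.
Qed.

Lemma logder_conv b k : b 0%N = 1 ->
  \sum_(1 <= j < k.+1) logder b j * b (k - j)%N = INR k * b k.
Proof.
move=> b0; case: k => [|k]; first by rewrite big_geq //=; lra.
rewrite rsum_recr // subnn b0 logderS; rewrite /=; lra.
Qed.

(** With b_0 = 1 the convolution equations form a triangular system, so a guessed solution is the
    solution. The semigroup case computes its coefficients in this way. *)
Lemma logder_unique b a k : b 0%N = 1 ->
  (forall m, \sum_(1 <= j < m.+1) a j * b (m - j)%N = INR m * b m) ->
  (0 < k)%N -> logder b k = a k.
Proof.
move=> b0 ha; elim/ltn_ind: k => -[//|k] IH _.
have := ha k.+1; rewrite rsum_recr // subnn b0 logderS => <-.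
rewrite -[X in _ - X](eq_big_nat _ _ (F1 := fun j => a j * b (k.+1 - j)%N)).
  rewrite /=; lra.
by move=> j /andP[j0 jk]; rewrite IH.
Qed.

(* If b_1 = 0 the recurrence for the coefficient of z^k involves no coefficient of
   z^(k-1); if b_1 = 1 this is achieved by subtracting the preceding recurrence,
   i.e. by passing from f to (1 - z) f. *)
Lemma logder_rec_bound b k : (forall i, b i = 0 \/ b i = 1) -> b 0%N = 1 ->
  Rabs (logder b k.+2) <= INR k.+2 + \sum_(1 <= j < k.+1) Rabs (logder b j).
Proof.
move=> b01 b0.
have bnd c d : (forall j, (1 <= j < k.+1)%N -> Rabs (d j) <= 1) -> Rabs c <= INR k.+2 ->
    Rabs (c - \sum_(1 <= j < k.+1) logder b j * d j)
    <= INR k.+2 + \sum_(1 <= j < k.+1) Rabs (logder b j).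
  move=> hd hc.
  suff : Rabs (\sum_(1 <= j < k.+1) logder b j * d j) <=
    \sum_(1 <= j < k.+1) Rabs (logder b j).
    move=> h; apply: Rle_trans (Rabs_triang _ _) _; rewrite Rabs_Ropp; lra.
  apply: Rle_trans (rsum_abs _ _ _ _) _; apply: rsum_le => j.
  rewrite mem_index_iota => hj _; rewrite Rabs_mult.
  have := hd j hj; have := Rabs_pos (logder b j); nra.
have hb i : 0 <= b i <= 1 by case: (b01 i) => ->; lra.
have hk := pos_INR k.+1; have hkS := S_INR k.+1.
case: (b01 1%N) => b1.
  rewrite logderS rsum_recr // subSnn b1 Rmult_0_r.
  rewrite Rplus_0_r.
  apply: bnd => [j _|]; apply: Rabs_le.
    by have := hb (k.+2 - j)%N; lra.
  by case: (b01 k.+2) => ->; lra.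
have e : logder b k.+2 = (INR k.+2 * b k.+2 - INR k.+1 * b k.+1)
    - \sum_(1 <= j < k.+1) logder b j * (b (k.+2 - j)%N - b (k.+1 - j)%N).
  rewrite logderS -(logder_conv b k.+1) // !(rsum_recr 1 k.+1) //.
  rewrite subnn subSnn b0 b1.
  have -> : \sum_(1 <= j < k.+1) logder b j * (b (k.+2 - j)%N - b (k.+1 - j)%N) =
    \sum_(1 <= j < k.+1) logder b j * b (k.+2 - j)%N -
    \sum_(1 <= j < k.+1) logder b j * b (k.+1 - j)%N.
    by rewrite -rsumB; apply: eq_bigr => j _; lra.
  lra.
rewrite e; apply: bnd => [j _|]; apply: Rabs_le.
  have := hb (k.+2 - j)%N; have := hb (k.+1 - j)%N; lra.
by case: (b01 k.+2) => ->; case: (b01 k.+1) => ->; lra.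
Qed.

Lemma geom_sum_74 k : \sum_(1 <= j < k.+1) (7 / 4) ^ j <= 4 / 3 * (7 / 4) ^ k.+1.
Proof.
elim: k => [|k IH]; first by rewrite big_geq //=; lra.
rewrite rsum_recr // [_ ^ k.+2]/=; move: IH; rewrite /=; lra.
Qed.

(** The constant 5/7 is what the induction for 3 (7/4)^k leaves over: by [geom_sum_74] the earlier
    coefficients take 3 * 4/3 * 4/7 = 16/7 of (7/4)^(k+2), and 3 - 16/7 = 5/7. *)
Lemma nat_le_74 k : INR k.+2 <= 5 / 7 * (7 / 4) ^ k.+2.
Proof.
elim: k => [|k IH]; first by rewrite /=; lra.
have h : 1 <= INR k.+2 by apply: INR_ge1.
rewrite [INR _]S_INR; move: IH h; set x := INR k.+2; rewrite -[(_ ^ k.+3)]/(7 / 4 * (7 / 4) ^ k.+2).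
set y := _ ^ _; have : 2 <= x by rewrite /x !S_INR; have := pos_INR k; lra.
lra.
Qed.

(* The radius of convergence is at least 4/7 > 1/2, so the local series at p = 2 converges
   absolutely even at s = 1, with room for a factor n^(1/8). *)
Lemma logder_bound b k : (forall i, b i = 0 \/ b i = 1) -> b 0%N = 1 ->
  Rabs (logder b k) <= 3 * (7 / 4) ^ k.
Proof.
move=> b01 b0; elim/ltn_ind: k => -[|[|k]] IH.
- rewrite /logder /= Rabs_R0; lra.
- rewrite logderS big_geq //; case: (b01 1%N) => -> /=; apply: Rabs_le; lra.
have := logder_rec_bound b k b01 b0.
have : \sum_(1 <= j < k.+1) Rabs (logder b j) <= \sum_(1 <= j < k.+1) 3 * (7 / 4) ^ j.
  apply: rsum_le => j; rewrite mem_index_iota => /andP[_ hj] _; apply: IH.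
  exact: ltnW.
rewrite rsum_distrr.
have := geom_sum_74 k; have := nat_le_74 k; rewrite /=; lra.
Qed.

(** * The von Mangoldt function of a multiplicative set *)

Definition ind (S : set nat) (n : nat) : R := if n \in S then 1 else 0.

Definition local_coef (S : set nat) (p k : nat) : R := logder (fun j => ind S (p ^ j)) k.

(** For n = p^k with k > 0 the least prime divisor is p and its multiplicity is k, so the equality
    test detects prime powers. The value n = 1 passes it with [pdiv 1] = 1, and ln 1 = 0 gives the
    required 0. *)
Definition vonMangoldt (S : set nat) (n : nat) : R :=
  let p := pdiv n in let k := logn p n in
  if (n == p ^ k)%N then local_coef S p k * ln (INR p) else 0.

Lemma ind01 S n : ind S n = 0 \/ ind S n = 1.
Proof. by rewrite /ind; case: ifP; auto. Qed.

Lemma ind_bound S n : 0 <= ind S n <= 1.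
Proof. by case: (ind01 S n) => ->; lra. Qed.

Section MultiplicativeSet.
Variable S : set nat.
Hypothesis hS : multiplicative_set S.

Lemma ind1 : ind S 1 = 1.
Proof. by case: hS => _ [S1 _]; rewrite /ind; case: ifP => // /negP; rewrite in_setE. Qed.

Lemma indM m n : coprime m n -> ind S (m * n) = ind S m * ind S n.
Proof.
case: hS => _ [_ h] /h {}h; rewrite /ind.
have -> : ((m * n)%N \in S) = (m \in S) && (n \in S).
  apply/idP/andP; rewrite !in_setE; first by move/h.
  by move=> ?; apply/h.
by case: (m \in S); case: (n \in S) => /=; lra.
Qed.

Lemma local_coef_bound p k : Rabs (local_coef S p k) <= 3 * (7 / 4) ^ k.
Proof. by apply: logder_bound => [i|]; [exact: ind01|rewrite expn0 ind1]. Qed.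

Lemma local_coef1 p : local_coef S p 1 = ind S p.
Proof. by rewrite /local_coef logderS big_geq // expn1 /=; lra. Qed.

Lemma vonMangoldt_pfactor p k : prime p -> (0 < k)%N ->
  vonMangoldt S (p ^ k) = local_coef S p k * ln (INR p).
Proof.
move=> pp; case: k => // k _; rewrite /vonMangoldt.
by rewrite pdiv_pfactor // pfactorK // eqxx.
Qed.

Lemma vonMangoldt_prime p : prime p -> vonMangoldt S p = ind S p * ln (INR p).
Proof. by move=> pp; rewrite -{1}(expn1 p) vonMangoldt_pfactor // local_coef1. Qed.

Lemma vonMangoldt1 : vonMangoldt S 1 = 0.
Proof. have e : pdiv 1 = 1%N by [].
rewrite /vonMangoldt e; case: (_ == _) => //.
have -> : INR 1 = 1 by [].
by rewrite ln_1 Rmult_0_r.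
Qed.

Lemma vonMangoldt_cases n : (0 < n)%N ->
  vonMangoldt S n = 0 \/ exists p k, [/\ prime p, (0 < k)%N & n = (p ^ k)%N].
Proof.
rewrite leq_eqVlt => /orP[/eqP <-|n1]; first by left; rewrite vonMangoldt1.
have pp := pdiv_prime n1.
have [e|ne] := eqVneq n (pdiv n ^ logn (pdiv n) n)%N; last first.
  by left; rewrite /vonMangoldt (negbTE ne).
right; exists (pdiv n), (logn (pdiv n) n); split => //.
by rewrite lt0n; apply/eqP => e0; move: n1; rewrite e e0.
Qed.

Lemma prime_power_eq p q i j : prime p -> prime q -> (0 < i)%N -> (0 < j)%N ->
  (p ^ i = q ^ j)%N -> p = q /\ i = j.
Proof.
move=> pp pq; case: i => // i; case: j => // j _ _ e.
have epq : p = q by rewrite -(pdiv_pfactor i pp) e pdiv_pfactor.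
by split => //; rewrite -(pfactorK i.+1 pp) e epq pfactorK.
Qed.

(* Writing a value at a prime power as a double sum lets sums over n be exchanged
   with sums over the pairs (prime, exponent). *)
Lemma sum_prime_powers B n (F : nat -> nat -> R) p k :
  prime p -> (0 < k)%N -> n = (p ^ k)%N -> (n < B)%N ->
  \sum_(1 <= q < B | prime q) \sum_(1 <= j < B | n == (q ^ j)%N) F q j = F p k.
Proof.
move=> pp k0 e nB.
have pn : (p <= n)%N by rewrite e -{1}(expn1 p) leq_exp2l // prime_gt1.
have kn : (k < n)%N by rewrite e ltn_expl // prime_gt1.
rewrite (rsum_single _ _ _ _ p) ?iota_uniq //; last first.
- move=> q _ pq qp; apply: big1_seq => j /andP[/eqP ej].
  rewrite mem_index_iota => /andP[j0 _].
  have [epq _] := prime_power_eq _ _ _ _ pp pq k0 j0 (etrans (esym e) ej).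
  by rewrite epq eqxx in qp.
- by rewrite mem_index_iota prime_gt0 //= (leq_ltn_trans pn).
rewrite (rsum_single _ _ _ _ k) ?iota_uniq //; first by rewrite mem_index_iota k0 (ltn_trans kn).
  by rewrite e.
move=> j; rewrite mem_index_iota => /andP[j0 _] /eqP ej jk.
have [_ ekj] := prime_power_eq _ _ _ _ pp pp k0 j0 (etrans (esym e) ej).
by rewrite ekj eqxx in jk.
Qed.

Lemma sum_not_prime_power B n (F : nat -> nat -> R) :
  ~ (exists p k, [/\ prime p, (0 < k)%N & n = (p ^ k)%N]) ->
  \sum_(1 <= q < B | prime q) \sum_(1 <= j < B | n == (q ^ j)%N) F q j = 0.
Proof.
move=> h; apply: big1_seq => q /andP[pq _]; apply: big1_seq => j /andP[/eqP ej].
by rewrite mem_index_iota => /andP[j0 _]; case: h; exists q, j.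
Qed.

Lemma vonMangoldt_double B n : (0 < n < B)%N ->
  vonMangoldt S n = \sum_(1 <= p < B | prime p) \sum_(1 <= k < B | n == (p ^ k)%N)
                      local_coef S p k * ln (INR p).
Proof.
move=> /andP[n0 nB].
have [h|h] := pselect (exists p k, [/\ prime p, (0 < k)%N & n = (p ^ k)%N]).
  case: h => p [k [pp k0 e]].
  rewrite (sum_prime_powers B n (fun p k => local_coef S p k * ln (INR p)) p k) //.
  by rewrite e vonMangoldt_pfactor.
rewrite sum_not_prime_power //; case: (vonMangoldt_cases n n0) => // h'.
Qed.

Lemma ln_prod (I : Type) (r : seq I) (P : pred I) (f : I -> nat) :
  (forall i, P i -> (0 < f i)%N) ->
  ln (INR (\prod_(i <- r | P i) f i)%N) = \sum_(i <- r | P i) ln (INR (f i)).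
Proof.
move=> h; apply: (proj2 (_ : (0 < \prod_(i <- r | P i) f i)%N /\ _)).
elim: r => [|i r [IH0 IH]]; first by rewrite !big_nil ln_1.
rewrite !big_cons; case: ifP => // Pi; split; first by rewrite muln_gt0 h.
by rewrite mult_INR ln_mult ?IH //; apply: INR_gt0 => //; apply: h.
Qed.

Lemma INR_exp p k : INR (p ^ k)%N = INR p ^ k.
Proof. by elim: k => //= k IH; rewrite expnS mult_INR IH. Qed.

Lemma ln_pow_INR p k : (0 < p)%N -> ln (INR (p ^ k)%N) = INR k * ln (INR p).
Proof.
move=> p0; rewrite INR_exp; elim: k => [|k IH]; first by rewrite /= ln_1; lra.
rewrite S_INR /= ln_mult ?IH; [lra|exact: INR_gt0|].
by apply: pow_lt; apply: INR_gt0.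
Qed.

Lemma ln_sum_logn n : (0 < n)%N ->
  ln (INR n) = \sum_(1 <= p < n.+1 | prime p) INR (logn p n) * ln (INR p).
Proof.
move=> n0; rewrite -{1}(partnT n0) /partn ln_prod; last first.
  by move=> p _; rewrite expn_gt0; case: p => //; rewrite orbC lognE.
rewrite big_ltn // /= big_mkcond /= [RHS]big_mkcond /=.
have -> : ln (INR (0 ^ logn 0 n)%N) = 0 by rewrite lognE /= ln_1.
rewrite Rplus_0_l; apply: eq_big_nat => p /andP[p0 _].
case: ifP => pp; first by rewrite ln_pow_INR.
by rewrite lognE pp /= ln_1.
Qed.

(** Fix a prime p and write n = p^v m with m prime to p. The divisors p^k contribute ln p * 1_S(m)
    times the sum over 1 <= k <= v of a_k 1_S(p^(v-k)), which the recurrence evaluates to v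
    1_S(p^v). This is v ln p * 1_S(n), and summing v ln p over p gives ln n. *)
Lemma conv_indicator_vonMangoldt n : (0 < n)%N ->
  \sum_(1 <= d < n.+1 | (d %| n)%N) vonMangoldt S d * ind S (n %/ d) =
  ind S n * ln (INR n).
Proof.
move=> n0.
pose G p k := local_coef S p k * ln (INR p).
transitivity (\sum_(1 <= d < n.+1 | (d %| n)%N) \sum_(1 <= p < n.+1 | prime p)
   \sum_(1 <= k < n.+1 | d == (p ^ k)%N) G p k * ind S (n %/ d)).
  rewrite big_seq_cond [RHS]big_seq_cond; apply: eq_bigr => d /andP[].
  rewrite mem_index_iota => hd _; rewrite (vonMangoldt_double n.+1) // big_distrl.
  by apply: eq_bigr => p _; rewrite big_distrl.
rewrite exchange_big /=.
rewrite ln_sum_logn // big_distrr /=; apply: eq_bigr => p pp.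
transitivity (\sum_(1 <= k < n.+1 | (p ^ k %| n)%N) G p k * ind S (n %/ p ^ k)).
  under eq_bigr do rewrite big_mkcond.
  rewrite exchange_big /= [RHS]big_mkcond.
  rewrite big_seq_cond [RHS]big_seq_cond; apply: eq_bigr => k /andP[].
  rewrite mem_index_iota => /andP[k0 kn] _.
  case: ifP => hd; last first.
    by apply: big1 => d dn; case: eqP => // e; rewrite -e dn in hd.
  rewrite (rsum_single _ _ _ _ (p ^ k)%N) ?iota_uniq ?eqxx //.
    by rewrite mem_index_iota expn_gt0 prime_gt0 //= ltnS dvdn_leq.
  by move=> d _ _ dp; rewrite (negbTE dp).
set v := logn p n.
have hv : (v < n.+1)%N by rewrite ltnS; apply: ltnW; apply: ltn_logl.
have [m pm en] := pfactor_coprime pp n0.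
rewrite -/v in en.
have hm j : ind S (p ^ j * m)%N = ind S (p ^ j) * ind S m.
  by rewrite indM // coprimeXl.
transitivity (\sum_(1 <= k < v.+1) ln (INR p) * ind S m *
    (local_coef S p k * ind S (p ^ (v - k)))).
  rewrite (@big_cat_nat _ _ _ v.+1) //= [X in _ + X]big1_seq ?Rplus_0_r; last first.
    move=> k /andP[hk]; rewrite mem_index_iota => /andP[hk2 _].
    by move: hk; rewrite pfactor_dvdn // -/v leqNgt hk2.
  rewrite big_seq_cond [RHS]big_seq_cond; apply: eq_big => [k|k /andP[]].
    rewrite mem_index_iota pfactor_dvdn // -/v andbT.
    by case: (1 <= k)%N => //=; case: ltnP => //=; rewrite ltnS => ->.
  rewrite mem_index_iota ltnS => /andP[k0 kv] _.
  have -> : (n %/ p ^ k = p ^ (v - k) * m)%N.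
    rewrite en mulnC -{1}(subnKC kv) expnD -mulnA mulKn // expn_gt0 prime_gt0 //.
  rewrite hm /G; lra.
rewrite rsum_distrr (logder_conv (fun j => ind S (p ^ j))); last by rewrite expn0 ind1.
rewrite [in RHS]en mulnC hm; lra.
Qed.

End MultiplicativeSet.

(** * Proper prime powers *)

(** Seen by comparing eighth powers, as 2^(-7) = 1/128 < (14/25)^8. The value 14/25 is chosen
    because 7/4 * 14/25 = 49/50 is below 1. *)
Lemma Rpower_2_neg78 : Rpower 2 (- (7 / 8)) <= 14 / 25.
Proof.
case: (Rle_lt_dec (Rpower 2 (- (7 / 8))) (14 / 25)) => // h.
have e : Rpower 2 (- (7 / 8)) ^ 8 = / 128.
  rewrite -Rpower_pow; last exact: Rpower_pos.
  rewrite Rpower_mult (_ : - (7 / 8) * INR 8 = - INR 7); last by rewrite /=; lra.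
  rewrite Rpower_Ropp Rpower_pow; last lra.
  by congr Rinv; lra.
have : (14 / 25) ^ 8 <= Rpower 2 (- (7 / 8)) ^ 8 by apply: pow_incr; lra.
rewrite e; lra.
Qed.

Lemma Rpower_neg78 p : 2 <= p -> 7 / 4 * Rpower p (- (7 / 8)) <= 49 / 50.
Proof.
move=> hp; have h : Rpower p (- (7 / 8)) <= Rpower 2 (- (7 / 8)).
  by apply: Rpower_decreasing; lra.
have := Rpower_2_neg78; lra.
Qed.

Lemma geom_sum_le x N : 0 <= x < 1 -> \sum_(0 <= k < N) x ^ k <= / (1 - x).
Proof.
move=> hx; have h0 : 0 < / (1 - x) by apply: Rinv_0_lt_compat; lra.
suff -> : \sum_(0 <= k < N) x ^ k = / (1 - x) * (1 - x ^ N).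
  have : 0 <= x ^ N by apply: pow_le; lra.
  nra.
elim: N => [|N IH]; first by rewrite big_geq //=; lra.
by rewrite rsum_recr // IH /=; field; lra.
Qed.

Section PrimePowers.
Variable S : set nat.
Hypothesis hS : multiplicative_set S.

Definition proper_part (n : nat) : R :=
  if prime n then 0 else vonMangoldt S n / INR n.

(** A majorant of the term at p^k weighted by (p^k)^(1/8), which is at most 3 ln p (7/4 p^(-7/8))^k.
    Two of the k factors are kept as 49/16 p^(-7/4), the others are bounded by 49/50, and ln p <= 4
    p^(1/4) leaves the summable power p^(-3/2). *)
Let G (p k : nat) : R :=
  if (1 < k)%N then 3 * (49 / 16) * (49 / 50) ^ (k - 2) * (4 * Rpower (INR p) (- (1 + / 2)))
  else 0.

Let G_ge0 p k : 0 <= G p k.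
Proof.
rewrite /G; case: ifP => _; last lra.
have := Rpower_pos (INR p) (- (1 + / 2)).
have : 0 <= (49 / 50) ^ (k - 2) by apply: pow_le; lra.
by move=> *; apply: Rmult_le_pos; lra.
Qed.

Lemma proper_part_bound p k : prime p -> (1 < k)%N ->
  Rabs (vonMangoldt S (p ^ k) / INR (p ^ k)) * Rpower (INR (p ^ k)) (/ 8) <= G p k.
Proof.
move=> pp k1; rewrite vonMangoldt_pfactor //; last exact: ltnW.
have p0 : 0 < INR p by apply: INR_gt0; apply: prime_gt0.
have p2 : 2 <= INR p by apply: INR_ge2; apply: prime_gt1.
have pk0 : 0 < INR (p ^ k)%N by apply: INR_gt0; rewrite expn_gt0 prime_gt0.
rewrite /Rdiv !Rabs_mult (Rabs_pos_eq (/ _)); last by left; apply: Rinv_0_lt_compat.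
have l0 : 0 <= ln (INR p) by apply: ln_INR_ge0; apply: prime_gt0.
rewrite (Rabs_pos_eq (ln _)) //.
set y := Rpower (INR p) (- (7 / 8)).
have y0 : 0 < y := Rpower_pos _ _.
have -> : Rabs (local_coef S p k) * ln (INR p) * / INR (p ^ k)%N * Rpower (INR (p ^ k)) (/ 8) =
    Rabs (local_coef S p k) * (ln (INR p) * y ^ k).
  rewrite /y -Rpower_pow; last exact: Rpower_pos.
  rewrite Rpower_mult INR_exp -Rpower_pow // Rpower_mult -Rpower_Ropp.
  rewrite !Rmult_assoc -Rpower_plus; congr (_ * (_ * Rpower _ _)); lra.
apply: Rle_trans (_ : 3 * (7 / 4) ^ k * (ln (INR p) * y ^ k) <= _).
  apply: Rmult_le_compat_r; last exact: local_coef_bound.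
  by apply: Rmult_le_pos => //; apply: pow_le; lra.
have -> : 3 * (7 / 4) ^ k * (ln (INR p) * y ^ k) = 3 * ln (INR p) * (7 / 4 * y) ^ k.
  rewrite Rpow_mult_distr; lra.
rewrite /G k1 -{1}(subnKC k1) pow_add.
have hl : ln (INR p) <= 4 * Rpower (INR p) (/ 4).
  have := ln_le_Rpower (INR p) (/ 4) p0; rewrite Rinv_inv; apply; lra.
have hy : (7 / 4 * y) ^ (k - 2) <= (49 / 50) ^ (k - 2).
  apply: pow_incr; have := Rpower_neg78 _ p2; rewrite -/y; lra.
have hy0 : 0 <= (7 / 4 * y) ^ (k - 2) by apply: pow_le; lra.
have ey : (7 / 4 * y) ^ 2 = 49 / 16 * Rpower (INR p) (- (7 / 4)).
  have -> : Rpower (INR p) (- (7 / 4)) = y * y by rewrite /y -Rpower_plus; congr Rpower; lra.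
  rewrite /=; lra.
have e3 : Rpower (INR p) (- (1 + / 2)) = Rpower (INR p) (/ 4) * Rpower (INR p) (- (7 / 4)).
  rewrite -Rpower_plus; congr Rpower; lra.
rewrite ey e3; set u := Rpower _ (/ 4) in hl *; set v := Rpower _ (- (7 / 4)).
have v0 : 0 < v := Rpower_pos _ _.
have -> : 3 * ln (INR p) * (49 / 16 * v * (7 / 4 * y) ^ (k - 2)) =
  (3 * (49 / 16) * v) * (ln (INR p) * (7 / 4 * y) ^ (k - 2)) by lra.
have -> : 3 * (49 / 16) * (49 / 50) ^ (k - 2) * (4 * (u * v)) =
  (3 * (49 / 16) * v) * ((4 * u) * (49 / 50) ^ (k - 2)) by lra.
apply: Rmult_le_compat_l; first lra.
exact: Rmult_le_compat.
Qed.

Lemma proper_part_sum_bounded :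
  exists C, 0 <= C /\ forall N,
    \sum_(1 <= n < N) Rabs (proper_part n) * Rpower (INR n) (/ 8) <= C.
Proof.
(* The factor 50 is the sum of the geometric series of ratio 49/50; the others are the constants of
   [G]. The remaining factor 1 + 2 bounds the sum of p^(-3/2). *)
pose c0 := 3 * (49 / 16) * 4 * 50.
exists (c0 * (1 + / / 2)); split; first by rewrite /c0 Rinv_inv; lra.
move=> N.
apply: Rle_trans (_ : \sum_(1 <= n < N) \sum_(1 <= p < N | prime p)
    \sum_(1 <= k < N | n == (p ^ k)%N) G p k <= _).
  apply: rsum_le => n; rewrite mem_index_iota => /andP[n0 nN] _.
  have dbl0 : 0 <= \sum_(1 <= p < N | prime p) \sum_(1 <= k < N | n == (p ^ k)%N) G p k.
    by apply: rsum_ge0 => p _ _; apply: rsum_ge0 => k _ _; apply: G_ge0.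
  rewrite /proper_part; case: ifP => [_|np]; first by rewrite Rabs_R0 Rmult_0_l.
  case: (vonMangoldt_cases S n n0) => [->|[p [k [pp k0 e]]]].
    by rewrite /Rdiv Rmult_0_l Rabs_R0 Rmult_0_l.
  rewrite (sum_prime_powers N n G p k) // e.
  apply: proper_part_bound => //.
  by move: k0; rewrite leq_eqVlt => /orP[/eqP k1|//]; rewrite e -k1 expn1 pp in np.
rewrite exchange_big /=.
apply: Rle_trans (_ : \sum_(1 <= p < N | prime p) \sum_(1 <= k < N) G p k <= _).
  apply: rsum_le => p _ pp.
  under eq_bigr do rewrite big_mkcond.
  rewrite exchange_big /=; apply: rsum_le => k _ _.
  rewrite -big_mkcond /=.
  have [hk|hk] := boolP ((p ^ k)%N \in index_iota 1 N).
    rewrite (rsum_single _ _ _ _ (p ^ k)%N) ?iota_uniq ?eqxx //; first lra.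
    by move=> i _ /eqP -> /eqP.
  rewrite big1_seq; first exact: G_ge0.
  by move=> i /andP[/eqP -> hi]; rewrite hi in hk.
apply: Rle_trans (_ : \sum_(1 <= p < N | prime p) c0 * Rpower (INR p) (- (1 + / 2)) <= _).
  apply: rsum_le => p _ pp; set w := Rpower _ _.
  have w0 : 0 < w := Rpower_pos _ _.
  have hg : \sum_(0 <= k < N - 2) (49 / 50) ^ k <= 50.
    apply: Rle_trans (geom_sum_le _ _ _) _; lra.
  case: (leqP N 2) => hN.
    rewrite big1_seq /c0; first lra.
    move=> k /andP[_]; rewrite mem_index_iota => /andP[k0 kN].
    by rewrite /G ltnNge -ltnS (leq_trans kN hN).
  rewrite big_ltn ?(ltn_trans _ hN) // {1}/G /= Rplus_0_l.
  rewrite -{1}(add0n 2%N) big_addn.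
  apply: Rle_trans (_ : \sum_(0 <= k < N - 2) (3 * (49 / 16) * (4 * w)) * (49 / 50) ^ k <= _).
    by apply: rsum_le => k _ _; rewrite /G addnK addn2 /= -/w; lra.
  rewrite rsum_distrr /c0; nra.
apply: Rle_trans (_ : \sum_(1 <= p < N) c0 * Rpower (INR p) (- (1 + / 2)) <= _).
  apply: rsum_subpred => // i _ _; rewrite /c0.
  have := Rpower_pos (INR i) (- (1 + / 2)); lra.
rewrite rsum_distrr; apply: Rmult_le_compat_l; first by rewrite /c0; lra.
apply: zeta_partial_le; lra.
Qed.

(** Rankin's trick: for n >= M the factor (n/M)^(1/8) is at least 1, so the bounded weighted sum
    also bounds the tail. *)
Lemma proper_part_tail :
  exists C, 0 <= C /\ forall M N, (0 < M)%N ->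
    \sum_(M <= n < N) Rabs (proper_part n) <= C * Rpower (INR M) (- / 8).
Proof.
have [C [C0 hC]] := proper_part_sum_bounded.
exists C; split => // M N M0.
have hw : 0 < Rpower (INR M) (- / 8) := Rpower_pos _ _.
have h0 i : 0 <= Rabs (proper_part i) * Rpower (INR i) (/ 8).
  by apply: Rmult_le_pos; [exact: Rabs_pos|left; exact: Rpower_pos].
apply: Rle_trans (_ : \sum_(M <= n < N)
   Rpower (INR M) (- / 8) * (Rabs (proper_part n) * Rpower (INR n) (/ 8)) <= _).
  apply: rsum_le => n; rewrite mem_index_iota => /andP[Mn nN] _.
  have h : 1 <= Rpower (INR M) (- / 8) * Rpower (INR n) (/ 8).
    have <- : Rpower (INR n) (- / 8) * Rpower (INR n) (/ 8) = 1.
      by rewrite -Rpower_plus Rplus_opp_l Rpower_O //; apply: INR_gt0; apply: leq_trans Mn.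
    apply: Rmult_le_compat_r; first by left; apply: Rpower_pos.
    have := leq_INR M n Mn; have := INR_gt0 M M0 => *.
    apply: Rpower_decreasing; lra.
  have := Rabs_pos (proper_part n); nra.
rewrite rsum_distrr Rmult_comm; apply: Rmult_le_compat_r; first lra.
case: (leqP M N) => hMN; last by rewrite big_geq //; apply: ltnW.
have := hC N; rewrite (rsum_cat M) //.
have : 0 <= \sum_(1 <= n < M) Rabs (proper_part n) * Rpower (INR n) (/ 8).
  by apply: rsum_ge0.
lra.
Qed.

Lemma vonMangoldt_abs_le n : (0 < n)%N ->
  Rabs (vonMangoldt S n) <= ln (INR n) + INR n * Rabs (proper_part n).
Proof.
move=> n0; have hn := INR_gt0 _ n0; have hl := ln_INR_ge0 _ n0.
rewrite /proper_part; case: ifP => pn.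
  rewrite vonMangoldt_prime // Rabs_R0 Rabs_mult (Rabs_pos_eq (ln _)) //.
  have [h1 h2] := ind_bound S n; rewrite Rabs_pos_eq //; nra.
rewrite /Rdiv Rabs_mult (Rabs_pos_eq (/ _)); last by left; apply: Rinv_0_lt_compat.
have -> : INR n * (Rabs (vonMangoldt S n) * / INR n) = Rabs (vonMangoldt S n) by field; lra.
lra.
Qed.

Lemma ex_series_vonMangoldt sigma : 1 < sigma ->
  ex_series (fun k => Rabs (vonMangoldt S k.+1) * Rpower (INR k.+1) (- sigma)).
Proof.
move=> hs; have [C [C0 hC]] := proper_part_tail.
(* Half of the margin sigma - 1 absorbs the logarithm at primes; the other half keeps the sum of
   n^(-1-a) finite. *)
pose a := (sigma - 1) / 2; have ha : 0 < a by rewrite /a; lra.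
apply: (nonneg_series_bounded (fun n => Rabs (vonMangoldt S n) * Rpower (INR n) (- sigma))
         (/ a * (1 + / a) + C * 1)).
  by move=> n _; apply: Rmult_le_pos; [exact: Rabs_pos|left; exact: Rpower_pos].
move=> N.
apply: Rle_trans (_ : \sum_(1 <= n < N.+1) (/ a * Rpower (INR n) (- (1 + a)) +
   Rabs (proper_part n)) <= _).
  apply: rsum_le => n; rewrite mem_index_iota => /andP[n0 _] _.
  have n1 := INR_ge1 _ n0; have hn := INR_gt0 _ n0.
  have hw : 0 < Rpower (INR n) (- sigma) := Rpower_pos _ _.
  apply: Rle_trans (Rmult_le_compat_r _ _ _ (Rlt_le _ _ hw) (vonMangoldt_abs_le n n0)) _.
  have h1 : ln (INR n) * Rpower (INR n) (- sigma) <= / a * Rpower (INR n) (- (1 + a)).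
    have -> : Rpower (INR n) (- (1 + a)) = Rpower (INR n) a * Rpower (INR n) (- sigma).
      by rewrite -Rpower_plus; congr Rpower; rewrite /a; lra.
    rewrite -Rmult_assoc; apply: Rmult_le_compat_r; first lra.
    exact: ln_le_Rpower.
  have h2 : INR n * Rpower (INR n) (- sigma) <= 1.
    rewrite -{1}(Rpower_1 (INR n)) // -Rpower_plus -{2}(Rpower_O (INR n)) //.
    apply: Rle_Rpower; lra.
  have := Rabs_pos (proper_part n); nra.
rewrite rsumD rsum_distrr; apply: Rplus_le_compat.
  apply: Rmult_le_compat_l; first by left; apply: Rinv_0_lt_compat.
  exact: zeta_partial_le.
by rewrite -(Rpower_INR1 (- / 8)); apply: hC.
Qed.

End PrimePowers.

(** * Complex Dirichlet series *)

Lemma exp_le x y : x <= y -> exp x <= exp y.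
Proof. by case=> [/exp_increasing|->]; lra. Qed.

Lemma Rabs_exp_minus1 x : Rabs (exp x - 1) <= Rabs x * exp (Rabs x).
Proof.
have h1 := exp_ineq1_le x; have h2 := exp_ineq1_le (- x).
have e0 := exp_pos x; have ee : exp x * exp (- x) = 1 by rewrite -exp_plus Rplus_opp_r exp_0.
have h3 : exp x * (1 - x) <= 1 by nra.
case: (Rle_lt_dec 0 x) => hx.
  rewrite !Rabs_pos_eq; nra.
rewrite (Rabs_left x) // Rabs_left1; last by rewrite -exp_0; left; apply: Rlt_minus; apply: exp_increasing.
have := exp_ineq1_le (- x); nra.
Qed.

Lemma Rabs_exp_taylor x : Rabs (exp x - 1 - x) <= x ^ 2 * exp (Rabs x).
Proof.
have h1 := exp_ineq1_le x; have h2 := exp_ineq1_le (- x).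
have e0 := exp_pos x; have ee : exp x * exp (- x) = 1 by rewrite -exp_plus Rplus_opp_r exp_0.
have h3 : exp x * (1 - x) <= 1 by nra.
rewrite Rabs_pos_eq; last lra.
have h4 : exp x - 1 - x <= x * (exp x - 1) by lra.
have h5 : x * (exp x - 1) <= Rabs x * Rabs (exp x - 1).
  rewrite -Rabs_mult; exact: Rle_abs.
have := Rabs_exp_minus1 x.
have <- : Rabs x * Rabs x = x ^ 2 by rewrite -Rabs_mult Rabs_pos_eq; nra.
have := Rabs_pos x; nra.
Qed.

Lemma Rabs_sin_le1 x : Rabs (sin x) <= 1.
Proof. by apply: Rabs_le; have := SIN_bound x; lra. Qed.

Lemma Rabs_cos_le1 x : Rabs (cos x) <= 1.
Proof. by apply: Rabs_le; have := COS_bound x; lra. Qed.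

Lemma Rabs_sin_le x : Rabs (sin x) <= Rabs x.
Proof.
have := bounded_variation sin cos 1 0 x.
rewrite sin_0 !Rminus_0_r Rmult_1_l; apply => t _; split; last exact: Rabs_cos_le1.
by apply/is_derive_Reals; apply: derivable_pt_lim_sin.
Qed.

Lemma Rabs_cos_minus1 x : Rabs (cos x - 1) <= x ^ 2.
Proof.
have := bounded_variation cos (fun t => - sin t) (Rabs x) 0 x.
rewrite cos_0 !Rminus_0_r -Rabs_mult (Rabs_pos_eq (x * x)); last nra.
rewrite (_ : x ^ 2 = x * x); last by rewrite /=; lra.
apply => t ht; split; first by apply/is_derive_Reals; apply: derivable_pt_lim_cos.
rewrite Rabs_Ropp; apply: Rle_trans (Rabs_sin_le t) _.
by rewrite !Rminus_0_r in ht.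
Qed.

Lemma Rabs_cos_minus1_le x : Rabs (cos x - 1) <= Rabs x.
Proof.
have := bounded_variation cos (fun t => - sin t) 1 0 x.
rewrite cos_0 !Rminus_0_r Rmult_1_l; apply => t _.
split; first by apply/is_derive_Reals; apply: derivable_pt_lim_cos.
by rewrite Rabs_Ropp; apply: Rabs_sin_le1.
Qed.

Lemma Rabs_sin_minus x : Rabs (sin x - x) <= x ^ 2.
Proof.
have := bounded_variation (fun t => sin t - t) (fun t => cos t - 1) (Rabs x) 0 x.
rewrite sin_0 !Rminus_0_r -Rabs_mult (Rabs_pos_eq (x * x)); last nra.
rewrite (_ : x ^ 2 = x * x); last by rewrite /=; lra.
apply => t ht; split.
  apply/is_derive_Reals; apply: derivable_pt_lim_minus; first exact: derivable_pt_lim_sin.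
  exact: derivable_pt_lim_id.
apply: Rle_trans (Rabs_cos_minus1_le t) _.
by rewrite !Rminus_0_r in ht.
Qed.

(* The real and imaginary parts of exp(z) - 1 - z at z = x + i y. *)
Lemma cexp_taylor x y :
  Rabs (exp x * cos y - 1 - x) <= 3 * (x ^ 2 + y ^ 2) * exp (Rabs x) /\
  Rabs (exp x * sin y - y) <= 3 * (x ^ 2 + y ^ 2) * exp (Rabs x).
Proof.
have E1 : 1 <= exp (Rabs x) by have := exp_ineq1_le (Rabs x); have := Rabs_pos x; lra.
have E2 : exp x <= exp (Rabs x) by apply: exp_le; apply: Rle_abs.
have Ex := exp_pos x.
have x2 : 0 <= x ^ 2 by apply: pow2_ge_0.
have y2 : 0 <= y ^ 2 by apply: pow2_ge_0.
set E := exp (Rabs x) in E1 E2 *.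
split.
  have -> : exp x * cos y - 1 - x = (exp x - 1 - x) + exp x * (cos y - 1) by lra.
  apply: Rle_trans (Rabs_triang _ _) _.
  rewrite Rabs_mult (Rabs_pos_eq (exp x)); last lra.
  have := Rabs_exp_taylor x; rewrite -/E; have := Rabs_cos_minus1 y.
  have := Rabs_pos (cos y - 1).
  move=> h1 h2 h3; have : exp x * Rabs (cos y - 1) <= E * y ^ 2.
    by apply: Rmult_le_compat; lra.
  nra.
have -> : exp x * sin y - y = exp x * (sin y - y) + (exp x - 1) * y by lra.
apply: Rle_trans (Rabs_triang _ _) _.
rewrite !Rabs_mult (Rabs_pos_eq (exp x)); last lra.
have := Rabs_exp_minus1 x; rewrite -/E; have := Rabs_sin_minus y.
have := Rabs_pos (sin y - y).
move=> h1 h2 h3; have : exp x * Rabs (sin y - y) <= E * y ^ 2.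
  by apply: Rmult_le_compat; lra.
have : Rabs (exp x - 1) * Rabs y <= Rabs x * E * Rabs y.
  by apply: Rmult_le_compat_r => //; apply: Rabs_pos.
have : Rabs x * Rabs y <= x ^ 2 + y ^ 2.
  rewrite -(pow2_abs x) -(pow2_abs y); have := Rabs_pos x; have := Rabs_pos y => *.
  have := pow2_ge_0 (Rabs x - Rabs y); rewrite /=; nra.
nra.
Qed.

Definition npow_re (n : nat) (s : C) : R :=
  Rpower (INR n) (- Re s) * cos (Im s * ln (INR n)).
Definition npow_im (n : nat) (s : C) : R :=
  - (Rpower (INR n) (- Re s) * sin (Im s * ln (INR n))).

Lemma npow_oppE n s : npow_opp n s = (npow_re n s, npow_im n s).
Proof.
rewrite /npow_opp /npow_re /npow_im /Rpower /Cmult /Cminus /Cplus /Copp /RtoC /Ci /=.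
by congr (_, _); lra.
Qed.

Lemma npow_re_plus n s h :
  npow_re n (s + h)%C = npow_re n s * npow_re n h - npow_im n s * npow_im n h.
Proof.
rewrite /npow_re /npow_im /Re /Im /= Ropp_plus_distr Rpower_plus Rmult_plus_distr_r cos_plus; lra.
Qed.

Lemma npow_im_plus n s h :
  npow_im n (s + h)%C = npow_re n s * npow_im n h + npow_im n s * npow_re n h.
Proof.
rewrite /npow_re /npow_im /Re /Im /= Ropp_plus_distr Rpower_plus Rmult_plus_distr_r sin_plus; lra.
Qed.

Lemma npow_re_mul m n s : (0 < m)%N -> (0 < n)%N ->
  npow_re (m * n) s = npow_re m s * npow_re n s - npow_im m s * npow_im n s.
Proof.
move=> /INR_gt0 hm /INR_gt0 hn.
rewrite /npow_re /npow_im mult_INR -Rpower_mult_distr // ln_mult // Rmult_plus_distr_l cos_plus.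
lra.
Qed.

Lemma npow_im_mul m n s : (0 < m)%N -> (0 < n)%N ->
  npow_im (m * n) s = npow_re m s * npow_im n s + npow_im m s * npow_re n s.
Proof.
move=> /INR_gt0 hm /INR_gt0 hn.
rewrite /npow_re /npow_im mult_INR -Rpower_mult_distr // ln_mult // Rmult_plus_distr_l sin_plus.
lra.
Qed.

Lemma npow_re_bound n s : Rabs (npow_re n s) <= Rpower (INR n) (- Re s).
Proof.
rewrite /npow_re Rabs_mult Rabs_pos_eq; last by left; apply: Rpower_pos.
have := Rabs_cos_le1 (Im s * ln (INR n)); have := Rpower_pos (INR n) (- Re s); nra.
Qed.

Lemma npow_im_bound n s : Rabs (npow_im n s) <= Rpower (INR n) (- Re s).
Proof.
rewrite /npow_im Rabs_Ropp Rabs_mult Rabs_pos_eq; last by left; apply: Rpower_pos.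
have := Rabs_sin_le1 (Im s * ln (INR n)); have := Rpower_pos (INR n) (- Re s); nra.
Qed.

(** The second order remainder of exp at -h ln n. Only Re h is restricted, because |n^(-h)| depends
    on it alone and is then at most n^eta. *)
Lemma npow_taylor n h eta : (0 < n)%N -> Rabs (Re h) <= eta ->
  let L := ln (INR n) in
  let K := 3 * (Cmod h ^ 2 * L ^ 2) * Rpower (INR n) eta in
  Rabs (npow_re n h - 1 + Re h * L) <= K /\ Rabs (npow_im n h + Im h * L) <= K.
Proof.
move=> n0 hh L K.
have L0 : 0 <= L by apply: ln_INR_ge0.
have [h1 h2] := cexp_taylor (- Re h * L) (- Im h * L).
have eK : 3 * ((- Re h * L) ^ 2 + (- Im h * L) ^ 2) * exp (Rabs (- Re h * L)) <= K.
  have -> : (- Re h * L) ^ 2 + (- Im h * L) ^ 2 = Cmod h ^ 2 * L ^ 2.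
    by rewrite Cmod2_alt /=; lra.
  apply: Rmult_le_compat_l.
    have := pow2_ge_0 (Cmod h); have := pow2_ge_0 L => a b.
    by have := Rmult_le_pos _ _ b a; lra.
  rewrite /Rpower -/L; apply: exp_le; rewrite Rabs_mult Rabs_Ropp (Rabs_pos_eq L) //.
  exact: Rmult_le_compat_r.
split.
  apply: Rle_trans eK; apply: Rle_trans h1.
  rewrite /npow_re /Rpower -/L.
  rewrite (_ : - Im h * L = - (Im h * L)); last lra.
  by rewrite cos_neg; right; congr Rabs; lra.
apply: Rle_trans eK; apply: Rle_trans h2.
rewrite /npow_im /Rpower -/L.
rewrite (_ : - Im h * L = - (Im h * L)); last lra.
by rewrite sin_neg; right; congr Rabs; lra.
Qed.

Definition abs_conv (c : nat -> R) (sigma : R) :=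
  ex_series (fun k => Rabs (c k.+1) * Rpower (INR k.+1) (- sigma)).

Definition dirichlet (c : nat -> R) (s : C) : C :=
  (Series (fun k => c k.+1 * npow_re k.+1 s), Series (fun k => c k.+1 * npow_im k.+1 s)).

Lemma ex_series_bound (f g : nat -> R) :
  (forall n, (0 < n)%N -> Rabs (f n) <= g n) -> ex_series (fun k => g k.+1) ->
  ex_series (fun k => f k.+1).
Proof.
move=> h; apply: (@ex_series_le R_AbsRing R_CompleteNormedModule (fun k => f k.+1)) => n.
exact: h.
Qed.

Lemma abs_conv_le c s1 s2 : s1 <= s2 -> abs_conv c s1 -> abs_conv c s2.
Proof.
move=> h; apply: (ex_series_bound (fun n => Rabs (c n) * Rpower (INR n) (- s2))
  (fun n => Rabs (c n) * Rpower (INR n) (- s1))) => n n0.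
have := Rpower_pos (INR n) (- s2) => p.
rewrite Rabs_mult Rabs_Rabsolu (Rabs_pos_eq (Rpower _ _)); last lra.
apply: Rmult_le_compat_l; first exact: Rabs_pos.
apply: Rle_Rpower; [exact: INR_ge1|lra].
Qed.

Lemma ex_re c s : abs_conv c (Re s) -> ex_series (fun k => c k.+1 * npow_re k.+1 s).
Proof.
move=> hc; apply: (ex_series_bound (fun n => c n * npow_re n s)
  (fun n => Rabs (c n) * Rpower (INR n) (- Re s))) hc => n _.
rewrite Rabs_mult; apply: Rmult_le_compat_l; [exact: Rabs_pos|exact: npow_re_bound].
Qed.

Lemma ex_im c s : abs_conv c (Re s) -> ex_series (fun k => c k.+1 * npow_im k.+1 s).
Proof.
move=> hc; apply: (ex_series_bound (fun n => c n * npow_im n s)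
  (fun n => Rabs (c n) * Rpower (INR n) (- Re s))) hc => n _.
rewrite Rabs_mult; apply: Rmult_le_compat_l; [exact: Rabs_pos|exact: npow_im_bound].
Qed.

Lemma ln_mul_abs_conv c s1 s2 : s1 < s2 -> abs_conv c s1 ->
  abs_conv (fun n => - c n * ln (INR n)) s2.
Proof.
move=> h hc.
apply: (ex_series_bound (fun n => Rabs (- c n * ln (INR n)) * Rpower (INR n) (- s2))
  (fun n => / (s2 - s1) * (Rabs (c n) * Rpower (INR n) (- s1)))) => [n n0|].
  have p := Rpower_pos (INR n) (- s2); have L0 := ln_INR_ge0 _ n0.
  rewrite !Rabs_mult Rabs_Rabsolu Rabs_Ropp (Rabs_pos_eq (Rpower _ _)); last lra.
  rewrite Rabs_Rabsolu (Rabs_pos_eq (ln _)) //.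
  have -> : Rpower (INR n) (- s1) = Rpower (INR n) (s2 - s1) * Rpower (INR n) (- s2).
    by rewrite -Rpower_plus; congr Rpower; lra.
  have hl := ln_le_Rpower (INR n) (s2 - s1) (INR_gt0 _ n0) ltac:(lra).
  have := Rmult_le_compat_r _ _ _ (Rlt_le _ _ p) hl => hl'.
  have := Rmult_le_compat_l _ _ _ (Rabs_pos (c n)) hl'; lra.
exact: (ex_series_scal (V := R_NormedModule)).
Qed.

Lemma Series_abs_le (f g : nat -> R) :
  (forall n, (0 < n)%N -> Rabs (f n) <= g n) -> ex_series (fun k => g k.+1) ->
  Rabs (Series (fun k => f k.+1)) <= Series (fun k => g k.+1).
Proof.
move=> h hg; apply: Rle_trans (Series_Rabs _ _) _.
  apply: (ex_series_bound (fun n => Rabs (f n)) g) => // n n0.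
  by rewrite Rabs_Rabsolu; apply: h.
apply: Series_le => // n; split; [exact: Rabs_pos|exact: h].
Qed.

(** Termwise differentiation with an error quadratic in h rather than a bare limit: the same
    estimate serves the complex derivative of L_S and the real derivatives along horizontal
    half-lines. *)
Lemma dirichlet_quadratic c s sigma : abs_conv c sigma -> sigma < Re s ->
  exists B eta, 0 <= B /\ 0 < eta /\ forall h : C, Rabs (Re h) <= eta ->
    let D := dirichlet (fun n => - c n * ln (INR n)) s in
    Rabs (Re (dirichlet c (s + h)%C) - Re (dirichlet c s) - Re (h * D)%C) <= B * Cmod h ^ 2 /\
    Rabs (Im (dirichlet c (s + h)%C) - Im (dirichlet c s) - Im (h * D)%C) <= B * Cmod h ^ 2.
Proof.
(* Three shares of the distance to sigma: one for |n^(-h)|, two for (ln n)^2 <= n^(2 eta) / eta^2.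
   Together they lead from n^(-Re s) back to n^(-sigma). *)
move=> hc hs; pose eta := (Re s - sigma) / 3.
have eta0 : 0 < eta by rewrite /eta; lra.
pose X := Series (fun k => Rabs (c k.+1) * Rpower (INR k.+1) (- sigma)).
(* Here 6 = 2 * 3, from two products per component and the 3 of [npow_taylor]; the factor 4 is
   slack. *)
pose K := 6 * (4 / eta ^ 2).
have K0 : 0 <= K.
  rewrite /K; apply: Rmult_le_pos; first lra.
  apply: Rmult_le_pos; first lra.
  by left; apply: Rinv_0_lt_compat; apply: pow_lt.
exists (K * X), eta; split.
  apply: Rmult_le_pos => //; rewrite /X.
  apply: (Series_ge0 (fun i => Rabs (c i) * Rpower (INR i) (- sigma))) => // n _.
  by apply: Rmult_le_pos; [exact: Rabs_pos|left; exact: Rpower_pos].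
split => // h hh D.
have hs1 : abs_conv c (Re s) by apply: abs_conv_le hc; lra.
have hs2 : abs_conv c (Re (s + h)%C).
  apply: abs_conv_le hc; have -> : Re (s + h)%C = Re s + Re h by [].
  by move/Rabs_le_between: hh; rewrite /eta; lra.
have hs3 := ln_mul_abs_conv _ _ _ hs hc.
have tb n (u v : R) : (0 < n)%N -> Rabs u <= Rpower (INR n) (- Re s) ->
    Rabs v <= Rpower (INR n) (- Re s) ->
  forall a b,
    let L := ln (INR n) in let k := 3 * (Cmod h ^ 2 * L ^ 2) * Rpower (INR n) eta in
    Rabs a <= k -> Rabs b <= k ->
    Rabs (c n * (u * a + v * b)) <=
    (K * Cmod h ^ 2) * (Rabs (c n) * Rpower (INR n) (- sigma)).
  move=> n0 hu hv a b L k ha hb.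
  have p := Rpower_pos (INR n) (- Re s).
  rewrite Rabs_mult.
  have e1 : Rabs (u * a + v * b) <= 2 * (Rpower (INR n) (- Re s) * k).
    apply: Rle_trans (Rabs_triang _ _) _; rewrite !Rabs_mult.
    have := Rmult_le_compat _ _ _ _ (Rabs_pos u) (Rabs_pos a) hu ha.
    have := Rmult_le_compat _ _ _ _ (Rabs_pos v) (Rabs_pos b) hv hb.
    lra.
  have L0 : 0 <= L by apply: ln_INR_ge0.
  have hl : L <= / eta * Rpower (INR n) eta by apply: ln_le_Rpower => //; apply: INR_gt0.
  have hL : L ^ 2 <= / eta ^ 2 * (Rpower (INR n) eta) ^ 2.
    by rewrite -pow_inv -Rpow_mult_distr; apply: pow_incr; split.
  have es : Rpower (INR n) (- sigma) =
     (Rpower (INR n) eta) ^ 2 * Rpower (INR n) eta * Rpower (INR n) (- Re s).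
    rewrite /= Rmult_1_r -!Rpower_plus; congr Rpower; rewrite /eta; lra.
  have p2 := Rpower_pos (INR n) eta.
  have e2 : 2 * (Rpower (INR n) (- Re s) * k) <= K * Cmod h ^ 2 * Rpower (INR n) (- sigma).
    rewrite es /k /K.
    set w := Rpower (INR n) (- Re s) in p *; set z := Rpower (INR n) eta in p2 hL *.
    set H := Cmod h ^ 2; have H0 : 0 <= H by apply: pow2_ge_0.
    have Hz : 0 <= H * z * w by apply: Rmult_le_pos; [apply: Rmult_le_pos|]; lra.
    have := Rmult_le_compat_l _ _ _ Hz hL.
    have q : 0 <= H * z * w * (/ eta ^ 2 * z ^ 2).
      apply: Rmult_le_pos => //; apply: Rmult_le_pos.
        by left; apply: Rinv_0_lt_compat; apply: pow_lt.
      by apply: pow_le; lra.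
    rewrite /Rdiv; lra.
  have := Rmult_le_compat_l _ _ _ (Rabs_pos (c n)) (Rle_trans _ _ _ e1 e2); lra.
have scale : Series (fun k => (K * Cmod h ^ 2) * (Rabs (c k.+1) * Rpower (INR k.+1) (- sigma)))
   = K * X * Cmod h ^ 2 by rewrite Series_scal_l /X; lra.
have exs : ex_series (fun k => (K * Cmod h ^ 2) * (Rabs (c k.+1) * Rpower (INR k.+1) (- sigma))).
  exact: (ex_series_scal (V := R_NormedModule)).
rewrite -scale.
have r1 := Series_correct _ (ex_re _ _ hs1); have r2 := Series_correct _ (ex_re _ _ hs2).
have r3 := Series_correct _ (ex_re _ _ hs3).
have i1 := Series_correct _ (ex_im _ _ hs1); have i2 := Series_correct _ (ex_im _ _ hs2).
have i3 := Series_correct _ (ex_im _ _ hs3).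
pose A n := npow_re n h - 1 + Re h * ln (INR n).
pose B n := npow_im n h + Im h * ln (INR n).
split.
  have := is_series_minus _ _ _ _ (is_series_minus _ _ _ _ r2 r1)
    (is_series_minus _ _ _ _ (is_series_scal (Re h) _ _ r3) (is_series_scal (Im h) _ _ i3)).
  move/is_series_unique => e.
  rewrite [X in Rabs X](_ : _ = Series (fun k => c k.+1 *
     (npow_re k.+1 s * A k.+1 + (- npow_im k.+1 s) * B k.+1))); last first.
    apply: (etrans _ (etrans (esym e) _)).
      by rewrite /D /dirichlet /plus /opp /scal /Re /Im /= /mult /=; lra.
    apply: Series_ext => k; rewrite npow_re_plus /A /B.
    rewrite /minus /plus /opp /scal /= /mult /=; lra.
  apply: (Series_abs_le (fun n => c n * (npow_re n s * A n + (- npow_im n s) * B n))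
    (fun n => (K * Cmod h ^ 2) * (Rabs (c n) * Rpower (INR n) (- sigma)))) exs => n n0.
  have [ha hb] := npow_taylor n h eta n0 hh.
  apply: tb => //; first exact: npow_re_bound.
  by rewrite Rabs_Ropp; exact: npow_im_bound.
have := is_series_minus _ _ _ _ (is_series_minus _ _ _ _ i2 i1)
    (is_series_plus _ _ _ _ (is_series_scal (Re h) _ _ i3) (is_series_scal (Im h) _ _ r3)).
move/is_series_unique => e.
rewrite [X in Rabs X](_ : _ = Series (fun k => c k.+1 *
     (npow_im k.+1 s * A k.+1 + npow_re k.+1 s * B k.+1))); last first.
  apply: (etrans _ (etrans (esym e) _)).
    by rewrite /D /dirichlet /plus /opp /scal /Re /Im /= /mult /=; lra.
  apply: Series_ext => k; rewrite npow_im_plus /A /B.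
  rewrite /minus /plus /opp /scal /= /mult /=; lra.
apply: (Series_abs_le (fun n => c n * (npow_im n s * A n + npow_re n s * B n))
    (fun n => (K * Cmod h ^ 2) * (Rabs (c n) * Rpower (INR n) (- sigma)))) exs => n n0.
have [ha hb] := npow_taylor n h eta n0 hh.
by apply: tb => //; [exact: npow_im_bound|exact: npow_re_bound].
Qed.

Lemma Cmod_le_abs (z : C) : Cmod z <= Rabs (Re z) + Rabs (Im z).
Proof.
have {1}-> : z = (RtoC (Re z) + Ci * RtoC (Im z))%C.
  by rewrite /Cplus /Cmult /RtoC /Ci /Re /Im /=; case: z => a b /=; congr (_, _); lra.
apply: Rle_trans (Cmod_triangle _ _) _; rewrite Cmod_mult !Cmod_R.
have -> : Cmod Ci = 1 by rewrite /Cmod /= !Rmult_0_l Rplus_0_l !Rmult_1_r sqrt_1.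
lra.
Qed.

Lemma is_derive_quadratic (f : C -> C) (s l : C) B eta : 0 <= B -> 0 < eta ->
  (forall h : C, Rabs (Re h) <= eta -> Cmod (f (s + h) - f s - h * l)%C <= B * Cmod h ^ 2) ->
  is_derive f s l.
Proof.
move=> B0 eta0 hf; split; first exact: is_linear_scal_l.
move=> y hy.
have <- := is_filter_lim_locally_unique (V := AbsRing_NormedModule C_AbsRing) s y hy.
move=> {y hy} eps.
(* Within this radius B |h|^2 <= eps |h|; the denominator B + 1 covers the case B = 0. *)
have dpos : 0 < Rmin eta (eps / (B + 1)).
  apply: Rmin_pos => //; apply: Rdiv_lt_0_compat; [exact: cond_pos|lra].
exists (mkposreal _ dpos) => z hz.
have {}hz : Cmod (z - s)%C < Rmin eta (eps / (B + 1)) by exact: hz.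
have hz1 := Rlt_le_trans _ _ _ hz (Rmin_l _ _).
have hz2 := Rlt_le_trans _ _ _ hz (Rmin_r _ _).
have e1 : (s + (z - s))%C = z by ring.
have := hf (z - s)%C; rewrite e1 => hfz.
have {}hfz : Cmod (f z - f s - (z - s) * l)%C <= B * Cmod (z - s) ^ 2.
  by apply: hfz; apply: Rle_trans (re_le_Cmod _) _; lra.
apply: Rle_trans hfz _.
have c0 := Cmod_ge_0 (z - s).
have -> : B * Cmod (z - s) ^ 2 = (Cmod (z - s) * B) * Cmod (z - s) by rewrite /=; lra.
apply: Rmult_le_compat_r => //.
have := Rmult_lt_compat_r (B + 1) _ _ ltac:(lra) hz2.
rewrite /Rdiv Rmult_assoc Rinv_l; lra.
Qed.

Lemma derivable_quadratic (f : R -> R) (x l : R) B eta : 0 <= B -> 0 < eta ->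
  (forall h : R, Rabs h <= eta -> Rabs (f (x + h) - f x - h * l) <= B * h ^ 2) ->
  derivable_pt_lim f x l.
Proof.
move=> B0 eta0 hf eps eps0.
have dpos : 0 < Rmin eta (eps / (B + 1)).
  apply: Rmin_pos => //; apply: Rdiv_lt_0_compat; lra.
exists (mkposreal _ dpos) => h h0 /= hh.
have h1 := Rlt_le_trans _ _ _ hh (Rmin_l _ _).
have h2 := Rlt_le_trans _ _ _ hh (Rmin_r _ _).
have hp : 0 < Rabs h by apply: Rabs_pos_lt.
have -> : (f (x + h) - f x) / h - l = (f (x + h) - f x - h * l) / h by field.
rewrite /Rdiv Rabs_mult Rabs_inv; apply: (Rmult_lt_reg_r (Rabs h)) => //.
rewrite Rmult_assoc Rinv_l ?Rmult_1_r; last lra.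
apply: Rle_lt_trans (hf h (Rlt_le _ _ h1)) _.
rewrite -pow2_abs.
have h3 : Rabs h * (B + 1) < eps.
  have := Rmult_lt_compat_r (B + 1) _ _ ltac:(lra) h2.
  by rewrite /Rdiv Rmult_assoc Rinv_l; lra.
have -> : B * Rabs h ^ 2 = (Rabs h * B) * Rabs h by rewrite /=; lra.
apply: Rmult_lt_compat_r => //; nra.
Qed.

(** * Multiplication of Dirichlet series *)

Lemma rsum_widen m n N (P : pred nat) (f : nat -> R) : (n <= N)%N ->
  \sum_(m <= i < n | P i) f i = \sum_(m <= i < N | P i && (i < n)%N) f i.
Proof. exact: big_nat_widen. Qed.

Lemma conv_partial (a b : nat -> R) (phi : nat -> R) N :
  \sum_(1 <= n < N) (\sum_(1 <= d < n.+1 | (d %| n)%N) a d * b (n %/ d)%N) * phi n =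
  \sum_(1 <= d < N) \sum_(1 <= e < N | (d * e < N)%N) a d * b e * phi (d * e)%N.
Proof.
transitivity (\sum_(1 <= n < N) \sum_(1 <= d < N) \sum_(1 <= e < N | n == (d * e)%N)
    a d * b e * phi (d * e)%N).
  apply: eq_big_nat => n /andP[n0 nN].
  rewrite (rsum_widen 1 n.+1 N) // big_distrl /= big_mkcond.
  apply: eq_big_nat => d /andP[d0 dN].
  case: ifP => [/andP[dn _]|hdn].
    rewrite (rsum_single _ _ _ _ (n %/ d)%N) ?iota_uniq //.
    - by rewrite mulnC divnK.
    - rewrite mem_index_iota divn_gt0 // dvdn_leq //=; apply: leq_ltn_trans nN.
      exact: leq_div.
    - by rewrite mulnC divnK.
    - by move=> e _ /eqP -> ; rewrite mulKn // eqxx.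
  rewrite big1_seq // => e /andP[/eqP en _].
  have dn : (d %| n)%N by rewrite en dvdn_mulr.
  by move: hdn; rewrite dn /= ?ltnS dvdn_leq.
rewrite exchange_big /=; apply: eq_big_nat => d /andP[d0 dN].
under eq_bigr do rewrite big_mkcond.
rewrite exchange_big /= [RHS]big_mkcond; apply: eq_big_nat => e /andP[e0 eN].
rewrite -big_mkcond /=; case: ifP => hde.
  rewrite (rsum_single _ _ _ _ (d * e)%N) ?iota_uniq ?eqxx //.
    by rewrite mem_index_iota muln_gt0 d0 e0.
  by move=> i _ /eqP -> /eqP.
rewrite big1_seq // => n /andP[/eqP en]; rewrite mem_index_iota en => /andP[_].
by rewrite hde.
Qed.

(** As M^2 <= N, a pair with d e >= N lies outside the square d, e < M, so its term survives when
    the small square is removed from the large one. *)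
Lemma conv_remainder (x y : nat -> R) M N : (M * M <= N)%N -> (M <= N)%N ->
  (forall n, 0 <= x n) -> (forall n, 0 <= y n) ->
  \sum_(1 <= d < N) \sum_(1 <= e < N | ~~ (d * e < N)%N) x d * y e <=
  (\sum_(1 <= d < N) x d) * (\sum_(1 <= d < N) y d) -
  (\sum_(1 <= d < M) x d) * (\sum_(1 <= d < M) y d).
Proof.
move=> hMM hMN x0 y0.
have -> : (\sum_(1 <= d < N) x d) * (\sum_(1 <= d < N) y d) =
    \sum_(1 <= d < N) \sum_(1 <= e < N) x d * y e.
  by rewrite big_distrl /=; apply: eq_bigr => d _; rewrite big_distrr.
have -> : (\sum_(1 <= d < M) x d) * (\sum_(1 <= d < M) y d) =
    \sum_(1 <= d < N) \sum_(1 <= e < N) (if (d < M)%N && (e < M)%N then x d * y e else 0).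
  rewrite (rsum_widen 1 M N) // (rsum_widen 1 M N (fun=> true) y) // big_distrl /= big_mkcond.
  apply: eq_bigr => d _; case: ifP => hd; last by rewrite big1.
  by rewrite big_distrr /= big_mkcond.
rewrite -rsumB; apply: rsum_le => d _ _; rewrite -rsumB big_mkcond.
apply: rsum_le => e _ _; have := Rmult_le_pos _ _ (x0 d) (y0 e).
case: (ltnP d M) => hd; case: (ltnP e M) => he /=; case: ifP => hde; try lra.
have h : (d * e < N)%N := leq_trans (ltn_mul hd he) hMM.
by rewrite h in hde.
Qed.

(** The hyperbolic region d e <= N and the square d, e <= N differ by terms that [conv_remainder]
    dominates by a Cauchy difference of the product of two convergent partial sums. Having [phi]
    separate from its majorant [w] lets the same statement handle the real and the imaginary part of
    n^(-s). *)
Lemma conv_limit (a b phi : nat -> R) (w : nat -> R) :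
  (forall n, 0 <= w n) ->
  (forall d e, (0 < d)%N -> (0 < e)%N -> Rabs (phi (d * e)%N) <= w d * w e) ->
  ex_series (fun k => Rabs (a k.+1) * w k.+1) -> ex_series (fun k => Rabs (b k.+1) * w k.+1) ->
  is_lim_seq (fun N =>
    \sum_(1 <= n < N.+1) (\sum_(1 <= d < n.+1 | (d %| n)%N) a d * b (n %/ d)%N) * phi n -
    \sum_(1 <= d < N.+1) \sum_(1 <= e < N.+1) a d * b e * phi (d * e)%N) 0.
Proof.
move=> w0 hphi [X hX] [Y hY].
pose x n := Rabs (a n) * w n; pose y n := Rabs (b n) * w n.
have x0 n : 0 <= x n by apply: Rmult_le_pos => //; apply: Rabs_pos.
have y0 n : 0 <= y n by apply: Rmult_le_pos => //; apply: Rabs_pos.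
have /(is_series_bigP x) {}hX := hX; have /(is_series_bigP y) {}hY := hY.
have hXY := is_lim_seq_mult' _ _ _ _ hX hY.
apply/is_lim_seq_spec => eps.
have he2 : 0 < eps / 2 by have := cond_pos eps; lra.
move/is_lim_seq_spec: hXY => /(_ (mkposreal _ he2)) [N0 hN0] /=.
exists (N0.+1 * N0.+1)%N => N /leP hN.
have hM : (N0.+1 <= N.+1)%N.
  by rewrite leqW // (leq_trans _ hN) // leq_pmulr.
have hMM : (N0.+1 * N0.+1 <= N.+1)%N by apply: leqW.
have rem := conv_remainder x y _ _ hMM hM x0 y0.
rewrite Rminus_0_r conv_partial -rsumB.
apply: Rle_lt_trans (_ : \sum_(1 <= d < N.+1) \sum_(1 <= e < N.+1 | ~~ (d * e < N.+1)%N)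
    x d * y e < _).
  apply: Rle_trans (rsum_abs _ _ _ _) _; apply: rsum_le => d; rewrite mem_index_iota => /andP[d0 _] _.
  rewrite big_mkcond -rsumB [X in _ <= X]big_mkcond.
  apply: Rle_trans (rsum_abs _ _ _ _) _; apply: rsum_le => e; rewrite mem_index_iota => /andP[e0 _] _.
  case: ifP => _ /=; first by rewrite Rminus_diag Rabs_R0; lra.
  rewrite Rminus_0_l Rabs_Ropp !Rabs_mult /x /y.
  have := Rmult_le_compat_l _ _ _ (Rabs_pos (a d * b e)) (hphi d e d0 e0).
  rewrite Rabs_mult; lra.
apply: Rle_lt_trans rem _.
have h1 := hN0 N ltac:(by apply/leP); have h2 := hN0 N0 ltac:(by []).
move/Rabs_lt_between: h1 => /= h1; move/Rabs_lt_between: h2 => /= h2.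
lra.
Qed.

Lemma dirichlet_product (a b c : nat -> R) (s : C) :
  (forall n, (0 < n)%N -> c n = \sum_(1 <= d < n.+1 | (d %| n)%N) a d * b (n %/ d)%N) ->
  abs_conv a (Re s) -> abs_conv b (Re s) -> abs_conv c (Re s) ->
  dirichlet c s = (dirichlet a s * dirichlet b s)%C.
Proof.
move=> hc ha hb hcc.
have w0 n : 0 <= Rpower (INR n) (- Re s) by left; apply: Rpower_pos.
have wM d e : (0 < d)%N -> (0 < e)%N ->
   Rpower (INR (d * e)) (- Re s) = Rpower (INR d) (- Re s) * Rpower (INR e) (- Re s).
  by move=> d0 e0; rewrite mult_INR Rpower_mult_distr //; apply: INR_gt0.
have lim (f : nat -> R) : ex_series (fun k => f k.+1) ->
    is_lim_seq (fun N => \sum_(1 <= n < N.+1) f n) (Series (fun k => f k.+1)).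
  by move=> hf; apply/is_series_bigP; apply: Series_correct.
have are := lim (fun n => a n * npow_re n s) (ex_re _ _ ha).
have aim := lim (fun n => a n * npow_im n s) (ex_im _ _ ha).
have bre := lim (fun n => b n * npow_re n s) (ex_re _ _ hb).
have bim := lim (fun n => b n * npow_im n s) (ex_im _ _ hb).
have cre := lim (fun n => c n * npow_re n s) (ex_re _ _ hcc).
have cim := lim (fun n => c n * npow_im n s) (ex_im _ _ hcc).
have dbl (f g : nat -> R) N : (\sum_(1 <= n < N) f n) * (\sum_(1 <= n < N) g n) =
    \sum_(1 <= d < N) \sum_(1 <= e < N) f d * g e.
  by rewrite big_distrl /=; apply: eq_bigr => d _; rewrite big_distrr.
have uniq_lim u (l1 l2 : R) : is_lim_seq u l1 -> is_lim_seq u l2 -> l1 = l2.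
  by move=> /is_lim_seq_unique h1 /is_lim_seq_unique; rewrite h1 => -[].
have key (phi u : nat -> R) (l1 l2 : R) :
  (forall d e, (0 < d)%N -> (0 < e)%N ->
     Rabs (phi (d * e)%N) <= Rpower (INR d) (- Re s) * Rpower (INR e) (- Re s)) ->
  is_lim_seq (fun N => \sum_(1 <= n < N.+1) c n * phi n) l1 ->
  is_lim_seq u l2 ->
  (forall N, u N = \sum_(1 <= d < N.+1) \sum_(1 <= e < N.+1) a d * b e * phi (d * e)%N) ->
  l1 = l2.
  move=> hphi h1 h2 hu.
  have h3 := conv_limit a b phi (fun n => Rpower (INR n) (- Re s)) w0 hphi ha hb.
  apply: (uniq_lim u) h2; rewrite -(Rminus_0_r l1).
  apply: is_lim_seq_ext (is_lim_seq_minus' _ _ _ _ h1 h3) => N.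
  rewrite -hu.
  have -> : \sum_(1 <= n < N.+1) (\sum_(1 <= d < n.+1 | (d %| n)%N) a d * b (n %/ d)%N) * phi n
     = \sum_(1 <= n < N.+1) c n * phi n.
    by apply: eq_big_nat => n /andP[n0 _]; rewrite hc.
  lra.
rewrite /dirichlet /Cmult /=; congr (_, _).
  apply: (key (fun n => npow_re n s)) cre (is_lim_seq_minus' _ _ _ _
     (is_lim_seq_mult' _ _ _ _ are bre) (is_lim_seq_mult' _ _ _ _ aim bim)) _ => [d e d0 e0|N].
    by rewrite -wM //; apply: npow_re_bound.
  rewrite !dbl -rsumB; apply: eq_big_nat => d /andP[d0 _]; rewrite -rsumB.
  by apply: eq_big_nat => e /andP[e0 _]; rewrite npow_re_mul //; lra.
apply: (key (fun n => npow_im n s)) cim (is_lim_seq_plus' _ _ _ _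
     (is_lim_seq_mult' _ _ _ _ are bim) (is_lim_seq_mult' _ _ _ _ aim bre)) _ => [d e d0 e0|N].
  by rewrite -wM //; apply: npow_im_bound.
rewrite !dbl -rsumD; apply: eq_big_nat => d /andP[d0 _]; rewrite -rsumD.
by apply: eq_big_nat => e /andP[e0 _]; rewrite npow_im_mul //; lra.
Qed.

Lemma sum_n_C (z : nat -> C) N :
  sum_n z N = (sum_n (fun k => Re (z k)) N, sum_n (fun k => Im (z k)) N).
Proof.
elim: N => [|N IH]; first by rewrite !sum_O; case: (z 0%N).
by rewrite !sum_Sn IH.
Qed.

Lemma is_series_C (z : nat -> C) (a b : R) :
  is_series z ((a, b) : C) <->
  is_series (fun k => Re (z k)) a /\ is_series (fun k => Im (z k)) b.
Proof.
split.
  move=> h; split; apply/filterlim_locally => eps; move/filterlim_locally: h => /(_ eps).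
    by apply: filter_imp => N; rewrite sum_n_C => -[].
  by apply: filter_imp => N; rewrite sum_n_C => -[].
move=> [/filterlim_locally h1 /filterlim_locally h2]; apply/filterlim_locally => eps.
apply: filter_imp (filter_and _ _ (h1 eps) (h2 eps)) => N [b1 b2].
by rewrite sum_n_C; split.
Qed.

(** * The function L_S *)

Section LFunction.
Variable S : set nat.
Hypothesis hS : multiplicative_set S.

Lemma L_funE s : L_fun S s = dirichlet (ind S) s.
Proof.
by rewrite /L_fun /dirichlet; congr (_, _); apply: Series_ext => k;
  rewrite /L_term /ind; case: ifP => _; rewrite ?npow_oppE /=; lra.
Qed.

Lemma abs_conv_ind sigma : 1 < sigma -> abs_conv (ind S) sigma.
Proof.
move=> h; apply: (ex_series_bound (fun n => Rabs (ind S n) * Rpower (INR n) (- sigma))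
  (fun n => Rpower (INR n) (- (1 + (sigma - 1))))).
  move=> n _; have p := Rpower_pos (INR n) (- sigma).
  have -> : - (1 + (sigma - 1)) = - sigma by lra.
  have [h1 h2] := ind_bound S n.
  rewrite Rabs_pos_eq (Rabs_pos_eq (ind S n)) //; nra.
by apply: (ex_series_zeta (sigma - 1)); lra.
Qed.

Lemma abs_conv_vonMangoldt sigma : 1 < sigma -> abs_conv (vonMangoldt S) sigma.
Proof. exact: ex_series_vonMangoldt. Qed.

Let L' (s : C) : C := dirichlet (fun n => - ind S n * ln (INR n)) s.

Lemma is_derive_L s : 1 < Re s -> is_derive (L_fun S) s (L' s).
Proof.
move=> hs; pose sigma := (1 + Re s) / 2.
have h1 : abs_conv (ind S) sigma by apply: abs_conv_ind; rewrite /sigma; lra.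
have [B [eta [B0 [eta0 h]]]] := dirichlet_quadratic (ind S) s sigma h1 ltac:(rewrite /sigma; lra).
apply: (is_derive_quadratic _ _ _ (B + B) eta) => //; first lra.
move=> u /h /= [hr hi]; rewrite !L_funE.
apply: Rle_trans (Cmod_le_abs _) _; rewrite Rmult_plus_distr_r.
apply: Rplus_le_compat; [exact: hr|exact: hi].
Qed.

Lemma L'_product s : 1 < Re s ->
  L' s = (- (dirichlet (vonMangoldt S) s * L_fun S s))%C.
Proof.
move=> hs; rewrite L_funE.
have ha := abs_conv_vonMangoldt _ hs; have hb := abs_conv_ind _ hs.
have hmid : 1 < (1 + Re s) / 2 < Re s by lra.
have hc := ln_mul_abs_conv _ _ _ (proj2 hmid) (abs_conv_ind _ (proj1 hmid)).
have hc' : abs_conv (fun n => ind S n * ln (INR n)) (Re s).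
  apply: ex_series_ext hc => k; congr (_ * _).
  by rewrite -Rabs_Ropp; congr Rabs; lra.
rewrite -(dirichlet_product (vonMangoldt S) (ind S) (fun n => ind S n * ln (INR n))) //.
  rewrite /L' /dirichlet /Copp /= -!Series_opp; congr (_, _);
  by apply: Series_ext => k; lra.
by move=> n n0; rewrite conv_indicator_vonMangoldt.
Qed.

Lemma dirichlet_vonMangoldt_bound (s : C) sigma : 1 < sigma -> sigma <= Re s ->
  Rabs (Re (dirichlet (vonMangoldt S) s)) <=
  Series (fun k => Rabs (vonMangoldt S k.+1) * Rpower (INR k.+1) (- sigma)).
Proof.
move=> h1 hs.
apply: (Series_abs_le (fun n => vonMangoldt S n * npow_re n s)
  (fun n => Rabs (vonMangoldt S n) * Rpower (INR n) (- sigma))).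
  move=> n n0; rewrite Rabs_mult; apply: Rmult_le_compat_l; first exact: Rabs_pos.
  apply: Rle_trans (npow_re_bound _ _) _.
  apply: Rle_Rpower; [exact: INR_ge1|lra].
exact: abs_conv_vonMangoldt.
Qed.

(** The term n = 1 is 1, and a shift by T multiplies the bound for the rest by at most 2^(-T). For T
    = Z / ln 2, with Z the sum of n^(-Re s) over n >= 2, the rest is at most Z e^(-Z) < 1. *)
Lemma L_fun_re_pos (s : C) : 1 < Re s ->
  exists T, 0 <= T /\ 0 < Re (L_fun S (s + RtoC T)%C).
Proof.
move=> hs; pose sigma := Re s.
pose Z := Series (fun k => Rpower (INR k.+2) (- sigma)).
have exZ : ex_series (fun k => Rpower (INR k.+2) (- sigma)).
  apply/(ex_series_incr_1 (fun k => Rpower (INR k.+1) (- sigma))).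
  have -> : - sigma = - (1 + (sigma - 1)) by lra.
  by apply: ex_series_zeta; rewrite /sigma; lra.
have Z0 : 0 <= Z.
  by apply: (Series_ge0 (fun n => Rpower (INR n.+1) (- sigma))) => // n _; left; apply: Rpower_pos.
have l2 : 0 < ln 2 by apply: ln_gt0; lra.
exists (Z / ln 2); split.
  by apply: Rmult_le_pos => //; left; apply: Rinv_0_lt_compat.
set T := Z / ln 2; set s' := (s + RtoC T)%C.
have T0 : 0 <= T by apply: Rmult_le_pos => //; left; apply: Rinv_0_lt_compat.
have es : Re s' = sigma + T by [].
rewrite L_funE /= Series_incr_1; last by apply: ex_re; apply: abs_conv_ind; rewrite es /sigma; lra.
have -> : ind S 1 * npow_re 1 s' = 1.
  by rewrite ind1 // /npow_re Rpower_INR1 /= ln_1 Rmult_0_r cos_0; lra.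
have hb : Rabs (Series (fun k => ind S k.+2 * npow_re k.+2 s')) <= Rpower 2 (- T) * Z.
  rewrite /Z -Series_scal_l.
  apply: (Series_abs_le (fun n => ind S n.+1 * npow_re n.+1 s')
    (fun n => Rpower 2 (- T) * Rpower (INR n.+1) (- sigma))); last first.
    exact: (ex_series_scal (V := R_NormedModule)).
  move=> n n0; rewrite Rabs_mult.
  have [i0 i1] := ind_bound S n.+1; rewrite (Rabs_pos_eq (ind _ _)) //.
  have hn := npow_re_bound n.+1 s'.
  have hp := Rabs_pos (npow_re n.+1 s').
  apply: Rle_trans (_ : Rpower (INR n.+1) (- Re s') <= _); first nra.
  rewrite es Ropp_plus_distr Rplus_comm Rpower_plus; apply: Rmult_le_compat_r.
    by left; apply: Rpower_pos.
  apply: Rpower_decreasing => //; split; [lra|exact: INR_ge2].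
have hlt : Rpower 2 (- T) * Z < 1.
  have -> : Rpower 2 (- T) = / exp Z.
    by rewrite /Rpower -exp_Ropp; congr exp; rewrite /T; field; lra.
  apply: (Rmult_lt_reg_l (exp Z)); first exact: exp_pos.
  rewrite -Rmult_assoc Rinv_r ?Rmult_1_l ?Rmult_1_r; last by have := exp_pos Z; lra.
  have := exp_ineq1_le Z; lra.
move/Rabs_le_between: hb => hb; lra.
Qed.

(* On a horizontal half-line, |L|^2 satisfies a linear differential inequality by
   L' = - D L with D bounded, so a zero would propagate to the right. *)
Lemma L_fun_neq0 s : 1 < Re s -> L_fun S s <> 0%C.
Proof.
move=> hs L0; have [T [T0 hT]] := L_fun_re_pos s hs.
pose M := Series (fun k => Rabs (vonMangoldt S k.+1) * Rpower (INR k.+1) (- Re s)).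
pose u t := Re (L_fun S (s + RtoC t)%C); pose v t := Im (L_fun S (s + RtoC t)%C).
pose D t := dirichlet (vonMangoldt S) (s + RtoC t)%C.
have es t : Re (s + RtoC t)%C = Re s + t by [].
have hre t : 0 <= t -> 1 < Re (s + RtoC t)%C.
  by move=> t0; rewrite es; lra.
have hM t : 0 <= t -> Rabs (Re (D t)) <= M.
  move=> t0; apply: dirichlet_vonMangoldt_bound => //.
  by rewrite es; lra.
have hd t : 0 <= t ->
   derivable_pt_lim u t (- (Re (D t) * u t - Im (D t) * v t)) /\
   derivable_pt_lim v t (- (Re (D t) * v t + Im (D t) * u t)).
  move=> t0; have h1 := hre t t0.
  pose sigma := (1 + Re (s + RtoC t)%C) / 2.
  have hs1 : 1 < sigma by rewrite /sigma; lra.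
  have hs2 : sigma < Re (s + RtoC t)%C by rewrite /sigma; lra.
  have hq := dirichlet_quadratic (ind S) (s + RtoC t)%C sigma
    (abs_conv_ind _ hs1) hs2.
  case: hq => B [eta [B0 [eta0 h]]].
  have eD : L' (s + RtoC t)%C = (- (D t * L_fun S (s + RtoC t)))%C by apply: L'_product.
  have hh (x : R) : Rabs x <= eta ->
      Rabs (u (t + x) - u t - x * Re (L' (s + RtoC t)%C)) <= B * x ^ 2 /\
      Rabs (v (t + x) - v t - x * Im (L' (s + RtoC t)%C)) <= B * x ^ 2.
    move=> hx; have := h (RtoC x) hx; rewrite Cmod_R pow2_abs -!L_funE.
    have -> : ((s + RtoC t) + RtoC x)%C = (s + RtoC (t + x))%C.
      by rewrite /Cplus /RtoC /=; congr (_, _); lra.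
    rewrite -/(L' _) /u /v.
    have -> : Re (RtoC x * L' (s + RtoC t))%C = x * Re (L' (s + RtoC t)%C).
      by rewrite /Re /=; lra.
    have -> // : Im (RtoC x * L' (s + RtoC t))%C = x * Im (L' (s + RtoC t)%C).
    by rewrite /Im /=; lra.
  have -> : - (Re (D t) * u t - Im (D t) * v t) = Re (L' (s + RtoC t)%C) by rewrite eD.
  have -> : - (Re (D t) * v t + Im (D t) * u t) = Im (L' (s + RtoC t)%C) by rewrite eD.
  split; apply: (derivable_quadratic _ _ _ B eta) => // x hx.
    exact: (proj1 (hh x hx)).
  exact: (proj2 (hh x hx)).
(* The exponential is an integrating factor: g' = (-2 Re D - 2M) g <= 0, so g cannot rise from g(0)
   = 0 to g(T) > 0. *)
pose g t := (u t * u t + v t * v t) * exp (- (2 * M) * t).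
pose g' t := (- 2 * Re (D t) - 2 * M) * g t.
have hg t : 0 <= t -> derivable_pt_lim g t (g' t).
  move=> t0; have [du dv] := hd t t0.
  have de : derivable_pt_lim (fun t => exp (- (2 * M) * t)) t (exp (- (2 * M) * t) * (- (2 * M) * 1)).
    apply: (derivable_pt_lim_comp (fun t => - (2 * M) * t) exp).
      by apply: derivable_pt_lim_scal; apply: derivable_pt_lim_id.
    exact: derivable_pt_lim_exp.
  have := derivable_pt_lim_mult _ _ _ _ _ (derivable_pt_lim_plus _ _ _ _ _
    (derivable_pt_lim_mult _ _ _ _ _ du du) (derivable_pt_lim_mult _ _ _ _ _ dv dv)) de.
  rewrite /plus_fct /mult_fct.
  congr (derivable_pt_lim _ _ _); rewrite /g' /g; lra.
have g_ge0 t : 0 <= g t.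
  by apply: Rmult_le_pos; [nra|left; apply: exp_pos].
have e0 : (s + RtoC 0)%C = s by rewrite Cplus_0_r.
have g0 : g 0 = 0 by rewrite /g /u /v e0 L0 /=; lra.
have gT : 0 < g T.
  apply: Rmult_lt_0_compat; last exact: exp_pos.
  rewrite -/(u T) in hT; nra.
have Tpos : 0 < T.
  by case: T0 => // T0; rewrite -T0 g0 in gT; lra.
have [c [hc1 hc2]] := MVT_cor2 g g' 0 T Tpos (fun c hc => hg c (proj1 hc)).
have := hM c ltac:(lra) => /Rabs_le_between hMc.
rewrite g0 /g' in hc1; have := g_ge0 c => gc.
have : (- 2 * Re (D c) - 2 * M) * g c <= 0.
  have : 0 <= (2 * Re (D c) + 2 * M) * g c by apply: Rmult_le_pos; lra.
  lra.
nra.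
Qed.

Lemma neg_logder_L s : 1 < Re s ->
  (- (C_derive (L_fun S) s / L_fun S s))%C = dirichlet (vonMangoldt S) s.
Proof.
move=> hs; rewrite (is_C_derive_unique _ _ _ (is_derive_L s hs)) L'_product //.
by field; apply: L_fun_neq0.
Qed.

Lemma is_Lambda_vonMangoldt : is_Lambda S (vonMangoldt S).
Proof.
move=> s hs; rewrite neg_logder_L //; apply/is_series_C.
have ha := abs_conv_vonMangoldt _ hs.
split.
  apply: (is_series_ext (fun k => vonMangoldt S k.+1 * npow_re k.+1 s)).
    by move=> k; rewrite npow_oppE /Re /=; lra.
  exact: Series_correct (ex_re _ _ ha).
apply: (is_series_ext (fun k => vonMangoldt S k.+1 * npow_im k.+1 s)).
  by move=> k; rewrite npow_oppE /Im /=; lra.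
exact: Series_correct (ex_im _ _ ha).
Qed.

End LFunction.

(** * Uniqueness of Dirichlet coefficients *)

Lemma le_exp_decay_0 (A x : R) (s0 : R) : 0 < x -> 0 <= A ->
  (forall s, s0 <= s -> A <= exp (- (s * x))) -> A = 0.
Proof.
move=> hx hA h; case: (Rle_lt_or_eq_dec _ _ hA) => // hA'; exfalso.
have ix := Rinv_0_lt_compat _ hx; have iA := Rinv_0_lt_compat _ hA'.
pose s := Rmax s0 (/ A * / x).
have hs1 : / A * / x <= s by apply: Rmax_r.
have := h s (Rmax_l _ _); rewrite exp_Ropp => h1.
have sx : / A <= s * x.
  have := Rmult_le_compat_r _ _ _ (Rlt_le _ _ hx) hs1.
  by rewrite Rmult_assoc Rinv_l ?Rmult_1_r; lra.
have h2 : / A < exp (s * x).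
  have := exp_ineq1_le (s * x); lra.
have := Rinv_lt_contravar _ _ (Rmult_lt_0_compat _ _ iA (exp_pos _)) h2.
rewrite Rinv_inv; lra.
Qed.

(** Strong induction: once the earlier coefficients vanish, the term at n must be balanced by the
    later ones, which are O((n+1)^(-s)). Letting s grow, the ratio (n/(n+1))^s tends to 0 and forces
    D(n) = 0. *)
Lemma dirichlet_coef_zero (D : nat -> R) :
  (forall s, 1 < s -> is_series (fun k => D k.+1 * Rpower (INR k.+1) (- s)) 0) ->
  forall n, (0 < n)%N -> D n = 0.
Proof.
move=> hD.
have [B hB] : { B | forall k, Rabs (D k.+1 * Rpower (INR k.+1) (- (2))) <= B }.
  apply: (filterlim_bounded (fun k => D k.+1 * Rpower (INR k.+1) (- (2)))); exists 0.
  by apply: ex_series_lim_0; exists 0; apply: (hD 2); lra.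
have B0 : 0 <= B by apply: Rle_trans (hB 0%N); apply: Rabs_pos.
have hbnd n : (0 < n)%N -> Rabs (D n) * Rpower (INR n) (- (2)) <= B.
  case: n => // n _; have := hB n; rewrite Rabs_mult (Rabs_pos_eq (Rpower _ _)) //.
  by left; apply: Rpower_pos.
elim/ltn_ind => n IH n0.
have hn := INR_gt0 _ n0; have hn1 := INR_gt0 n.+1 isT.
(* Convergence at s = 2 gives |D(i)| <= B i^2. Of the exponent s, 2 is spent on this bound and 2 on
   the sum of i^(-2), which is at most 2; the remaining s - 4 is evaluated at the first index n +
   1. *)
have key s : 4 <= s -> Rabs (D n) * Rpower (INR n) (- s) <= 2 * B * Rpower (INR n.+1) (4 - s).
  move=> hs.
  have /(is_series_bigP (fun k => D k * Rpower (INR k) (- s))) /is_lim_seq_abs hl := hD s ltac:(lra).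
  rewrite /= Rabs_R0 in hl.
  suff : Rbar_le (Rabs (D n) * Rpower (INR n) (- s) - 2 * B * Rpower (INR n.+1) (4 - s)) 0.
    by rewrite /=; lra.
  apply: (is_lim_seq_le_loc (fun=> _) _ _ _ _ (is_lim_seq_const _) hl).
  exists n => N /leP hN.
  rewrite (rsum_cat n.+1) // rsum_recr // big1_seq; last first.
    move=> i /andP[_]; rewrite mem_index_iota => /andP[i0 ni].
    by rewrite IH // Rmult_0_l.
  rewrite Rplus_0_l.
  set X := D n * _; set Y := \sum_(_ <= i < _) _.
  have eX : Rabs X = Rabs (D n) * Rpower (INR n) (- s).
    by rewrite Rabs_mult (Rabs_pos_eq (Rpower _ _)) //; left; apply: Rpower_pos.
  have hY : Rabs Y <= 2 * B * Rpower (INR n.+1) (4 - s).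
    apply: Rle_trans (rsum_abs _ _ _ _) _.
    apply: Rle_trans (_ : \sum_(n.+1 <= i < N.+1)
      (B * Rpower (INR n.+1) (4 - s)) * Rpower (INR i) (- (1 + 1)) <= _).
      apply: rsum_le => i; rewrite mem_index_iota => /andP[ni iN] _.
      have i0 : (0 < i)%N by apply: leq_trans ni.
      rewrite Rabs_mult (Rabs_pos_eq (Rpower _ _)); last by left; apply: Rpower_pos.
      have -> : - s = - (2) + - (s - 4) + - (1 + 1) by lra.
      have -> : 4 - s = - (s - 4) by lra.
      rewrite !Rpower_plus -!Rmult_assoc; apply: Rmult_le_compat_r.
        by left; apply: Rpower_pos.
      apply: Rmult_le_compat; [|by left; apply: Rpower_pos|exact: hbnd|].
        by apply: Rmult_le_pos; [exact: Rabs_pos|left; apply: Rpower_pos].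
      apply: Rpower_decreasing; last lra.
      by split => //; apply: leq_INR.
    rewrite rsum_distrr.
    have hz : \sum_(n.+1 <= i < N.+1) Rpower (INR i) (- (1 + 1)) <= 2.
      have := zeta_partial_le 1 N.+1 ltac:(lra); rewrite (rsum_cat n.+1) // Rinv_1.
      have : 0 <= \sum_(1 <= i < n.+1) Rpower (INR i) (- (1 + 1)).
        by apply: rsum_ge0 => i _ _; left; apply: Rpower_pos.
      lra.
    have : 0 <= B * Rpower (INR n.+1) (4 - s).
      by apply: Rmult_le_pos => //; left; apply: Rpower_pos.
    nra.
  have := Rabs_triang_inv X (- Y); rewrite Rabs_Ropp.
  have -> : X - - Y = X + Y by lra.
  lra.
pose x := ln (INR n.+1) - ln (INR n).
have hx : 0 < x by rewrite /x; have := ln_increasing _ _ hn (ltn_INR _ _ (ltnSn n)); lra.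
pose K := 2 * B * Rpower (INR n.+1) 4 + 1.
have K0 : 0 < K.
  have := Rmult_le_pos _ _ B0 (Rlt_le _ _ (Rpower_pos (INR n.+1) 4)); rewrite /K; lra.
have iK := Rinv_0_lt_compat _ K0.
have : Rabs (D n) / K = 0.
  apply: (le_exp_decay_0 _ x 4) => //.
    by apply: Rmult_le_pos; [exact: Rabs_pos|lra].
  move=> s hs; have := key s hs.
  have -> : exp (- (s * x)) = Rpower (INR n.+1) (- s) * Rpower (INR n) s.
    by rewrite /Rpower -exp_plus; congr exp; rewrite /x; lra.
  rewrite /Rminus Rpower_plus => h.
  have e : Rpower (INR n) (- s) * Rpower (INR n) s = 1.
    by rewrite -Rpower_plus Rplus_opp_l Rpower_O.
  have p1 := Rpower_pos (INR n) s; have p2 := Rpower_pos (INR n.+1) (- s).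
  have := Rmult_le_compat_r _ _ _ (Rlt_le _ _ p1) h.
  rewrite Rmult_assoc e Rmult_1_r => h'.
  apply: (Rmult_le_reg_r K) => //; rewrite /Rdiv Rmult_assoc Rinv_l ?Rmult_1_r; last lra.
  apply: Rle_trans h' _; rewrite /K.
  have := Rmult_lt_0_compat _ _ p2 p1; lra.
move=> h; have : Rabs (D n) = 0.
  have -> : Rabs (D n) = Rabs (D n) / K * K by field; lra.
  by rewrite h; lra.
by case: (Req_dec (D n) 0) => // /Rabs_no_R0.
Qed.

(** The choice made by [epsilon] is a genuine expansion because [vonMangoldt S] is one. Both have
    the same sum at each real s > 1, and their difference is a vanishing Dirichlet series. *)
Lemma LambdaE S n : multiplicative_set S -> (0 < n)%N -> Lambda S n = vonMangoldt S n.
Proof.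
move=> hS.
have h1 : is_Lambda S (Lambda S).
  by apply: epsilon_spec; exists (vonMangoldt S); apply: is_Lambda_vonMangoldt.
have h2 := is_Lambda_vonMangoldt S hS.
move: n.
suff H n : (0 < n)%N -> Lambda S n - vonMangoldt S n = 0 by move=> n /H; lra.
apply: (dirichlet_coef_zero (fun n => Lambda S n - vonMangoldt S n)) => s hs.
have {h1} := h1 (RtoC s) hs; have {h2} := h2 (RtoC s) hs.
case: (- _)%C => a b /is_series_C[e1 _] /is_series_C[e2 _].
have := is_series_minus _ _ _ _ e2 e1; rewrite plus_opp_r => h.
apply: is_series_ext h => k; rewrite npow_oppE /npow_re /Re /Im /= !Rmult_0_l cos_0.
by rewrite /plus /opp /=; lra.
Qed.

(** * Partial summation from Condition B *)

Lemma nat_floor_bounds x : 0 <= x -> INR (nat_floor x) <= x < INR (nat_floor x) + 1.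
Proof.
move=> x0; have [h1 h2] := base_Int_part x.
have h3 : (0 <= Int_part x)%Z.
  have : IZR (-1) < IZR (Int_part x) by lra.
  by move/lt_IZR; lia.
rewrite /nat_floor INR_IZR_INZ Z2Nat.id //; lra.
Qed.

Lemma nat_floor_INR n : nat_floor (INR n) = n.
Proof.
have [h1 h2] := nat_floor_bounds (INR n) (pos_INR n).
apply/eqP; rewrite eqn_leq; apply/andP; split; apply/leP.
  exact: INR_le.
have : (n < (nat_floor (INR n)).+1)%coq_nat by apply: INR_lt; rewrite S_INR.
lia.
Qed.

Lemma prime_countS S n :
  INR (prime_count S (INR n.+1)) =
  INR (prime_count S (INR n)) + (if prime n.+1 then ind S n.+1 else 0).
Proof.
have e : iota 1 n.+1 = iota 1 n ++ [:: n.+1] by rewrite -[in LHS](addn1 n) iotaD add1n.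
rewrite /prime_count !nat_floor_INR e count_cat plus_INR; congr (_ + _).
rewrite [count _ _]/= addn0 /ind; case: (prime _) => //=.
by case: (_ \in S).
Qed.

Lemma ex_RInt_inv_ln a b : 1 < a <= b -> ex_RInt (fun t => / ln t) a b.
Proof.
move=> hab; apply: (ex_RInt_continuous (V := R_CompleteNormedModule)) => z.
rewrite Rmin_left ?Rmax_right; try lra; move=> hz.
apply: (ex_derive_continuous (V := R_NormedModule)).
auto_derive; split; first lra.
split => //; have := ln_gt0 z; lra.
Qed.

Lemma Li_succ n : (1 < n)%N ->
  / ln (INR n.+1) <= Li (INR n.+1) - Li (INR n) <= / ln (INR n).
Proof.
move=> n1; have h2 := INR_ge2 _ n1; have eS : INR n.+1 = INR n + 1 := S_INR n.
have ex1 : ex_RInt (fun t => / ln t) 2 (INR n) by apply: ex_RInt_inv_ln; lra.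
have ex2 : ex_RInt (fun t => / ln t) (INR n) (INR n.+1) by apply: ex_RInt_inv_ln; lra.
have ch : RInt (fun t => / ln t) 2 (INR n) + RInt (fun t => / ln t) (INR n) (INR n.+1) =
  RInt (fun t => / ln t) 2 (INR n.+1) := RInt_Chasles _ _ _ _ ex1 ex2.
rewrite /Li -ch (_ : forall u v : R, u + v - u = v); last by move=> *; lra.
have ec (c : R) : RInt (fun=> c) (INR n) (INR n.+1) = c.
  have -> : RInt (fun=> c) (INR n) (INR n.+1) = (INR n.+1 - INR n) * c by exact: RInt_const.
  rewrite eS; lra.
have l0 := ln_gt0 (INR n) ltac:(lra).
split.
  rewrite -[X in X <= _]ec.
  apply: RInt_le => //; [lra|exact: ex_RInt_const|] => x hx.
  apply: Rinv_le_contravar; first by apply: ln_gt0; lra.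
  by apply: ln_le; lra.
rewrite -[X in _ <= X]ec; apply: RInt_le => //; [lra|exact: ex_RInt_const|] => x hx.
apply: Rinv_le_contravar => //.
by apply: ln_le; lra.
Qed.

Lemma ln_succ_bounds x : 0 < x -> / (x + 1) <= ln (x + 1) - ln x <= / x.
Proof.
move=> hx.
have -> : ln (x + 1) - ln x = ln ((x + 1) / x) by rewrite ln_div; lra.
split; last first.
  have := ln_le_minus1 ((x + 1) / x) ltac:(by apply: Rdiv_lt_0_compat; lra).
  have -> // : (x + 1) / x - 1 = / x by field; lra.
have := ln_le_minus1 (x / (x + 1)) ltac:(by apply: Rdiv_lt_0_compat; lra).
have -> : ln (x / (x + 1)) = - ln ((x + 1) / x).
  by rewrite -ln_Rinv; [congr ln; field; lra|apply: Rdiv_lt_0_compat; lra].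
have -> : x / (x + 1) - 1 = - / (x + 1) by field; lra.
lra.
Qed.

Lemma ln_ge1 x : 3 <= x -> 1 <= ln x.
Proof.
move=> hx; rewrite -[X in X <= _]ln_exp; apply: ln_le; first exact: exp_pos.
have := exp_le_3; lra.
Qed.

Lemma Rinv_succ_diff x : 0 < x -> 0 <= / x - / (x + 1) <= / x ^ 2.
Proof.
move=> hx; have -> : / x - / (x + 1) = / (x * (x + 1)) by field; lra.
split; first by left; apply: Rinv_0_lt_compat; nra.
apply: Rinv_le_contravar; [exact: pow_lt|rewrite /=; nra].
Qed.

(** Both quantities lie between 1/(n+1) and 1/(n+1) + 1/n^2; n >= 3 ensures ln n >= 1. Weighting by
    ln(n+1)/(n+1) is thus what turns the main term Li into ln. *)
Lemma Li_increment_error n : (2 < n)%N ->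
  Rabs ((Li (INR n.+1) - Li (INR n)) * (ln (INR n.+1) / INR n.+1)
        - (ln (INR n.+1) - ln (INR n))) <= / INR n ^ 2.
Proof.
move=> n2; have [h1 h2] := Li_succ n (ltnW n2).
have hn : 3 <= INR n by have := leq_INR _ _ n2; rewrite [INR 3]/=; lra.
rewrite !S_INR in h1 h2 *; set x := INR n in hn h1 h2 *.
set d := Li (x + 1) - Li x in h1 h2 *.
have l1 := ln_ge1 x hn; have l2 := ln_ge1 (x + 1) ltac:(lra).
have [k1 k2] := ln_succ_bounds x ltac:(lra).
have [r1 r2] := Rinv_succ_diff x ltac:(lra).
have ix : 0 < / (x + 1) by apply: Rinv_0_lt_compat; lra.
have b1 : / (x + 1) <= d * (ln (x + 1) / (x + 1)).
  have -> : / (x + 1) = / ln (x + 1) * (ln (x + 1) / (x + 1)) by field; lra.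
  apply: Rmult_le_compat_r => //; apply: Rmult_le_pos; lra.
have b2 : d * (ln (x + 1) / (x + 1)) <= / (x + 1) + / x ^ 2.
  apply: Rle_trans (_ : / ln x * (ln (x + 1) / (x + 1)) <= _).
    apply: Rmult_le_compat_r => //; apply: Rmult_le_pos; lra.
  have -> : / ln x * (ln (x + 1) / (x + 1)) =
     / (x + 1) + (ln (x + 1) - ln x) * / ln x * / (x + 1) by field; lra.
  have e : (ln (x + 1) - ln x) * / ln x <= / x.
    have : / ln x <= 1 by rewrite -[X in _ <= X]Rinv_1; apply: Rinv_le_contravar; lra.
    have : 0 < / ln x by apply: Rinv_0_lt_compat; lra.
    nra.
  have e2 : / x * / (x + 1) <= / x ^ 2.
    have -> : / x ^ 2 = / x * / x by field; lra.
    apply: Rmult_le_compat_l; first by left; apply: Rinv_0_lt_compat; lra.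
    apply: Rinv_le_contravar; lra.
  have := Rmult_le_compat_r _ _ _ (Rlt_le _ _ ix) e; lra.
by apply: Rabs_le; lra.
Qed.

Lemma ln_div_id_increment x : 3 <= x ->
  Rabs (ln (x + 1) / (x + 1) - ln x / x) <= ln x / x ^ 2.
Proof.
move=> hx; have l1 := ln_ge1 x hx.
have [k1 k2] := ln_succ_bounds x ltac:(lra).
have [r1 r2] := Rinv_succ_diff x ltac:(lra).
have ix : 0 < / (x + 1) by apply: Rinv_0_lt_compat; lra.
have ix2 : 0 < / x ^ 2 by apply: Rinv_0_lt_compat; apply: pow_lt; lra.
have -> : ln (x + 1) / (x + 1) - ln x / x =
  (ln (x + 1) - ln x) * / (x + 1) - ln x * (/ x - / (x + 1)) by field; lra.
have e2 : / x * / (x + 1) <= / x ^ 2.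
  have -> : / x ^ 2 = / x * / x by field; lra.
  apply: Rmult_le_compat_l; first by left; apply: Rinv_0_lt_compat; lra.
  apply: Rinv_le_contravar; lra.
have a1 : 0 <= (ln (x + 1) - ln x) * / (x + 1) by apply: Rmult_le_pos; lra.
have a2 : (ln (x + 1) - ln x) * / (x + 1) <= / x ^ 2.
  by apply: Rle_trans e2; apply: Rmult_le_compat_r; lra.
have a3 : 0 <= ln x * (/ x - / (x + 1)) by apply: Rmult_le_pos; lra.
have a4 : ln x * (/ x - / (x + 1)) <= ln x * / x ^ 2 by apply: Rmult_le_compat_l; lra.
apply: Rabs_le; rewrite /Rdiv; nra.
Qed.

(** The mean value theorem for (ln t)^(-rho), standing in for the integral of 1/(t ln^(1+rho) t). It
    is applied at x = n - 1, whence the arguments n - 1 in the later error bounds. *)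
Lemma ln_neg_power_diff x rho : 1 < x -> 0 < rho ->
  / ((x + 1) * Rpower (ln (x + 1)) (1 + rho)) <=
  / rho * (Rpower (ln x) (- rho) - Rpower (ln (x + 1)) (- rho)).
Proof.
move=> hx hr.
have hd c : x <= c <= x + 1 ->
    derivable_pt_lim (fun t => Rpower (ln t) (- rho)) c
      (- rho * Rpower (ln c) (- rho - 1) * / c).
  move=> hc; apply: (derivable_pt_lim_comp ln (fun u => Rpower u (- rho))).
    by apply: derivable_pt_lim_ln; lra.
  by apply: derivable_pt_lim_power; apply: ln_gt0; lra.
have hx1 : x < x + 1 by lra.
have [c [hc1 hc2]] := MVT_cor2 _ _ _ _ hx1 hd.
have -> : Rpower (ln x) (- rho) - Rpower (ln (x + 1)) (- rho) =
   rho * (/ c * Rpower (ln c) (- (1 + rho))).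
  have -> : - (1 + rho) = - rho - 1 by lra.
  lra.
rewrite -Rmult_assoc Rinv_l ?Rmult_1_l; last lra.
rewrite Rinv_mult -Rpower_Ropp; apply: Rmult_le_compat.
- by left; apply: Rinv_0_lt_compat; lra.
- by left; apply: Rpower_pos.
- by apply: Rinv_le_contravar; lra.
- apply: Rpower_decreasing; last lra.
  by split; [apply: ln_gt0; lra|apply: ln_le; lra].
Qed.

(** A Cauchy bound that depends on the smaller index only survives letting the larger one tend to
    infinity, so it is also a rate of convergence. *)
Lemma lim_cauchy_rate (e phi : nat -> R) n0 :
  (forall M N, (n0 <= M)%N -> (M <= N)%N -> Rabs (e N - e M) <= phi M) ->
  is_lim_seq phi 0 ->
  exists l : R, is_lim_seq e l /\ forall M, (n0 <= M)%N -> Rabs (e M - l) <= phi M.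
Proof.
move=> he hphi.
have [l hl] : ex_finite_lim_seq e.
  apply/ex_lim_seq_cauchy_corr => eps.
  move/is_lim_seq_spec: hphi => /(_ (pos_div_2 eps)) [N1 h1].
  pose N0 := maxn n0 N1.
  have hphi0 : phi N0 < eps / 2.
    have := h1 N0 ltac:(apply/leP; apply: leq_maxr); rewrite Rminus_0_r => h.
    by apply: Rle_lt_trans (Rle_abs _) h.
  exists N0 => n m /leP hn /leP hm.
  have a1 := he N0 n (leq_maxl _ _) hn; have a2 := he N0 m (leq_maxl _ _) hm.
  have -> : e n - e m = (e n - e N0) + - (e m - e N0) by lra.
  apply: Rle_lt_trans (Rabs_triang _ _) _; rewrite Rabs_Ropp; lra.
exists l; split => // M hM.
suff : Rbar_le (Rabs (l - e M)) (phi M) by rewrite /= Rabs_minus_sym.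
apply: (is_lim_seq_le_loc (fun N => Rabs (e N - e M)) (fun=> phi M)).
- by exists M => N /leP hN; apply: he.
- apply: (is_lim_seq_abs _ (l - e M)).
  exact: is_lim_seq_minus' hl (is_lim_seq_const _).
- exact: is_lim_seq_const.
Qed.

Lemma INR_large x : exists n, x < INR n.
Proof. by have [n h] := INR_unbounded x; exists n. Qed.

Lemma Rpower_neg_lim0 (f : nat -> R) a : 0 < a ->
  (forall A, exists n0, forall n, (n0 <= n)%N -> A < f n) ->
  is_lim_seq (fun n => Rpower (f n) (- a)) 0.
Proof.
move=> ha hf; apply/is_lim_seq_spec => eps.
pose Y := Rpower (/ eps) (/ a).
have ie : 0 < / eps by apply: Rinv_0_lt_compat; apply: cond_pos.
have [n0 hn0] := hf Y; exists n0 => n /leP /hn0 hl.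
rewrite Rminus_0_r Rabs_pos_eq; last by left; apply: Rpower_pos.
have Y0 : 0 < Y := Rpower_pos _ _.
have : Rpower Y a < Rpower (f n) a by apply: Rlt_Rpower_l.
have -> : Rpower Y a = / eps by rewrite /Y Rpower_mult Rinv_l ?Rpower_1; lra.
move=> h; rewrite Rpower_Ropp -(Rinv_inv eps).
by apply: Rinv_lt_contravar => //; apply: Rmult_lt_0_compat => //; apply: Rpower_pos.
Qed.

Lemma ln_power_lim0 rho : 0 < rho ->
  is_lim_seq (fun n => Rpower (ln (INR n.-1)) (- rho)) 0.
Proof.
move=> hr; apply: (Rpower_neg_lim0 (fun n => ln (INR n.-1))) => // A.
have [n0 hn0] := INR_large (exp A); exists n0.+1 => n hn.
rewrite -(ln_exp A); apply: ln_increasing; first exact: exp_pos.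
by apply: Rlt_le_trans hn0 _; apply: leq_INR; rewrite -ltnS (leq_trans hn) // leqSpred.
Qed.

Lemma INR_power_lim0 a : 0 < a -> is_lim_seq (fun n => Rpower (INR n) (- a)) 0.
Proof.
move=> ha; apply: (Rpower_neg_lim0 (fun n => INR n)) => // A.
have [n0 hn0] := INR_large A; exists n0 => n hn.
by apply: Rlt_le_trans hn0 _; apply: leq_INR.
Qed.

Section Asymptotics.
Variables (S : set nat) (delta rho : R).
Hypotheses (hS : multiplicative_set S) (hB : condition_B S delta rho).

Let delta0 : 0 < delta. Proof. by case: hB. Qed.
Let rho0 : 0 < rho. Proof. by case: hB => _ []. Qed.

Let Rem n := INR (prime_count S (INR n)) - delta * Li (INR n).

Lemma prime_remainder_bound :
  exists K n0, 0 <= K /\ (3 < n0)%N /\ forall n, (n0 <= n)%N ->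
    Rabs (Rem n) <= K * (INR n / Rpower (ln (INR n)) (2 + rho)).
Proof.
case: hB => _ [_ [K [M hK]]]; have [n1 hn1] := INR_large M.
(* A threshold of at least 4 keeps n - 1 >= 3, so logarithms at n - 1 are positive and those at n
   are at least 1. The constant K of the O-bound has no prescribed sign. *)
exists (Rabs K), (maxn n1 4); split; first exact: Rabs_pos.
split; first exact: leq_maxr.
move=> n hn; have hM : M < INR n.
  by apply: Rlt_le_trans hn1 _; apply: leq_INR; apply: leq_trans hn; apply: leq_maxl.
apply: Rle_trans (hK _ hM) _.
have hq : 0 <= INR n / Rpower (ln (INR n)) (2 + rho).
  apply: Rmult_le_pos; first exact: pos_INR.
  by left; apply: Rinv_0_lt_compat; apply: Rpower_pos.
rewrite (Rabs_pos_eq (_ / _)) //; apply: Rmult_le_compat_r => //; exact: Rle_abs.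
Qed.

Definition weighted_sum n := \sum_(1 <= k < n.+1) vonMangoldt S k / INR k.

Let psi n := Rpower (ln (INR n)) (- rho).
(* Subtracting the boundary term of the summation by parts makes the increments of e
   absolutely summable. *)
Let e n := weighted_sum n - delta * ln (INR n) - Rem n * (ln (INR n) / INR n).

(** When n + 1 is prime, the jump of the prime count times ln(n+1)/(n+1) equals the von Mangoldt
    term and cancels it. What remains are the proper prime powers, the error in replacing Li by ln,
    and the summation by parts term. *)
Lemma e_increment n : (0 < n)%N -> e n.+1 - e n =
  proper_part S n.+1
  + delta * ((Li (INR n.+1) - Li (INR n)) * (ln (INR n.+1) / INR n.+1)
             - (ln (INR n.+1) - ln (INR n)))
  - Rem n * (ln (INR n.+1) / INR n.+1 - ln (INR n) / INR n).
Proof.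
move=> n0; rewrite /e /weighted_sum rsum_recr // /Rem prime_countS /proper_part.
case: ifP => pn; last lra.
rewrite vonMangoldt_prime //; lra.
Qed.

Lemma e_increment_bound : exists C n0, 0 <= C /\ (3 < n0)%N /\ forall n, (n0 <= n)%N ->
  Rabs (e n.+1 - e n) <= Rabs (proper_part S n.+1) + C * (psi n.-1 - psi n).
Proof.
have [K [n0 [K0 [hn0 hK]]]] := prime_remainder_bound.
(* From ln^(1+rho) n <= C2 n, so that errors 1/n^2 fit under 1/(n ln^(1+rho) n). *)
pose C2 := Rpower ((1 + rho) / 1) (1 + rho).
have C20 : 0 < C2 := Rpower_pos _ _.
exists ((delta * C2 + K) * / rho), n0; split.
  apply: Rmult_le_pos; last by left; apply: Rinv_0_lt_compat.
  by have := Rmult_lt_0_compat _ _ delta0 C20; lra.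
split => // n hn.
have n3 : (3 < n)%N := leq_trans hn0 hn.
have x4 : 4 <= INR n by have := leq_INR _ _ n3; rewrite [INR 4]/=; lra.
have l1 := ln_ge1 (INR n) ltac:(lra).
rewrite e_increment; last exact: ltn_trans n3.
have eS := S_INR n; have ep : INR n = INR n.-1 + 1.
  by rewrite -S_INR prednK // (ltn_trans _ n3).
have h1 := Li_increment_error n (ltnW n3).
have h2 := ln_div_id_increment (INR n) ltac:(lra); rewrite -S_INR in h2.
have h3 := hK n hn.
have h4 := ln_neg_power_diff (INR n.-1) rho ltac:(lra) rho0; rewrite -ep in h4.
set w := / (INR n * _) in h4.
have w0 : 0 < w.
  by apply: Rinv_0_lt_compat; apply: Rmult_lt_0_compat; [lra|exact: Rpower_pos].
have h5 : / INR n ^ 2 <= C2 * w.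
  have := Rpower_ln_le (INR n) (1 + rho) 1 ltac:(lra) ltac:(lra) ltac:(lra).
  rewrite -/C2 Rpower_1; last lra.
  move=> h; rewrite /w.
  have p := Rpower_pos (ln (INR n)) (1 + rho).
  have -> : / INR n ^ 2 = / INR n * / INR n by field; lra.
  rewrite Rinv_mult; apply: (Rmult_le_reg_r (INR n * INR n * Rpower (ln (INR n)) (1 + rho))).
    by apply: Rmult_lt_0_compat => //; nra.
  have -> : / INR n * / INR n * (INR n * INR n * Rpower (ln (INR n)) (1 + rho)) =
     Rpower (ln (INR n)) (1 + rho) by field; lra.
  have -> // : C2 * (/ INR n * / Rpower (ln (INR n)) (1 + rho)) *
    (INR n * INR n * Rpower (ln (INR n)) (1 + rho)) = C2 * INR n.
  by field; lra.
have h6 : Rabs (Rem n * (ln (INR n.+1) / INR n.+1 - ln (INR n) / INR n)) <= K * w.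
  rewrite Rabs_mult; apply: Rle_trans (Rmult_le_compat _ _ _ _ _ _ h3 h2) _; try exact: Rabs_pos.
  right; rewrite /w.
  have -> : 2 + rho = 1 + (1 + rho) by lra.
  rewrite Rpower_plus Rpower_1; last lra.
  have p := Rpower_pos (ln (INR n)) (1 + rho).
  by field; lra.
rewrite /Rminus; apply: Rle_trans (Rabs_triang _ _) _; rewrite Rabs_Ropp.
have := Rabs_triang (proper_part S n.+1)
   (delta * ((Li (INR n.+1) - Li (INR n)) * (ln (INR n.+1) / INR n.+1)
             - (ln (INR n.+1) - ln (INR n)))).
rewrite Rabs_mult (Rabs_pos_eq delta); last lra.
have := Rmult_le_compat_l _ _ _ (Rlt_le _ _ delta0) (Rle_trans _ _ _ h1 h5).
have c0 : 0 <= delta * C2 + K by have := Rmult_lt_0_compat _ _ delta0 C20; lra.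
have := Rmult_le_compat_l _ _ _ c0 h4.
rewrite /psi /Rminus in h6 *; lra.
Qed.

Lemma weighted_sum_asymptotic : exists l C n0, 0 <= C /\ (3 < n0)%N /\
  forall n, (n0 <= n)%N -> Rabs (weighted_sum n - delta * ln (INR n) - l) <= C * psi n.-1.
Proof.
have [C1 [n0 [C10 [hn0 hC1]]]] := e_increment_bound.
have [C2 [C20 hC2]] := proper_part_tail S hS.
have [K [n1 [K0 [hn1 hK]]]] := prime_remainder_bound.
(* Converts the prime power tail n^(-1/8) into the rate ln^(-rho). *)
pose C3 := Rpower (rho / (/ 8)) rho.
have C30 : 0 < C3 := Rpower_pos _ _.
pose m0 := maxn n0 n1.
have psi0 n : 0 < psi n := Rpower_pos _ _.
have pred4 n : (3 < n)%N -> [/\ INR n = INR n.-1 + 1, 3 <= INR n.-1 & (0 < n.-1)%N].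
  move=> n3; have e1 : INR n = INR n.-1 + 1 by rewrite -S_INR prednK // (ltn_trans _ n3).
  have := leq_INR _ _ n3; rewrite [INR 4]/= => h; split => //; first lra.
  by rewrite -ltnS prednK ?(ltn_trans _ n3).
have hpow n : (3 < n)%N -> Rpower (INR n.+1) (- / 8) <= C3 * psi n.-1.
  move=> n3; have [e1 h1 h2] := pred4 n n3.
  apply: Rle_trans (_ : Rpower (INR n.-1) (- / 8) <= _).
    have := S_INR n => eS; apply: Rpower_decreasing; lra.
  have := Rpower_ln_le (INR n.-1) rho (/ 8) ltac:(lra) rho0 ltac:(lra); rewrite -/C3.
  rewrite /psi !Rpower_Ropp.
  have p1 := Rpower_pos (ln (INR n.-1)) rho; have p2 := Rpower_pos (INR n.-1) (/ 8).
  move=> h; apply: (Rmult_le_reg_r (Rpower (INR n.-1) (/ 8) * Rpower (ln (INR n.-1)) rho)).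
    exact: Rmult_lt_0_compat.
  have -> : / Rpower (INR n.-1) (/ 8) * (Rpower (INR n.-1) (/ 8) * Rpower (ln (INR n.-1)) rho) =
    Rpower (ln (INR n.-1)) rho by field; lra.
  have -> // : C3 * / Rpower (ln (INR n.-1)) rho *
    (Rpower (INR n.-1) (/ 8) * Rpower (ln (INR n.-1)) rho) = C3 * Rpower (INR n.-1) (/ 8).
  by field; lra.
have he M N : (m0 <= M)%N -> (M <= N)%N -> Rabs (e N - e M) <= (C2 * C3 + C1) * psi M.-1.
  move=> hM hMN.
  have hM0 : (n0 <= M)%N by apply: leq_trans hM; apply: leq_maxl.
  have M3 : (3 < M)%N := leq_trans hn0 hM0.
  have -> : e N - e M = - \sum_(M <= n < N) (e n - e n.+1) by rewrite rsum_telescope //; lra.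
  rewrite Rabs_Ropp; apply: Rle_trans (rsum_abs _ _ _ _) _.
  apply: Rle_trans (_ : \sum_(M <= n < N) (Rabs (proper_part S n.+1) +
     C1 * (psi n.-1 - psi n.-1.+1)) <= _).
    apply: rsum_le => n; rewrite mem_index_iota => /andP[Mn nN] _.
    rewrite Rabs_minus_sym prednK; last by apply: leq_trans Mn; apply: leq_trans M3.
    by apply: hC1; apply: leq_trans Mn.
  rewrite rsumD rsum_distrr.
  have t1 : \sum_(M <= n < N) Rabs (proper_part S n.+1) <= C2 * (C3 * psi M.-1).
    have := hC2 M.+1 N.+1 isT; rewrite big_add1 /= => h; apply: Rle_trans h _.
    by apply: Rmult_le_compat_l => //; apply: hpow.
  have t2 : \sum_(M <= n < N) (psi n.-1 - psi n.-1.+1) <= psi M.-1.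
    have := rsum_telescope psi M.-1 N.-1 ltac:(by rewrite -!subn1 leq_sub2r).
    have -> : \sum_(M.-1 <= i < N.-1) (psi i - psi i.+1) =
       \sum_(M <= n < N) (psi n.-1 - psi n.-1.+1).
      have M1 : (0 < M)%N by apply: ltn_trans M3.
      rewrite -{2}(prednK M1) -{2}(prednK (leq_trans M1 hMN)).
      by rewrite big_add1.
    have := psi0 N.-1; lra.
  have := Rmult_le_compat_l _ _ _ C10 t2; lra.
have lphi : is_lim_seq (fun M => (C2 * C3 + C1) * psi M.-1) 0.
  rewrite -(Rmult_0_r (C2 * C3 + C1)).
  exact: (is_lim_seq_scal_l _ _ 0 (ln_power_lim0 rho rho0)).
have [l [_ hl]] := lim_cauchy_rate e _ m0 he lphi.
(* The summand K pays for restoring the boundary term that [e] had removed; it is O(ln^(-1-rho) n),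
   more than is needed. *)
exists l, (C2 * C3 + C1 + K), m0; split.
  have := Rmult_le_pos _ _ C20 (Rlt_le _ _ C30); lra.
split; first by apply: leq_trans hn0 (leq_maxl _ _).
move=> n hn; have hnn1 : (n1 <= n)%N by apply: leq_trans hn; apply: leq_maxr.
have n3 : (3 < n)%N := leq_trans hn1 hnn1.
have [e1 h1 h2] := pred4 n n3.
have l1 := ln_ge1 (INR n) ltac:(lra).
have hr : Rabs (Rem n * (ln (INR n) / INR n)) <= K * psi n.-1.
  rewrite Rabs_mult (Rabs_pos_eq (_ / _)); last first.
    by apply: Rmult_le_pos; [lra|left; apply: Rinv_0_lt_compat; lra].
  apply: Rle_trans (_ : K * (INR n / Rpower (ln (INR n)) (2 + rho)) * (ln (INR n) / INR n) <= _).
    apply: Rmult_le_compat_r; last exact: hK.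
    by apply: Rmult_le_pos; [lra|left; apply: Rinv_0_lt_compat; lra].
  have -> : 2 + rho = 1 + 1 + rho by lra.
  rewrite !Rpower_plus Rpower_1; last lra.
  have p := Rpower_pos (ln (INR n)) rho.
  have -> : K * (INR n / (ln (INR n) * ln (INR n) * Rpower (ln (INR n)) rho)) * (ln (INR n) / INR n)
     = K * (/ ln (INR n) * / Rpower (ln (INR n)) rho) by field; lra.
  apply: Rmult_le_compat_l => //; rewrite -Rpower_Ropp.
  apply: Rle_trans (_ : 1 * Rpower (ln (INR n)) (- rho) <= _).
    apply: Rmult_le_compat_r; first by left; apply: Rpower_pos.
    by rewrite -[X in _ <= X]Rinv_1; apply: Rinv_le_contravar; lra.
  rewrite Rmult_1_l; apply: Rpower_decreasing; last lra.
  by split; [apply: ln_gt0; lra|apply: ln_le; lra].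
have := hl n hn.
have -> : weighted_sum n - delta * ln (INR n) - l = (e n - l) + Rem n * (ln (INR n) / INR n).
  by rewrite /e; lra.
have := Rabs_triang (e n - l) (Rem n * (ln (INR n) / INR n)); lra.
Qed.

End Asymptotics.

(** * Abelian limit at s = 1 *)

Lemma is_lim_seq_inv_INR : is_lim_seq (fun n => / INR n) 0.
Proof.
have h := INR_power_lim0 1 ltac:(lra).
apply: (is_lim_seq_ext_loc _ _ _ _ h); exists 1%N => n /leP hn.
by rewrite Rpower_Ropp Rpower_1 //; apply: INR_gt0.
Qed.

Lemma harmonic_minus_ln_lim : exists g : R,
  is_lim_seq (fun n => \sum_(1 <= k < n.+1) / INR k - ln (INR n)) g.
Proof.
pose c n := \sum_(1 <= k < n.+1) / INR k - ln (INR n).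
have step n : (0 < n)%N -> c n.+1 <= c n.
  move=> n0; rewrite /c rsum_recr // S_INR.
  have := ln_succ_bounds (INR n) (INR_gt0 _ n0); lra.
have [g hg] : ex_finite_lim_seq (fun n => c n.+1).
  apply: (ex_finite_lim_seq_decr _ 0) => n; first exact: step.
  suff : ln (INR n.+2) <= \sum_(1 <= k < n.+2) / INR k.
    have := ln_increasing _ _ (INR_gt0 n.+1 isT) (ltn_INR _ _ (ltnSn n.+1)).
    by rewrite /c; lra.
  elim: n => [|n IH].
    rewrite big_nat1 (_ : INR 2 = 1 + 1) // [INR 1]/= Rinv_1.
    have := ln_le_minus1 (1 + 1); lra.
  rewrite rsum_recr //.
  have := ln_succ_bounds (INR n.+2) (INR_gt0 n.+2 isT); rewrite -(S_INR n.+2); lra.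
by exists g; apply/is_lim_seq_incr_1.
Qed.

Lemma euler_gamma_lim :
  is_lim_seq (fun n => \sum_(1 <= k < n.+1) / INR k - ln (INR n)) euler_gamma.
Proof.
have [g hg] := harmonic_minus_ln_lim.
suff -> : euler_gamma = g by [].
rewrite /euler_gamma (Lim_seq_ext _ _ (fun n => congr1 (Rminus^~ _) (sum_n_m_big _ _ _))).
by rewrite (is_lim_seq_unique _ _ hg).
Qed.

Lemma Rpower_neg_le1 n a : (0 < n)%N -> 0 <= a -> Rpower (INR n) (- a) <= 1.
Proof.
move=> n0 ha; rewrite -(Rpower_INR1 (- a)); apply: Rpower_decreasing => //.
by split; [exact: INR_gt0|exact: leq_INR].
Qed.

(** Summation by parts against the remainders r of the partial sums. The weights n^(-a) decrease
    from 1, so the indices n >= M, where r is small, cost at most eta/3 in total variation; those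
    below M cost B (1 - M^(-a)) <= a B ln M, which fixes the range of a. *)
Lemma abel_limit (t : nat -> R) (l : R) :
  is_lim_seq (fun N => \sum_(1 <= n < N.+1) t n) l ->
  forall eta, 0 < eta -> exists e0, 0 < e0 /\ forall a, 0 < a < e0 ->
    exists N0, forall N, (N0 <= N)%N ->
      Rabs (\sum_(1 <= n < N.+1) t n * Rpower (INR n) (- a) - l) <= eta.
Proof.
move=> hT eta eta0.
pose r N := \sum_(1 <= n < N.+1) t n - l.
have hr : is_lim_seq r 0.
  rewrite -(Rminus_diag l); exact: is_lim_seq_minus' hT (is_lim_seq_const _).
have [B hB] : { B | forall n, Rabs (r n) <= B }.
  by apply: (filterlim_bounded r); exists 0.
have B0 : 0 <= B := Rle_trans _ _ _ (Rabs_pos _) (hB 0%N).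
have eta3 : 0 < eta / 3 by lra.
move/is_lim_seq_spec: hr => /(_ (mkposreal _ eta3)) [M0 hM0].
pose M := M0.+1.
have hM n : (M <= n)%N -> Rabs (r n) <= eta / 3.
  move=> hn; left; have := hM0 n; rewrite Rminus_0_r; apply; apply/leP; exact: ltnW.
have lM : 0 <= ln (INR M) by apply: ln_INR_ge0.
have den : 0 < B * ln (INR M) + 1 by have := Rmult_le_pos _ _ B0 lM; lra.
exists (eta / 3 / (B * ln (INR M) + 1)); split; first exact: Rdiv_lt_0_compat.
move=> a [a0 ha]; exists M => N hN.
pose w n := Rpower (INR n) (- a).
have wpos n : 0 < w n := Rpower_pos _ _.
have wdec n : (0 < n)%N -> 0 <= w n - w n.+1.
  move=> n0; suff : w n.+1 <= w n by lra.
  apply: Rpower_decreasing; last lra.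
  by split; [exact: INR_gt0|exact: leq_INR].
(* The subtracted l fits exactly, since r(0) = -l and w(1) = 1. *)
have parts K : \sum_(1 <= n < K.+2) t n * w n - l =
    r K.+1 * w K.+1 + \sum_(1 <= n < K.+1) r n * (w n - w n.+1).
  elim: K => [|K IH].
    by rewrite /r !big_nat1 big_geq // /w Rpower_INR1; lra.
  rewrite rsum_recr // [in RHS]rsum_recr //.
  have -> : t K.+2 = r K.+2 - r K.+1 by rewrite /r (rsum_recr _ K.+2) //; lra.
  lra.
have N1 : N = N.-1.+1 by rewrite prednK // (leq_trans _ hN).
rewrite N1 parts -N1.
have b1 : Rabs (r N * w N) <= eta / 3.
  rewrite Rabs_mult (Rabs_pos_eq (w N)); last by left.
  have := Rpower_neg_le1 N a ltac:(by rewrite N1) ltac:(lra); rewrite -/(w N).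
  have := hM N hN; have := Rabs_pos (r N); have := wpos N; nra.
have b2 : Rabs (\sum_(1 <= n < M) r n * (w n - w n.+1)) <= eta / 3.
  apply: Rle_trans (rsum_abs _ _ _ _) _.
  apply: Rle_trans (_ : \sum_(1 <= n < M) B * (w n - w n.+1) <= _).
    apply: rsum_le => n; rewrite mem_index_iota => /andP[n0 _] _.
    rewrite Rabs_mult (Rabs_pos_eq (_ - _)); last exact: wdec.
    by apply: Rmult_le_compat_r; [exact: wdec|exact: hB].
  rewrite rsum_distrr rsum_telescope // {1}/w Rpower_INR1.
  have h1 : 1 - w M <= a * ln (INR M).
    have := exp_ineq1_le (- a * ln (INR M)); rewrite /w /Rpower; lra.
  have h2 := Rmult_le_compat_l _ _ _ B0 h1.
  have h3 : a * (B * ln (INR M) + 1) < eta / 3.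
    have := Rmult_lt_compat_r _ _ _ den ha.
    by rewrite /Rdiv (Rmult_assoc _ (/ _)) Rinv_l ?Rmult_1_r; lra.
  lra.
have b3 : Rabs (\sum_(M <= n < N) r n * (w n - w n.+1)) <= eta / 3.
  apply: Rle_trans (rsum_abs _ _ _ _) _.
  apply: Rle_trans (_ : \sum_(M <= n < N) (eta / 3) * (w n - w n.+1) <= _).
    apply: rsum_le => n; rewrite mem_index_iota => /andP[Mn _] _.
    have n0 : (0 < n)%N by apply: leq_trans Mn.
    rewrite Rabs_mult (Rabs_pos_eq (_ - _)); last exact: wdec.
    by apply: Rmult_le_compat_r; [exact: wdec|exact: hM].
  rewrite rsum_distrr rsum_telescope //.
  have := Rpower_neg_le1 M a isT ltac:(lra); rewrite -/(w M).
  have := wpos N; nra.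
rewrite (rsum_cat M) //.
apply: Rle_trans (Rabs_triang _ _) _.
have := Rabs_triang (\sum_(1 <= n < M) r n * (w n - w n.+1)) (\sum_(M <= n < N) r n * (w n - w n.+1)).
lra.
Qed.

(* The Dirichlet series with coefficients n (ln(n+1) - ln n), at 1 + a, is 1/a + O(a). *)
Lemma ln_increment_partial a N : 0 < a <= 1 ->
  0 <= \sum_(1 <= n < N.+1) (ln (INR n.+1) - ln (INR n)) * Rpower (INR n) (- a)
       - (1 - Rpower (INR N.+1) (- a)) / a <= 6 * a.
Proof.
move=> [a0 a1]; pose w n := Rpower (INR n) (- a).
have -> : (1 - Rpower (INR N.+1) (- a)) / a = \sum_(1 <= n < N.+1) (/ a * w n - / a * w n.+1).
  by rewrite (rsum_telescope (fun n => / a * w n)) // /w Rpower_INR1 /Rdiv; lra.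
rewrite -rsumB.
have term n : (0 < n)%N -> 0 <= (ln (INR n.+1) - ln (INR n)) * w n - (/ a * w n - / a * w n.+1)
    <= (3 * a) * Rpower (INR n) (- (1 + 1)).
  move=> n0; have hn := INR_gt0 _ n0; have n1 := INR_ge1 _ n0.
  have [u0 u1] := ln_succ_bounds (INR n) hn; rewrite -(S_INR n) in u0 u1.
  set u := ln (INR n.+1) - ln (INR n) in u0 u1 *.
  have iS : 0 < / INR n.+1 by apply: Rinv_0_lt_compat; apply: INR_gt0.
  have in1 : / INR n <= 1 by rewrite -[X in _ <= X]Rinv_1; apply: Rinv_le_contravar; lra.
  (* The term thus becomes (w(n)/a)(e^(-au) - 1 + au), nonnegative and of second order in au. The
     factor 3 bounds e, and 6 = 3 * 2 with 2 bounding the sum of n^(-2). *)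
  have ew : w n.+1 = w n * exp (- (a * u)).
    rewrite /w /Rpower -exp_plus /u; congr exp; lra.
  have au : 0 <= a * u <= 1 by split; nra.
  have -> : u * w n - (/ a * w n - / a * w n.+1) =
      / a * w n * (a * u - 1 + exp (- (a * u))) by rewrite ew; field; lra.
  have ia : 0 < / a by apply: Rinv_0_lt_compat.
  have w0 : 0 < w n := Rpower_pos _ _.
  have w1 : w n <= 1 by apply: Rpower_neg_le1 => //; lra.
  have iaw : 0 < / a * w n by apply: Rmult_lt_0_compat.
  have l1 := exp_ineq1_le (- (a * u)).
  split; first by apply: Rmult_le_pos; lra.
  have l2 : a * u - 1 + exp (- (a * u)) <= 3 * (a * u) ^ 2.
    have := Rabs_exp_taylor (- (a * u)).
    rewrite Rabs_Ropp (Rabs_pos_eq (a * u)); last lra.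
    have -> : exp (- (a * u)) - 1 - - (a * u) = a * u - 1 + exp (- (a * u)) by lra.
    rewrite Rabs_pos_eq; last lra.
    have -> : (- (a * u)) ^ 2 = (a * u) ^ 2 by rewrite /=; lra.
    have : exp (a * u) <= 3 by apply: Rle_trans (exp_le _ 1 _) exp_le_3; lra.
    have := pow2_ge_0 (a * u); nra.
  have l3 : u ^ 2 <= Rpower (INR n) (- (1 + 1)).
    rewrite Rpower_Ropp Rpower_plus Rpower_1 // Rinv_mult /= Rmult_1_r.
    apply: Rmult_le_compat; lra.
  apply: Rle_trans (Rmult_le_compat_l _ _ _ (Rlt_le _ _ iaw) l2) _.
  have -> : / a * w n * (3 * (a * u) ^ 2) = 3 * a * (w n * u ^ 2) by field; lra.
  apply: Rmult_le_compat_l; first lra.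
  have := pow2_ge_0 u; nra.
split.
  by apply: rsum_ge0 => n; rewrite mem_index_iota => /andP[n0 _] _; case: (term n n0).
apply: Rle_trans (_ : \sum_(1 <= n < N.+1) (3 * a) * Rpower (INR n) (- (1 + 1)) <= _).
  by apply: rsum_le => n; rewrite mem_index_iota => /andP[n0 _] _; case: (term n n0).
rewrite rsum_distrr; have := zeta_partial_le 1 N.+1 ltac:(lra); rewrite Rinv_1.
have : 0 <= \sum_(1 <= n < N.+1) Rpower (INR n) (- (1 + 1)).
  by apply: rsum_ge0 => n _ _; left; apply: Rpower_pos.
nra.
Qed.

Lemma ln_succ_lim0 : is_lim_seq (fun n => ln (INR n.+1) - ln (INR n)) 0.
Proof.
apply: (is_lim_seq_le_le_loc (fun=> 0) _ (fun n => / INR n)).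
- exists 1%N => n /leP n0; have hn := INR_gt0 _ n0.
  have := ln_succ_bounds (INR n) hn; rewrite -S_INR.
  have : 0 < / INR n.+1 by apply: Rinv_0_lt_compat; apply: INR_gt0.
  lra.
- exact: is_lim_seq_const.
- exact: is_lim_seq_inv_INR.
Qed.

Section Consequences.
Variables (S : set nat) (delta rho : R).
Hypotheses (hS : multiplicative_set S) (hB : condition_B S delta rho).
Variable l : R.

Lemma sum_LambdaE N :
  sum_n_m (fun n => Lambda S n / INR n) 1 N = weighted_sum S N.
Proof.
by rewrite sum_n_m_big; apply: eq_big_nat => n /andP[n0 _]; rewrite LambdaE.
Qed.

Hypothesis hl : is_lim_seq (fun n => weighted_sum S n - delta * ln (INR n)) l.

(** The comparison terms are delta (ln(n+1) - ln n) rather than delta/n: they telescope at s = 1,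
    and their Dirichlet series is 1/a + O(a) without a constant term, so neither the zeta function
    nor Euler's constant enters. *)
Lemma euler_kronecker_limit : is_Euler_Kronecker S delta (- l).
Proof.
case: (hB) => delta0 _.
have hT : is_lim_seq (fun N => \sum_(1 <= n < N.+1)
    (vonMangoldt S n / INR n - delta * (ln (INR n.+1) - ln (INR n)))) l.
  have hd : is_lim_seq (fun n => delta * (ln (INR n.+1) - ln (INR n))) (delta * 0).
    exact: (is_lim_seq_scal_l _ delta 0 ln_succ_lim0).
  have := is_lim_seq_minus' _ _ _ _ hl hd.
  rewrite Rmult_0_r Rminus_0_r; apply: is_lim_seq_ext => N.
  rewrite rsumB rsum_distrr.
  have -> : \sum_(1 <= i < N.+1) (ln (INR i.+1) - ln (INR i)) = ln (INR N.+1).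
    have -> : \sum_(1 <= i < N.+1) (ln (INR i.+1) - ln (INR i)) =
      \sum_(1 <= i < N.+1) (- ln (INR i) - - ln (INR i.+1)).
      by apply: eq_bigr => i _; lra.
    transitivity (- ln 1 - - ln (INR N.+1)); last by rewrite ln_1; lra.
    exact: (rsum_telescope (fun i => - ln (INR i))).
  rewrite /weighted_sum; lra.
apply/filterlim_locally => eps.
have eps2 : 0 < eps / 2 by have := cond_pos eps; lra.
(* Makes the O(a) error 6 delta a smaller than eps/4. *)
have eps4 : 0 < eps / (4 * (6 * delta)).
  by apply: Rdiv_lt_0_compat; [exact: cond_pos|lra].
have [e0 [e00 he0]] := abel_limit _ _ hT (eps / 2) eps2.
have dpos : 0 < Rmin (Rmin e0 1) (eps / (4 * (6 * delta))) by do !apply: Rmin_pos => //; lra.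
exists (mkposreal _ dpos) => s hs s1.
have {hs} : Rabs (s - 1) < Rmin (Rmin e0 1) (eps / (4 * (6 * delta))) by exact: hs.
set a := s - 1; have a0 : 0 < a by rewrite /a; lra.
rewrite Rabs_pos_eq; last lra.
move=> ha; have ha1 := Rlt_le_trans _ _ _ ha (Rmin_l _ _).
have ha2 := Rlt_le_trans _ _ _ ha (Rmin_r _ _).
have ha3 := Rlt_le_trans _ _ _ ha1 (Rmin_l _ _).
have ha4 := Rlt_le_trans _ _ _ ha1 (Rmin_r _ _).
pose F := Series (fun k => vonMangoldt S k.+1 * Rpower (INR k.+1) (- s)).
have hF : is_lim_seq (fun N => \sum_(1 <= n < N.+1) vonMangoldt S n * Rpower (INR n) (- s)) F.
  apply/is_series_bigP; apply: Series_correct.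
  apply: (ex_series_bound (fun n => vonMangoldt S n * Rpower (INR n) (- s))
    (fun n => Rabs (vonMangoldt S n) * Rpower (INR n) (- s))) => [n _|].
    rewrite Rabs_mult (Rabs_pos_eq (Rpower _ _)); first lra.
    by left; apply: Rpower_pos.
  exact: ex_series_vonMangoldt.
have eF : (C_derive (L_fun S) (RtoC s) / L_fun S (RtoC s))%C = RtoC (- F).
  have := neg_logder_L S hS (RtoC s) s1.
  have -> : dirichlet (vonMangoldt S) (RtoC s) = RtoC F.
    rewrite /dirichlet /RtoC /F; congr (_, _).
      by apply: Series_ext => k; rewrite /npow_re /Re /Im /= Rmult_0_l cos_0; lra.
    rewrite (Series_ext _ (fun=> 0 * 0)) ?Series_scal_l; first lra.
    by move=> k; rewrite /npow_im /Re /Im /= Rmult_0_l sin_0; lra.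
  move=> h; rewrite RtoC_opp -h; ring.
rewrite eF -RtoC_plus.
suff hfin : Rabs (- F + delta / a - - l) < eps.
  by split; [exact: hfin|exact: (ball_center (0 : R) eps)].
have [N0 hN0] := he0 a (conj a0 ha3).
(* With a fixed, N tends to infinity and (N+1)^(-a) tends to 0; only afterwards is a taken small. *)
have hb : Rbar_le (Rabs (F - delta * ((1 - 0) / a) - l)) (eps / 2 + delta * (6 * a)).
  apply: (is_lim_seq_le_loc (fun N => Rabs (\sum_(1 <= n < N.+1) vonMangoldt S n * Rpower (INR n) (- s)
     - delta * ((1 - Rpower (INR N.+1) (- a)) / a) - l)) (fun=> eps / 2 + delta * (6 * a))).
  - exists N0 => N /leP hN.
    have h1 := hN0 N hN.
    have h2 := ln_increment_partial a N ltac:(lra).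
    set G := \sum_(1 <= n < N.+1) (ln (INR n.+1) - ln (INR n)) * Rpower (INR n) (- a) in h2.
    set V := \sum_(1 <= n < N.+1) vonMangoldt S n * Rpower (INR n) (- s).
    have eq1 : \sum_(1 <= n < N.+1) (vonMangoldt S n / INR n -
        delta * (ln (INR n.+1) - ln (INR n))) * Rpower (INR n) (- a) = V - delta * G.
      rewrite /V /G -rsum_distrr -rsumB; apply: eq_big_nat => n /andP[n0 _].
      have -> : - s = - a + - (1) by rewrite /a; lra.
      rewrite Rpower_plus (Rpower_Ropp _ 1) Rpower_1; last exact: INR_gt0.
      by rewrite /Rdiv; lra.
    rewrite eq1 in h1.
    set H := (1 - _) / a in h2 *.
    have -> : V - delta * H - l = (V - delta * G - l) + delta * (G - H) by lra.
    apply: Rle_trans (Rabs_triang _ _) _; apply: Rplus_le_compat => //.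
    rewrite Rabs_mult !Rabs_pos_eq; try lra.
    by apply: Rmult_le_compat_l; lra.
  - apply: (is_lim_seq_abs _ (F - delta * ((1 - 0) / a) - l)).
    apply: is_lim_seq_minus' (is_lim_seq_const _).
    apply: is_lim_seq_minus' hF _.
    apply: (is_lim_seq_scal_l _ delta ((1 - 0) / a)).
    apply: (is_lim_seq_scal_r _ (/ a) (1 - 0)).
    apply: is_lim_seq_minus' (is_lim_seq_const _) _.
    by apply/(is_lim_seq_incr_1 (fun N => Rpower (INR N) (- a))); apply: INR_power_lim0.
  - exact: is_lim_seq_const.
move: hb => /=; rewrite Rminus_0_r => hb.
have -> : - F + delta / a - - l = - (F - delta * (1 / a) - l) by rewrite /Rdiv; lra.
rewrite Rabs_Ropp; apply: Rle_lt_trans hb _.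
have : a * (4 * (6 * delta)) < eps.
  have := Rmult_lt_compat_r (4 * (6 * delta)) _ _ ltac:(lra) ha2.
  by rewrite /Rdiv Rmult_assoc Rinv_l ?Rmult_1_r; lra.
have := cond_pos eps; lra.
Qed.

(** The logarithms cancel in delta (H_N - ln N) - (W(N) - delta ln N), where H_N is the harmonic sum
    and W the weighted sum. *)
Lemma euler_kronecker_series :
  is_series (fun k => (delta - Lambda S k.+1) / INR k.+1) (delta * euler_gamma - l).
Proof.
apply/(is_series_bigP (fun n => (delta - Lambda S n) / INR n)).
have := is_lim_seq_minus' _ _ _ _ (is_lim_seq_scal_l _ delta _ euler_gamma_lim) hl.
apply: is_lim_seq_ext => N.
have -> : \sum_(1 <= i < N.+1) (delta - Lambda S i) / INR i =
   delta * \sum_(1 <= i < N.+1) / INR i - weighted_sum S N.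
  rewrite -sum_LambdaE sum_n_m_big -rsum_distrr -rsumB.
  by apply: eq_bigr => i _; rewrite /Rdiv; lra.
lra.
Qed.

End Consequences.

Lemma bigO_of_integers S delta rho l C n0 :
  multiplicative_set S -> condition_B S delta rho -> 0 <= C -> (3 < n0)%N ->
  (forall n, (n0 <= n)%N ->
     Rabs (weighted_sum S n - delta * ln (INR n) - l) <= C * Rpower (ln (INR n.-1)) (- rho)) ->
  bigO_pinfty
      (fun x => weighted_sum S (nat_floor x) - (delta * ln x - - l))
      (fun x => / Rpower (ln x) rho).
Proof.
move=> hS [delta0 [rho0 _]] C0 n03 hC.
pose C1 := Rpower (rho / 1) rho; have C10 : 0 < C1 := Rpower_pos _ _.
(* With N the floor of x, ln(N-1) >= ln(x)/2 costs the factor 2^rho, and replacing ln N by ln x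
   costs delta/N <= 2 delta/x, where 1/x <= C1 ln^(-rho) x. *)
exists (C * Rpower 2 rho + delta * (2 * C1)), (INR n0 + 1) => x hx.
have n04 : 4 <= INR n0 by have := leq_INR _ _ n03; rewrite [INR 4]/=; lra.
have [f1 f2] := nat_floor_bounds x ltac:(lra).
set N := nat_floor x in f1 f2 *.
have hN : (n0 <= N)%N.
  by apply/leP; apply: INR_le; lra.
have N0 : 0 < INR N by lra.
have lx : 0 < ln x by apply: ln_gt0; lra.
have px : 0 < Rpower (ln x) rho := Rpower_pos _ _.
rewrite (Rabs_pos_eq (/ _)); last by left; apply: Rinv_0_lt_compat.
have h1 := hC N hN.
have eN : INR N = INR N.-1 + 1.
  by rewrite -S_INR prednK // (leq_trans _ hN) // (leq_trans _ n03).
have h2 : Rpower (ln (INR N.-1)) (- rho) <= Rpower 2 rho * / Rpower (ln x) rho.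
  have -> : Rpower 2 rho * / Rpower (ln x) rho = Rpower (/ 2 * ln x) (- rho).
    rewrite -Rpower_mult_distr //; last lra.
    rewrite !Rpower_Ropp; congr (_ * _).
    by rewrite -Rpower_Ropp /Rpower ln_Rinv; [congr exp|]; lra.
  apply: Rpower_decreasing; last lra.
  split; first lra.
  suff : ln x <= 2 * ln (INR N.-1) by lra.
  have hN1 : x - 2 <= INR N.-1 by lra.
  have -> : 2 * ln (INR N.-1) = ln (INR N.-1 * INR N.-1) by rewrite ln_mult; lra.
  apply: ln_le; nra.
have h3 : 0 <= ln x - ln (INR N) <= 2 * C1 * / Rpower (ln x) rho.
  split; first by have := ln_le _ _ N0 f1; lra.
  have e1 : ln x - ln (INR N) = ln (x / INR N) by rewrite ln_div; lra.
  have h4 : ln (x / INR N) <= / INR N.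
    apply: Rle_trans (ln_le_minus1 _ _) _; first by apply: Rdiv_lt_0_compat; lra.
    apply: (Rmult_le_reg_r (INR N)) => //.
    have -> : (x / INR N - 1) * INR N = x - INR N by field; lra.
    rewrite Rinv_l; lra.
  have h5 : / INR N <= 2 * / x.
    have -> : 2 * / x = / (x / 2) by field; lra.
    apply: Rinv_le_contravar; lra.
  have h6 : / x <= C1 * / Rpower (ln x) rho.
    have := Rpower_ln_le x rho 1 ltac:(lra) rho0 ltac:(lra).
    rewrite -/C1 Rpower_1; last lra.
    move=> h; apply: (Rmult_le_reg_r (x * Rpower (ln x) rho)).
      by apply: Rmult_lt_0_compat; lra.
    have -> : / x * (x * Rpower (ln x) rho) = Rpower (ln x) rho by field; lra.
    by have -> : C1 * / Rpower (ln x) rho * (x * Rpower (ln x) rho) = C1 * x by field; lra.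
  lra.
have -> : weighted_sum S N - (delta * ln x - - l) =
  (weighted_sum S N - delta * ln (INR N) - l) - delta * (ln x - ln (INR N)) by lra.
rewrite /Rminus in h1 *; apply: Rle_trans (Rabs_triang _ _) _.
rewrite Rabs_Ropp Rabs_mult (Rabs_pos_eq delta); last lra.
rewrite (Rabs_pos_eq (ln x + - ln (INR N))); last lra.
have := Rmult_le_compat_l _ _ _ C0 h2.
have := Rmult_le_compat_l _ _ _ (Rlt_le _ _ delta0) (proj2 h3).
lra.
Qed.

(** * Semigroups of prime powers *)

(** Only finitely many generators are at most N, which makes the series in [sum_generators_le] a
    finite sum. *)
Lemma injective_bounded (q : nat -> nat) : injective q ->
  forall N, exists I, forall i, (q i <= N)%N -> (i < I)%N.
Proof.
move=> qi; elim=> [|N [I hI]].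
  have [[i0 e0]|h] := pselect (exists i, q i = 0%N).
    exists i0.+1 => i; rewrite leqn0 => /eqP e.
    by have -> : i = i0 by apply: qi; rewrite e e0.
  by exists 0%N => i; rewrite leqn0 => /eqP e; case: h; exists i.
have [[i0 e0]|h] := pselect (exists i, q i = N.+1).
  exists (maxn I i0.+1) => i; rewrite leq_eqVlt => /orP[/eqP e|hi].
    have -> : i = i0 by apply: qi; rewrite e e0.
    exact: leq_maxr.
  by apply: leq_trans (leq_maxl _ _); apply: hI.
exists I => i; rewrite leq_eqVlt => /orP[/eqP e|hi]; first by case: h; exists i.
exact: hI.
Qed.

Lemma Series_finite (a : nat -> R) I :
  (forall i, (I <= i)%N -> a i = 0) -> Series a = \sum_(0 <= i < I) a i.
Proof.
move=> ha; apply: is_series_unique.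
suff : is_lim_seq (sum_n a) (\sum_(0 <= i < I) a i) by [].
apply: (is_lim_seq_ext_loc (fun=> \sum_(0 <= i < I) a i)); last exact: is_lim_seq_const.
exists I => n /leP hn; rewrite /sum_n sum_n_m_big [RHS](rsum_cat I) ?leqW //.
rewrite [X in _ + X]big1_seq ?Rplus_0_r // => i /andP[_].
by rewrite mem_index_iota => /andP[hi _]; apply: ha.
Qed.

Lemma rsum_reindex_le (q : nat -> nat) (phi : nat -> R) I N : injective q ->
  (forall i, (0 < q i)%N) -> (forall n, (0 < n)%N -> 0 <= phi n) ->
  \sum_(0 <= i < I | (q i <= N)%N) phi (q i) <= \sum_(1 <= n < N.+1) phi n.
Proof.
move=> qi q0 phi0.
have -> : \sum_(0 <= i < I | (q i <= N)%N) phi (q i) =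
    \sum_(0 <= i < I) \sum_(1 <= n < N.+1 | n == q i) phi n.
  rewrite big_mkcond; apply: eq_bigr => i _; case: ifP => hi.
    rewrite (rsum_single _ _ _ _ (q i)) ?iota_uniq ?eqxx //.
      by rewrite mem_index_iota q0 ltnS.
    by move=> n _ /eqP -> /eqP.
  rewrite big1_seq // => n /andP[/eqP ->]; rewrite mem_index_iota ltnS => /andP[_].
  by rewrite hi.
under eq_bigr do rewrite big_mkcond.
rewrite exchange_big /=; apply: rsum_le => n; rewrite mem_index_iota => /andP[n0 _] _.
rewrite -big_mkcond /=.
have [[i [iI e]]|h] := pselect (exists i, i \in index_iota 0 I /\ n = q i).
  rewrite (rsum_single _ _ _ _ i) ?iota_uniq ?e ?eqxx //; first lra.
  by move=> j _ /eqP ej; rewrite (qi _ _ ej) eqxx.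
rewrite big1_seq; first exact: phi0.
by move=> i /andP[/eqP e hi]; case: h; exists i.
Qed.

Lemma geometric_partial x K : 1 < x ->
  / (x - 1) - \sum_(1 <= k < K.+1) / x ^ k = / (x ^ K * (x - 1)).
Proof.
move=> hx; elim: K => [|K IH]; first by rewrite big_geq // /= Rmult_1_l; lra.
rewrite rsum_recr //.
have -> u v w : Rminus u (v + w) = u - v - w by lra.
rewrite IH /=; have p : 0 < x ^ K by apply: pow_lt; lra.
field; lra.
Qed.

(** Let K be the last exponent with q^K <= N. The missing geometric tail is ln q / (q^K (q-1)) <= 2
    ln q / y with y = q^(K+1). Both y >= N and y >= q^2 are used: 1/y = y^(-1/4) y^(-3/4) <=
    N^(-1/4) q^(-3/2). With ln q <= 4 q^(1/4) this stays summable over q. *)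
Lemma generator_tail q N : (1 < q)%N -> (q <= N)%N ->
  0 <= ln (INR q) / (INR q - 1) - \sum_(1 <= k < N.+1 | (q ^ k <= N)%N) ln (INR q) / INR (q ^ k)
    <= Rpower (INR N) (- / 4) * (8 * Rpower (INR q) (- (1 + / 4))).
Proof.
move=> q1 qN; have N0 : (0 < N)%N by apply: leq_trans qN; apply: ltnW.
have x2 := INR_ge2 _ q1; set x := INR q in x2 *.
have lx : 0 <= ln x by apply: ln_ge0; lra.
have /andP[b1 b2] := trunc_log_bounds q1 N0.
set K := trunc_log q N in b1 b2.
have K1 : (0 < K)%N by apply: trunc_log_max => //; rewrite expn1.
have KN : (K < N.+1)%N by rewrite ltnS; apply: leq_trans b1; apply: ltnW; apply: ltn_expl.
have -> : \sum_(1 <= k < N.+1 | (q ^ k <= N)%N) ln x / INR (q ^ k) =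
    ln x * \sum_(1 <= k < K.+1) / x ^ k.
  rewrite (rsum_widen 1 K.+1 N.+1) // -rsum_distrr; apply: eq_big => k.
    rewrite /= ltnS; apply/idP/idP => h.
      rewrite -ltnS -(ltn_exp2l _ _ q1); exact: leq_ltn_trans h b2.
    by apply: leq_trans b1; rewrite leq_exp2l.
  by move=> _; rewrite INR_exp.
have -> : ln x / (x - 1) - ln x * \sum_(1 <= k < K.+1) / x ^ k =
  ln x * (/ (x - 1) - \sum_(1 <= k < K.+1) / x ^ k) by rewrite /Rdiv; lra.
rewrite geometric_partial; last lra.
have pK : 0 < x ^ K by apply: pow_lt; lra.
have i0 : 0 < / (x ^ K * (x - 1)).
  by apply: Rinv_0_lt_compat; apply: Rmult_lt_0_compat; lra.
split; first by apply: Rmult_le_pos; lra.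
pose y := INR (q ^ K.+1)%N.
have ey : y = x ^ K.+1 by rewrite /y INR_exp.
have yN : INR N <= y by apply: leq_INR; apply: ltnW.
have hN := INR_gt0 _ N0.
have y0 : 0 < y by lra.
have c1 : / (x ^ K * (x - 1)) <= 2 * Rpower y (- (1)).
  rewrite Rpower_Ropp Rpower_1 // ey [x ^ _.+1]/=.
  have -> : 2 * / (x * x ^ K) = / (x ^ K * (x / 2)) by field; lra.
  apply: Rinv_le_contravar; first by apply: Rmult_lt_0_compat; lra.
  by apply: Rmult_le_compat_l; lra.
have c2 : Rpower y (- (1)) <= Rpower (INR N) (- / 4) * Rpower x (- (1 + / 2)).
  have -> : - (1) = - / 4 + - (3 / 4) by lra.
  rewrite Rpower_plus; apply: Rmult_le_compat; try by left; apply: Rpower_pos.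
    by apply: Rpower_decreasing; lra.
  have -> : Rpower x (- (1 + / 2)) = Rpower (x ^ 2) (- (3 / 4)).
    rewrite -Rpower_pow; last lra.
    by rewrite Rpower_mult; congr Rpower; rewrite /=; lra.
  apply: Rpower_decreasing; last lra.
  split; first by apply: pow_lt; lra.
  by rewrite ey; apply: Rle_pow; [lra|apply/leP].
have c3 : ln x <= 4 * Rpower x (/ 4).
  by have := ln_le_Rpower x (/ 4) ltac:(lra) ltac:(lra); rewrite Rinv_inv.
have e4 : Rpower x (- (1 + / 4)) = Rpower x (/ 4) * Rpower x (- (1 + / 2)).
  by rewrite -Rpower_plus; congr Rpower; lra.
rewrite e4; set u := Rpower x (/ 4) in c3 *; set w := Rpower x (- (1 + / 2)) in c2 *.
have -> : Rpower (INR N) (- / 4) * (8 * (u * w)) = (4 * u) * (2 * (Rpower (INR N) (- / 4) * w)) by lra.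
by apply: Rmult_le_compat => //; lra.
Qed.

Section Semigroup.
Variables (S : set nat) (p e : nat -> nat) (q : nat -> nat).
Hypotheses (p_inj : injective p) (p_prime : forall i, prime (p i)) (e_gt0 : forall i, (0 < e i)%N).
Hypothesis qE : forall i, q i = (p i ^ e i)%N.
Hypothesis SE : S = semigroup_generated q.

Lemma generator_inj : injective q.
Proof.
move=> i j; rewrite !qE => h; apply: p_inj.
by have [] := prime_power_eq _ _ _ _ (p_prime i) (p_prime j) (e_gt0 i) (e_gt0 j) h.
Qed.

Lemma generator_gt1 i : (1 < q i)%N.
Proof.
by rewrite qE; apply: leq_trans (prime_gt1 (p_prime i)) _; rewrite -{1}(expn1 (p i)) leq_exp2l ?prime_gt1.
Qed.

Lemma generators_of_prime_power l r k : prime r -> (r ^ k = \prod_(i <- l) q i)%N ->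
  forall i, i \in l -> p i = r.
Proof.
move=> pr er i il.
have : (p i %| r ^ k)%N.
  rewrite er (big_rem i) //= qE; apply: dvdn_mulr.
  by rewrite -{1}(expn1 (p i)); apply: dvdn_exp2l.
rewrite Euclid_dvdX // => /andP[]; rewrite dvdn_prime2 // => /eqP.
by [].
Qed.

(** A product of generators equal to a power of p_i involves q_i alone, as the p_j are distinct
    primes; the local factor is therefore 1/(1 - z^e) with e = e_i. *)
Lemma ind_semigroup i k : ind S (p i ^ k) = if (e i %| k)%N then 1 else 0.
Proof.
rewrite /ind; have -> // : ((p i ^ k)%N \in S) = (e i %| k)%N.
apply/idP/idP; rewrite in_setE SE.
  move=> [l hl].
  have hi j : j \in l -> j = i.
    by move=> jl; apply: p_inj; apply: generators_of_prime_power (p_prime i) hl j jl.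
  have : (p i ^ k = p i ^ (e i * size l))%N.
    rewrite hl big_seq (eq_bigr (fun=> q i)); last by move=> j /hi ->.
    by rewrite -big_seq big_const_seq count_predT iter_muln_1 qE expnM.
  by move/(expnI (prime_gt1 (p_prime i))) => ->; apply: dvdn_mulr.
move=> /dvdnP[m ->]; exists (nseq m i).
by rewrite big_nseq iter_muln_1 qE -expnM mulnC.
Qed.

Lemma ind_semigroup_notin r k : prime r -> (forall i, p i <> r) ->
  ind S (r ^ k) = if k == 0%N then 1 else 0.
Proof.
move=> pr hr; rewrite /ind; have -> // : ((r ^ k)%N \in S) = (k == 0%N).
apply/idP/idP; rewrite in_setE SE.
  move=> [[|i l] hl].
    move: hl; rewrite big_nil; case: k => // k h.
    by have := ltn_expl k.+1 (prime_gt1 pr); rewrite h.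
  by case: (hr i); apply: (generators_of_prime_power _ _ _ pr hl); rewrite mem_head.
by move/eqP => ->; exists [::]; rewrite big_nil.
Qed.

Lemma sum_multiples d m : (0 < d)%N ->
  \sum_(1 <= j < m.+1) (if (d %| j)%N then INR d else 0) = INR d * INR (m %/ d).
Proof.
move=> d0; elim: m => [|m IH]; first by rewrite big_geq // div0n Rmult_0_r.
rewrite rsum_recr // IH divnS // plus_INR.
case: (d %| m.+1)%N; rewrite [INR (nat_of_bool _)]/=; lra.
Qed.

(** For f = 1/(1 - z^e), z f'/f is the sum of e z^(em) over m >= 1. This is confirmed through the
    recurrence: if e divides m, the sum counts the multiples of e up to m, each with weight e;
    otherwise every product vanishes. *)
Lemma local_coef_generator i k : (0 < k)%N ->
  local_coef S (p i) k = if (e i %| k)%N then INR (e i) else 0.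
Proof.
apply: (logder_unique _ (fun k => if (e i %| k)%N then INR (e i) else 0)).
  by rewrite ind_semigroup dvdn0.
move=> m; rewrite ind_semigroup.
case: ifP => hm.
  have em : INR m = INR (e i) * INR (m %/ e i) by rewrite Rmult_comm -mult_INR -{1}(divnK hm).
  rewrite Rmult_1_r em -sum_multiples //.
  apply: eq_big_nat => j /andP[j0 jm]; rewrite ind_semigroup.
  case: ifP => hj; last lra.
  by rewrite dvdn_sub //; lra.
rewrite Rmult_0_r big1_seq // => j /andP[_]; rewrite mem_index_iota ltnS => /andP[j0 jm].
case: ifP => hj; last lra.
rewrite ind_semigroup (dvdn_subl jm hj) hm; lra.
Qed.

Lemma local_coef_notin r k : prime r -> (forall i, p i <> r) -> (0 < k)%N ->
  local_coef S r k = 0.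
Proof.
move=> pr hr; apply: (logder_unique _ (fun=> 0)).
  by rewrite ind_semigroup_notin.
move=> m; rewrite ind_semigroup_notin // big1; last by move=> *; lra.
by case: m => [|m] /=; lra.
Qed.

(** At n = q_i^k the value is e_i ln p_i = ln q_i, and the pair (i, k) is determined by n. At all
    other n both sides are 0. *)
Lemma vonMangoldt_semigroup I N n : (forall i, (q i <= N)%N -> (i < I)%N) ->
  (0 < n <= N)%N ->
  vonMangoldt S n =
  \sum_(0 <= i < I) \sum_(1 <= k < N.+1 | n == (q i ^ k)%N) ln (INR (q i)).
Proof.
move=> hI /andP[n0 nN].
have [[i [k [k0 en]]]|h] := pselect (exists i k, (0 < k)%N /\ n = (q i ^ k)%N).
  have uniqik j m : (0 < m)%N -> n = (q j ^ m)%N -> j = i /\ m = k.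
    move=> m0; rewrite en !qE -!expnM => h.
    have hk : (0 < e i * k)%N by rewrite muln_gt0 e_gt0.
    have hm : (0 < e j * m)%N by rewrite muln_gt0 e_gt0.
    have [ep ee] := prime_power_eq _ _ _ _ (p_prime i) (p_prime j) hk hm h.
    have eji : j = i by apply: p_inj.
    split => //; move: ee; rewrite eji => /eqP.
    by rewrite eqn_pmul2l // => /eqP ->.
  have kn : (k < n)%N by rewrite en; apply: ltn_expl; apply: generator_gt1.
  have qn : (q i <= n)%N.
    by rewrite en -{1}(expn1 (q i)) leq_exp2l // generator_gt1.
  rewrite (rsum_single _ _ _ _ i) ?iota_uniq //.
  - rewrite (rsum_single _ _ _ _ k) ?iota_uniq //; last first.
    + by move=> m; rewrite mem_index_iota => /andP[m0 _] /eqP /(uniqik i m m0)[_ ->]; rewrite eqxx.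
    + by rewrite -en.
    + by rewrite mem_index_iota k0 ltnS (leq_trans (ltnW kn)).
    rewrite {1}en qE -expnM vonMangoldt_pfactor //; last by rewrite muln_gt0 e_gt0.
    rewrite local_coef_generator ?muln_gt0 ?e_gt0 // dvdn_mulr // ln_pow_INR //.
    exact: prime_gt0.
  - by rewrite mem_index_iota hI // (leq_trans qn).
  - move=> j _ _ ji; rewrite big1_seq // => m /andP[/eqP em]; rewrite mem_index_iota => /andP[m0 _].
    by have [eji _] := uniqik j m m0 em; rewrite eji eqxx in ji.
rewrite big1; last first.
  move=> i _; rewrite big1_seq // => k /andP[/eqP ek]; rewrite mem_index_iota => /andP[k0 _].
  by case: h; exists i, k.
case: (vonMangoldt_cases S n n0) => // -[r [k [pr k0 en]]].
rewrite en vonMangoldt_pfactor //.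
have [[i ei]|hr] := pselect (exists i, p i = r); last first.
  by rewrite local_coef_notin ?Rmult_0_l // => i ei; apply: hr; exists i.
rewrite -ei local_coef_generator //; case: ifP => [/dvdnP[m em]|_]; last by rewrite Rmult_0_l.
case: h; exists i, m; split; first by move: k0; rewrite em muln_gt0 => /andP[].
by rewrite en -ei qE -expnM em mulnC.
Qed.

Lemma weighted_sum_semigroup I N : (forall i, (q i <= N)%N -> (i < I)%N) ->
  weighted_sum S N = \sum_(0 <= i < I | (q i <= N)%N)
    \sum_(1 <= k < N.+1 | (q i ^ k <= N)%N) ln (INR (q i)) / INR (q i ^ k).
Proof.
move=> hI.
transitivity (\sum_(1 <= n < N.+1) \sum_(0 <= i < I) \sum_(1 <= k < N.+1 | n == (q i ^ k)%N)
    ln (INR (q i)) / INR (q i ^ k)).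
  apply: eq_big_nat => n hn; rewrite (vonMangoldt_semigroup I N n) //.
  rewrite /Rdiv big_distrl; apply: eq_bigr => i _; rewrite big_distrl /=.
  by apply: eq_bigr => k /eqP <-.
rewrite exchange_big /= [RHS]big_mkcond; apply: eq_bigr => i _.
under eq_bigr do rewrite big_mkcond.
rewrite exchange_big /=.
transitivity (\sum_(1 <= k < N.+1 | (q i ^ k <= N)%N) ln (INR (q i)) / INR (q i ^ k)).
  rewrite [RHS]big_mkcond; apply: eq_big_nat => k /andP[k0 _]; rewrite -big_mkcond /=.
  case: ifP => hk.
    rewrite (rsum_single _ _ _ _ (q i ^ k)%N) ?iota_uniq ?eqxx //.
      by rewrite mem_index_iota ltnS hk expn_gt0 (ltnW (generator_gt1 i)).
    by move=> n _ /eqP -> /eqP.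
  rewrite big1_seq // => n /andP[/eqP ->]; rewrite mem_index_iota ltnS => /andP[_].
  by rewrite hk.
case: ifP => // hq; rewrite big1_seq // => k /andP[hk]; rewrite mem_index_iota => /andP[k0 _].
suff : (q i <= N)%N by rewrite hq.
by apply: leq_trans hk; rewrite -{1}(expn1 (q i)) leq_exp2l // generator_gt1.
Qed.

Lemma sum_generators_bound x : 1 <= x ->
  0 <= sum_generators_le q (fun m => ln (INR m) / (INR m - 1)) x - weighted_sum S (nat_floor x)
    <= 40 * Rpower (INR (nat_floor x)) (- / 4).
Proof.
move=> x1; have [f1 f2] := nat_floor_bounds x ltac:(lra).
set N := nat_floor x in f1 f2 *.
have [I hI] := injective_bounded q generator_inj N.
have cond i : (INR (q i) <= x) <-> (q i <= N)%N.
  split => h; last by apply: Rle_trans f1; apply: leq_INR.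
  by rewrite -ltnS; apply/ltP; apply: INR_lt; rewrite S_INR; lra.
have N0 : (0 < N)%N.
  by apply/ltP; apply: INR_lt; rewrite [INR 0]/=; lra.
have -> : sum_generators_le q (fun m => ln (INR m) / (INR m - 1)) x =
    \sum_(0 <= i < I | (q i <= N)%N) ln (INR (q i)) / (INR (q i) - 1).
  rewrite /sum_generators_le (Series_finite _ I).
    rewrite [RHS]big_mkcond; apply: eq_bigr => i _.
    case: Rle_dec => h; first by rewrite (proj1 (cond i) h).
    by case: ifP => // /cond.
  move=> i iI; case: Rle_dec => // h.
  by have := hI i (proj1 (cond i) h); rewrite ltnNge iI.
rewrite (weighted_sum_semigroup I N) // -rsumB.
split.
  by apply: rsum_ge0 => i _ hi; case: (generator_tail (q i) N (generator_gt1 i) hi).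
apply: Rle_trans (_ : \sum_(0 <= i < I | (q i <= N)%N)
   Rpower (INR N) (- / 4) * (8 * Rpower (INR (q i)) (- (1 + / 4))) <= _).
  by apply: rsum_le => i _ hi; case: (generator_tail (q i) N (generator_gt1 i) hi).
rewrite rsum_distrr rsum_distrr.
have h1 := rsum_reindex_le q (fun n => Rpower (INR n) (- (1 + / 4))) I N generator_inj
   (fun i => ltnW (generator_gt1 i)) (fun n _ => Rlt_le _ _ (Rpower_pos _ _)).
(* The sum of q_i^(-5/4) is at most 1 + 4, hence 40 = 8 * 5. *)
have h2 := zeta_partial_le (/ 4) N.+1 ltac:(lra); rewrite Rinv_inv in h2.
have := Rpower_pos (INR N) (- / 4); nra.
Qed.

End Semigroup.

Lemma semigroup_limit S (delta l : R) (p e q : nat -> nat) : 0 < delta ->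
  injective p -> (forall i, prime (p i)) -> (forall i, (0 < e i)%N) ->
  (forall i, q i = (p i ^ e i)%N) -> S = semigroup_generated q ->
  is_lim_seq (fun n => weighted_sum S n - delta * ln (INR n)) l ->
  is_lim (fun x => delta * ln x
                 - sum_generators_le q (fun m => ln (INR m) / (INR m - 1)) x)
              p_infty (- l).
Proof.
move=> d0 pi pp e0 qE SE hl; apply/is_lim_spec => eps /=.
have eps3 : 0 < eps / 3 by have := cond_pos eps; lra.
have l2 : is_lim_seq (fun n => 40 * Rpower (INR n) (- / 4)) 0.
  rewrite -(Rmult_0_r 40); apply: (is_lim_seq_scal_l _ _ 0).
  by apply: INR_power_lim0; lra.
have l3 : is_lim_seq (fun n => delta * / INR n) 0.
  rewrite -(Rmult_0_r delta); exact: (is_lim_seq_scal_l _ _ 0 is_lim_seq_inv_INR).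
move/is_lim_seq_spec: hl => /(_ (mkposreal _ eps3)) [n1 h1].
move/is_lim_seq_spec: l2 => /(_ (mkposreal _ eps3)) [n2 h2].
move/is_lim_seq_spec: l3 => /(_ (mkposreal _ eps3)) [n3 h3].
exists (INR (maxn n1 (maxn n2 n3)) + 1) => x hx.
have x1 : 1 <= x by have := pos_INR (maxn n1 (maxn n2 n3)); lra.
have [f1 f2] := nat_floor_bounds x ltac:(lra).
have [g1 g2] := sum_generators_bound S p e q pi pp e0 qE SE x x1.
set N := nat_floor x in f1 f2 g1 g2.
have hN : (maxn n1 (maxn n2 n3) <= N)%N by apply/leP; apply: INR_le; lra.
move: hN; rewrite !geq_max => /andP[/leP /h1 /= a1 /andP[/leP /h2 /= a2 /leP /h3 /= a3]].
have N0 : 0 < INR N.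
  by have := pos_INR (maxn n1 (maxn n2 n3)); lra.
have b : 0 <= ln x - ln (INR N) <= / INR N.
  split; first by have := ln_le _ _ N0 f1; lra.
  have -> : ln x - ln (INR N) = ln (x / INR N) by rewrite ln_div; lra.
  apply: Rle_trans (ln_le_minus1 _ _) _; first by apply: Rdiv_lt_0_compat; lra.
  apply: (Rmult_le_reg_r (INR N)) => //.
  have -> : (x / INR N - 1) * INR N = x - INR N by field; lra.
  rewrite Rinv_l; lra.
have b1 := Rmult_le_compat_l _ _ _ (Rlt_le _ _ d0) (proj1 b).
have b2 := Rmult_le_compat_l _ _ _ (Rlt_le _ _ d0) (proj2 b).
rewrite Rminus_0_r in a2; rewrite Rminus_0_r in a3.
move/Rabs_lt_between: a1 => a1; move/Rabs_lt_between: a2 => a2; move/Rabs_lt_between: a3 => a3.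
apply/Rabs_lt_between; lra.
Qed.

Theorem theorem3 (S : set nat) (delta rho : R)
    (hS : multiplicative_set S) (hB : condition_B S delta rho) :
  exists gammaS : R,
    is_Euler_Kronecker S delta gammaS /\
    bigO_pinfty
      (fun x => sum_n_m (fun n => Lambda S n / INR n) 1 (nat_floor x)
                - (delta * ln x - gammaS))
      (fun x => / Rpower (ln x) rho) /\
    (ex_series (fun k => (delta - Lambda S k.+1) / INR k.+1) /\
     gammaS = - delta * euler_gamma
              + Series (fun k => (delta - Lambda S k.+1) / INR k.+1)) /\
    (forall q : nat -> nat,
       distinct_prime_powers q -> S = semigroup_generated q ->
       is_lim (fun x => delta * ln x
                 - sum_generators_le q (fun m => ln (INR m) / (INR m - 1)) x)
              p_infty gammaS).
Proof.
have [d0 [r0 _]] := hB.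
have [l [C [n0 [C0 [hn0 hC]]]]] := weighted_sum_asymptotic S delta rho hS hB.
have hl : is_lim_seq (fun n => weighted_sum S n - delta * ln (INR n)) l.
  have lC : is_lim_seq (fun n => C * Rpower (ln (INR n.-1)) (- rho)) 0.
    rewrite -(Rmult_0_r C); exact: (is_lim_seq_scal_l _ _ 0 (ln_power_lim0 rho r0)).
  have h0 : is_lim_seq (fun n => weighted_sum S n - delta * ln (INR n) - l) 0.
    apply/is_lim_seq_abs_0; apply: (is_lim_seq_le_le_loc (fun=> 0) _ _ _ _ _ lC).
      by exists n0 => n /leP /hC h; split => //; apply: Rabs_pos.
    exact: is_lim_seq_const.
  have := is_lim_seq_plus' _ _ _ _ h0 (is_lim_seq_const l); rewrite Rplus_0_l.
  by apply: is_lim_seq_ext => n; lra.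
have hs := euler_kronecker_series S delta hS l hl.
(* The sign flips because L_S'/L_S carries the von Mangoldt sum with a minus sign. *)
exists (- l); split; first exact: euler_kronecker_limit hB _ hl.
split.
  have [K hK] := bigO_of_integers S delta rho l C n0 hS hB C0 hn0 hC.
  exists K; case: hK => M hM; exists M => x hx.
  by rewrite sum_LambdaE //; apply: hM.
split.
  split; first by exists (delta * euler_gamma - l).
  by rewrite (is_series_unique _ _ hs); lra.
move=> q [p [e [pi hpe]]] SE.
by apply: (semigroup_limit S delta l p e q) => // i; case: (hpe i) => ? [].
Qed.
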